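(* Let $\pi=(\pi_i)_{i\ge1}$ be a nonincreasing sequence of strictly positive reals with $\sum_{i\ge1}\pi_i=1$, and assume that $\pi_k\in\mathrm{RV}_{-1/\gamma}$ for some $0<\gamma<1$. Then for every fixed $k\ge1$, as $n\to\infty$, the loop-deleted degree frequencies satisfy $$\vec r_{n,k}^{\,\circ}\longrightarrow\vec r_k,\qquad \bar r_{n,k}^{\,\circ}\longrightarrow\bar r_k\qquad\text{almost surely},$$ and the loop-deleted finite-sample tails satisfy $$\sum_{\ell\ge k}\vec r_{n,\ell}^{\,\circ}\longrightarrow\vec r_{k+},\qquad \sum_{\ell\ge k}\bar r_{n,\ell}^{\,\circ}\longrightarrow\bar r_{k+}\qquad\text{almost surely},$$ where $\vec r_k,\bar r_k$ are the limiting degree masses of the graph with self-loops retained and $\vec r_{k+}=\sum_{\ell\ge k}\vec r_\ell$, $\bar r_{k+}=\sum_{\ell\ge k}\bar r_\ell$. Hence the limiting degree distributions are unchanged by the deletion of self-loops.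
   Context: Regular variation: for a positive sequence $(a_k)_{k\ge1}$ and $\rho\in\mathbb{R}$, write $a_k\in\mathrm{RV}_\rho$ if for every $t>0$, $a_{\lceil tx\rceil}/a_{\lceil x\rceil}\to t^\rho$ as $x\to\infty$ ($x$ real). Sampling: $\xi_1,\xi_2,\ldots$ are i.i.d. random variables with values in $\{1,2,\ldots\}$ and $\mathbb{P}(\xi_1=i)=\pi_i$. Put $V_n=\{\xi_1,\ldots,\xi_n\}$ and $R_n=\#V_n$ (the number of distinct values among the first $n$ samples). Limiting masses: with the Sibuya weights $r_\ell(\gamma)=\dfrac{\gamma\,\Gamma(\ell-\gamma)}{\Gamma(1-\gamma)\Gamma(\ell+1)}$, $\ell\ge1$, set $\vec r_k=\sum_{\ell\ge1}r_\ell(\gamma)\,\mathbb{P}(R_\ell=k)$ and $\bar r_k=\sum_{\ell\ge1}r_\ell(\gamma)\,\mathbb{P}(R_{2\ell}=k)$ for $k\ge1$. Range-renewal graph: for symbols $x,y$ let $W_n(x,y)=\sum_{i=1}^{n-1}\mathbf 1_{\{\xi_i=x,\ \xi_{i+1}=y\}}$. Put $V_n^+(x)=\{y:W_n(x,y)\ge1\}$ and $\bar V_n(x)=\{y:W_n(x,y)+W_n(y,x)\ge1\}$. The retained-loop degrees are $D_n^+(x)=\#V_n^+(x)$ and $\bar D_n(x)=\#\bar V_n(x)$, with frequencies $\vec r_{n,k}=\#\{x\in V_{n-1}:D_n^+(x)=k\}/R_n$ and $\bar r_{n,k}=\#\{x\in V_n:\bar D_n(x)=k\}/R_n$, $k\ge1$.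 Known fact from earlier work (Chen, Xie, Ying): if $\pi$ is as in the claim, then for every fixed $k\ge1$, $\vec r_{n,k}\to\vec r_k$ and $\bar r_{n,k}\to\bar r_k$ almost surely as $n\to\infty$. Loop-deleted versions: for $x\in V_n$, $D_n^{+,\circ}(x)=\#(V_n^+(x)\setminus\{x\})$ and $\bar D_n^{\circ}(x)=\#(\bar V_n(x)\setminus\{x\})$; for $k\ge1$, $\vec r_{n,k}^{\,\circ}=\#\{x\in V_n:D_n^{+,\circ}(x)=k\}/R_n$ and $\bar r_{n,k}^{\,\circ}=\#\{x\in V_n:\bar D_n^{\circ}(x)=k\}/R_n$. *)

(* Defs.v *)
From mathcomp Require Import all_boot all_order all_algebra finmap.
From mathcomp Require Import all_classical all_reals all_analysis.
Set Implicit Arguments.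
Unset Strict Implicit.
Unset Printing Implicit Defensive.
Import Order.TTheory GRing.Theory Num.Theory.
Import numFieldNormedType.Exports.
Local Open Scope classical_set_scope.
Local Open Scope ring_scope.

(* All sequences indexed by {1, 2, ...} in the mathematics (the weights pi, the
   samples, the sequence a below) are functions on nat whose value at index 0
   is never constrained nor used.  The symbols are the positive naturals. *)

Definition regularly_varying (R : realType) (a : nat -> R) (rho : R) : Prop :=
  forall t : R, 0 < t ->
    a `|Num.ceil (t * x)|%N / a `|Num.ceil x|%N @[x --> +oo] --> t `^ rho.

(* Euler's integral, meaningful for s > 0 only. *)
Definition Gamma (R : realType) (s : R) : R :=
  \int[@lebesgue_measure R]_(t in `]0, +oo[) (t `^ (s - 1) * expR (- t)).

Definition sibuya (R : realType) (gamma : R) (l : nat) : R :=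
  gamma * Gamma (l%:R - gamma) / (Gamma (1 - gamma) * Gamma (l.+1)%:R).

Section Sampling.
Context (d : measure_display) (T : measurableType d) (R : realType).
Context (P : probability T R).

(* Every subset of nat is measurable, so A is arbitrary. *)
Definition mutually_independent (xi : nat -> {RV P >-> nat}) : Prop :=
  forall (J : {fset nat}) (A : nat -> set nat),
    (forall i, i \in J -> (1 <= i)%N) ->
    P (\bigcap_(i in [set` J]) (xi i @^-1` A i))
    = (\prod_(i <- J) P (xi i @^-1` A i))%E.

Definition iid_samples (pi : nat -> R) (xi : nat -> {RV P >-> nat}) : Prop :=
  [/\ forall i w, (1 <= i)%N -> (1 <= xi i w)%N,
      mutually_independent xi,
      forall i (A : set nat), (1 <= i)%N ->
        P (xi i @^-1` A) = P (xi 1%N @^-1` A) &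
      forall j, (1 <= j)%N -> P (xi 1%N @^-1` [set j]) = (pi j)%:E].

End Sampling.

(* Cardinality of a finite set; it is 0 on infinite sets, but it is only
   applied below to sets contained in some {s 1, ..., s n}. *)
Definition card_nat (A : set nat) : nat := #|` fset_set A|%fset.

(* The graph of a deterministic sample path s 1, s 2, ... *)
Section Graph.
Variable s : nat -> nat.

Definition V (n : nat) : set nat := [set s i | i in [set i | (1 <= i <= n)%N]].

Definition nrange (n : nat) : nat := card_nat (V n).

Definition W (n x y : nat) : nat :=
  (\sum_(1 <= i < n) ((s i == x) && (s i.+1 == y)))%N.

Definition Vout (n x : nat) : set nat := [set y | (1 <= W n x y)%N].

Definition Vbar (n x : nat) : set nat := [set y | (1 <= W n x y + W n y x)%N].

Definition Dout (n x : nat) : nat := card_nat (Vout n x).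

Definition Dbar (n x : nat) : nat := card_nat (Vbar n x).

Definition Dout_noloop (n x : nat) : nat := card_nat (Vout n x `\ x).

Definition Dbar_noloop (n x : nat) : nat := card_nat (Vbar n x `\ x).

Variable R : realType.

Definition rout (n k : nat) : R :=
  (card_nat [set x | V n.-1 x /\ Dout n x = k])%:R / (nrange n)%:R.

Definition rbar (n k : nat) : R :=
  (card_nat [set x | V n x /\ Dbar n x = k])%:R / (nrange n)%:R.

Definition rout_noloop (n k : nat) : R :=
  (card_nat [set x | V n x /\ Dout_noloop n x = k])%:R / (nrange n)%:R.

Definition rbar_noloop (n k : nat) : R :=
  (card_nat [set x | V n x /\ Dbar_noloop n x = k])%:R / (nrange n)%:R.

End Graph.

Section LimitingMasses.
Context (d : measure_display) (T : measurableType d) (R : realType).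
Context (P : probability T R) (gamma : R) (xi : nat -> {RV P >-> nat}).
Local Open Scope ereal_scope.

Definition sample_path (w : T) : nat -> nat := fun i => xi i w.

Definition rout_lim (k : nat) : \bar R :=
  \sum_(1 <= l <oo)
    ((sibuya gamma l)%:E * P [set w | nrange (sample_path w) l = k]).

Definition rbar_lim (k : nat) : \bar R :=
  \sum_(1 <= l <oo)
    ((sibuya gamma l)%:E * P [set w | nrange (sample_path w) (2 * l)%N = k]).

End LimitingMasses.

(* Main.v *)
(* Write F(t) for the sum over x of 1 - exp(- t q_x), with q_x = - ln (1 - pi_x),
   so that F(n) is the expected number of distinct symbols.  Regular variation of pi
   and the monotone density theorem give the asymptotics of all the derivatives of
   F relative to F; hence the proportion of symbols seen exactly l times is, in
   mean, at least the Sibuya weight r_l in the limit.  Most of those symbols occur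
   at interior, well separated times, and then their degree, with or without
   loops, is the number of distinct values among l (or 2l) almost independent
   neighbours.  This yields asymptotic lower bounds for the mean number of symbols
   of degree >= k and of degree < k; they are sharp because the r_l sum to 1.

   These counts change by a bounded multiple of the number of rare symbols when
   one sample is erased, so by the Efron-Stein inequality their variance is
   O(F(n)).  Chebyshev's inequality and Borel-Cantelli give almost sure
   convergence along sample sizes with F(n) close to j^2.  The number of symbols
   of degree >= k is nondecreasing in n, so the convergence extends to all n, and
   the claims for the frequencies follow by differences and telescoping. *)

Require Import Defs.
From mathcomp Require Import all_boot all_order all_algebra finmap.
From mathcomp Require Import all_classical all_reals all_analysis.
From mathcomp Require Import measurable_realfun.
From mathcomp Require Import ring lra zify.
Set Implicit Arguments.
Unset Strict Implicit.
Unset Printing Implicit Defensive.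
Import Order.TTheory GRing.Theory Num.Theory.
Import numFieldNormedType.Exports.
Local Open Scope classical_set_scope.
Local Open Scope ring_scope.

(** Degrees are not concentrated directly, because the degree of a symbol with many occurrences can
    react to erasures at many times. For a fixed number l of occurrences, erasing one sample can
    change the status of symbols with at most l + 1 occurrences only, and it is the counts of these
    symbols that concentrate. Estimates are one-sided: a lower bound for counts of good symbols and
    an upper bound for the range. The reverse bounds follow because the patterns of degree at least
    k and of degree less than k share the total Sibuya mass 1.

    Regular variation enters through integer dilations: q(N m) is close to N^(-1/gamma) q(m), and
    cutting the sum F into blocks of N indices turns this into F(tau t) ~ F(t) / N with tau =
    N^(-1/gamma). Quotients of such tau come arbitrarily close to 1, which is enough for the
    monotone density theorem, so pi is never inverted. Means are iterated discrete sums over a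
    finite prefix of the path; the probability space enters only when Chebyshev bounds and limiting
    masses are transferred to it. *)

(** * Absolutely summable real sequences *)

Section Summable.
Variable R : realType.
Implicit Types f g : nat -> R.

Definition summable_seq f := exists M, forall n, \sum_(i < n) `|f i| <= M.

(** Sums stay in the reals, where linear arithmetic applies. The limit is meaningful under
    [summable_seq] only, and [nneseries_ssum] links it to extended real series. *)
Definition ssum f : R := limn (series f).

Lemma summable_cvg f : summable_seq f -> cvgn (series f).
Proof.
move=> [M fM]; apply: normed_cvg; apply: nondecreasing_is_cvgn.
  by apply: nondecreasing_series => k _ _ /=.
exists M => _ [n _ <-]; have := fM n.
by rewrite -(big_mkord xpredT (fun i => `|f i|)).
Qed.

Lemma summable_le f g : (forall i, `|f i| <= g i) -> summable_seq g ->
  summable_seq f.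
Proof.
move=> fg [M gM]; exists M => n; apply: le_trans (gM n); apply: ler_sum => i _.
by apply: le_trans (fg i) _; exact: ler_norm.
Qed.

Lemma summableD f g : summable_seq f -> summable_seq g ->
  summable_seq (fun i => f i + g i).
Proof.
move=> [M fM] [N gN]; exists (M + N) => n.
apply: le_trans (lerD (fM n) (gN n)); rewrite -big_split /=.
by apply: ler_sum => i _; exact: ler_normD.
Qed.

Lemma summableZ c f : summable_seq f -> summable_seq (fun i => c * f i).
Proof.
move=> [M fM]; exists (`|c| * M) => n.
under eq_bigr do rewrite normrM.
by rewrite -mulr_sumr ler_wpM2l.
Qed.

Lemma summable_ge0 f M : (forall i, 0 <= f i) ->
  (forall n, \sum_(i < n) f i <= M) -> summable_seq f.
Proof.
by move=> f0 fM; exists M => n; under eq_bigr do rewrite ger0_norm //.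
Qed.

Lemma ssumD f g : summable_seq f -> summable_seq g ->
  ssum (fun i => f i + g i) = ssum f + ssum g.
Proof. by move=> sf sg; rewrite -lim_seriesD //; exact: summable_cvg. Qed.

Lemma ssumZ c f : summable_seq f -> ssum (fun i => c * f i) = c * ssum f.
Proof. by move=> sf; rewrite -[RHS]lim_seriesZ //; exact: summable_cvg. Qed.

Lemma ssumB f g : summable_seq f -> summable_seq g ->
  ssum (fun i => f i - g i) = ssum f - ssum g.
Proof. by move=> sf sg; rewrite -lim_seriesB //; exact: summable_cvg. Qed.

Lemma ler_ssum f g : summable_seq f -> summable_seq g ->
  (forall i, f i <= g i) -> ssum f <= ssum g.
Proof. by move=> sf sg; apply: lim_series_le; exact: summable_cvg. Qed.

Lemma partial_le_ssum f n : (forall i, 0 <= f i) -> summable_seq f ->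
  \sum_(i < n) f i <= ssum f.
Proof.
move=> f0 sf; rewrite -(big_mkord xpredT).
apply: (@nondecreasing_cvgn_le _ (series f)); last exact: summable_cvg.
by apply: nondecreasing_series.
Qed.

Lemma ssum_ge0 f : (forall i, 0 <= f i) -> summable_seq f -> 0 <= ssum f.
Proof. by move=> f0 sf; have := partial_le_ssum 0 f0 sf; rewrite big_ord0. Qed.

Lemma ssum_le_bound f B : summable_seq f -> (forall n, \sum_(i < n) f i <= B) ->
  ssum f <= B.
Proof.
move=> sf fB; apply: limr_le; first exact: summable_cvg.
by apply: nearW => n; rewrite /series /= big_mkord.
Qed.

Lemma ssum_cvg f : summable_seq f -> (\sum_(i < n) f i) @[n --> \oo] --> ssum f.
Proof.
move=> /summable_cvg cf.
rewrite (_ : (fun n => _) = series f) //.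
by apply/funext => n; rewrite /series /= big_mkord.
Qed.

Lemma nneseries_ssum f : (forall i, 0 <= f i) -> summable_seq f ->
  (\sum_(0 <= i <oo) (f i)%:E)%E = (ssum f)%:E.
Proof.
move=> f0 sf; apply/cvg_lim => //.
have -> : (fun n => (\sum_(0 <= i < n) (f i)%:E)%E) =
          (fun n => (\sum_(i < n) f i)%:E).
  by apply/funext => n; rewrite sumEFin big_mkord.
by apply: cvg_EFin; [exact: nearW|exact: ssum_cvg].
Qed.

End Summable.

Definition upd (s : nat -> nat) (i a : nat) : nat -> nat :=
  fun j => if j == i then a else s j.

Lemma upd_comm s i j a b : i != j -> upd (upd s i a) j b = upd (upd s j b) i a.
Proof.
move=> ij; apply/funext => k; rewrite /upd.
by case: (eqVneq k j) => // ->; rewrite eq_sym (negbTE ij).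
Qed.

Lemma upd_upd s i a b : upd (upd s i a) i b = upd s i b.
Proof. by apply/funext => k; rewrite /upd; case: eqP. Qed.

(** * Iterated expectations and the Efron-Stein inequality *)

Section DiscreteExpectation.
Variable R : realType.
Variable p : nat -> R.
Hypothesis p_ge0 : forall a, 0 <= p a.
Hypothesis p_summable : summable_seq p.
Hypothesis p_sum1 : ssum p = 1.

Definition bounded_real (X : Type) (f : X -> R) := exists M, forall x, `|f x| <= M.

Definition expect1 (g : nat -> R) : R := ssum (fun a => p a * g a).

Lemma bounded_realD X (f g : X -> R) : bounded_real f -> bounded_real g ->
  bounded_real (fun x => f x + g x).
Proof.
move=> [M fM] [N gN]; exists (M + N) => x.
by apply: le_trans (ler_normD _ _) _; exact: lerD.
Qed.

Lemma bounded_realM X (f g : X -> R) : bounded_real f -> bounded_real g ->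
  bounded_real (fun x => f x * g x).
Proof.
move=> [M fM] [N gN]; exists (M * N) => x.
by rewrite normrM; apply: ler_pM.
Qed.

Lemma bounded_cst X (c : R) : bounded_real (fun _ : X => c).
Proof. by exists `|c|. Qed.

Lemma bounded_realZ X (c : R) (f : X -> R) : bounded_real f ->
  bounded_real (fun x => c * f x).
Proof. by apply: bounded_realM; exact: bounded_cst. Qed.

Lemma bounded_realB X (f g : X -> R) : bounded_real f -> bounded_real g ->
  bounded_real (fun x => f x - g x).
Proof.
move=> bf [N gN]; apply: bounded_realD => //.
by exists N => x; rewrite normrN.
Qed.

Lemma bounded_comp X Y (h : Y -> X) (f : X -> R) : bounded_real f ->
  bounded_real (fun y => f (h y)).
Proof. by move=> [M fM]; exists M => y. Qed.

Lemma bounded_sum X I (r : seq I) (F : I -> X -> R) :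
  (forall i, bounded_real (F i)) -> bounded_real (fun x => \sum_(i <- r) F i x).
Proof.
move=> bF; elim: r => [|i r IH].
  by exists 0 => x; rewrite big_nil normr0.
have [M HM] := bounded_realD (bF i) IH.
by exists M => x; rewrite big_cons.
Qed.

Lemma bounded_bool X (b : X -> bool) : bounded_real (fun x => (b x)%:R).
Proof. by exists 1 => x; rewrite ger0_norm // lern1 leq_b1. Qed.

Lemma expect1_summable g : bounded_real g -> summable_seq (fun a => p a * g a).
Proof.
move=> [M gM]; apply: (@summable_le _ _ (fun a => M * p a)); last exact: summableZ.
by move=> i; rewrite normrM ger0_norm // mulrC ler_wpM2r.
Qed.
Hint Resolve expect1_summable : core.

Lemma expect1D f g : bounded_real f -> bounded_real g ->
  expect1 (fun a => f a + g a) = expect1 f + expect1 g.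
Proof.
move=> bf bg; rewrite /expect1 -ssumD; [|exact: expect1_summable..].
by congr ssum; apply/funext => a; rewrite mulrDr.
Qed.

Lemma expect1Z c g : bounded_real g -> expect1 (fun a => c * g a) = c * expect1 g.
Proof.
move=> bg; rewrite /expect1 -ssumZ; last exact: expect1_summable.
by congr ssum; apply/funext => a; rewrite mulrCA.
Qed.

Lemma expect1_cst c : expect1 (fun=> c) = c.
Proof.
rewrite /expect1 (_ : (fun _ => _) = (fun a => c * p a)); last first.
  by apply/funext => a; rewrite mulrC.
by rewrite ssumZ // p_sum1 mulr1.
Qed.

Lemma le_expect1 f g : bounded_real f -> bounded_real g ->
  (forall a, f a <= g a) -> expect1 f <= expect1 g.
Proof.
move=> bf bg fg; apply: ler_ssum; [exact: expect1_summable..|].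
by move=> a; rewrite ler_wpM2l.
Qed.

Lemma expect1_eq1 x : expect1 (fun a => (a == x)%:R) = p x.
Proof.
rewrite /expect1; apply/cvg_lim => //; apply: cvg_near_cst.
near=> n; rewrite /series /= (bigD1_seq x) ?iota_uniq //=; last first.
  by rewrite mem_iota add0n subn0; near: n; exact: nbhs_infty_gt.
rewrite eqxx mulr1 big1 ?addr0 // => a ax.
by rewrite (negbTE ax) mulr0.
Unshelve. all: by end_near. Qed.

Lemma norm_expect1_le g M : (forall a, `|g a| <= M) -> `|expect1 g| <= M.
Proof.
move=> gM; have bg : bounded_real g by exists M.
rewrite ler_norml -[X in - X]expect1_cst -{2}[M]expect1_cst.
have bM := bounded_cst nat M; apply/andP; split.
  rewrite -mulN1r -expect1Z //.
  apply: le_expect1 => //; first exact: bounded_realZ.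
  by move=> a; rewrite mulN1r lerNl; have := gM a; rewrite ler_norml => /andP[? _]; rewrite lerNl.
by apply: le_expect1 => // a; exact: le_trans (ler_norm _) (gM a).
Qed.

(** Integrates out the coordinates listed in [l], the head outermost, and reads all others off [s].
    This plays the role of a product measure on finitely many coordinates; [path_prob] identifies it
    with the law of the samples. *)
Fixpoint expect (l : seq nat) (f : (nat -> nat) -> R) (s : nat -> nat) : R :=
  if l is m :: l' then expect1 (fun a => expect l' f (upd s m a)) else f s.

Lemma bounded_expect l f : bounded_real f -> bounded_real (expect l f).
Proof.
move=> [M fM]; exists M; elim: l => [//|m l IH] s /=.
by apply: norm_expect1_le => a; exact: IH.
Qed.

Lemma bounded_expect_upd l f s m : bounded_real f ->
  bounded_real (fun a => expect l f (upd s m a)).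
Proof.
by move=> bf; apply: (bounded_comp (fun a => upd s m a)); exact: bounded_expect.
Qed.
Hint Resolve bounded_expect bounded_expect_upd : core.

Lemma expectD l f g s : bounded_real f -> bounded_real g ->
  expect l (fun t => f t + g t) s = expect l f s + expect l g s.
Proof.
move=> bf bg; elim: l s => [//|m l IH] s /=.
by rewrite -expect1D; [|auto..]; congr expect1; apply/funext => a; rewrite IH.
Qed.

Lemma expectZ l c f s : bounded_real f ->
  expect l (fun t => c * f t) s = c * expect l f s.
Proof.
move=> bf; elim: l s => [//|m l IH] s /=.
by rewrite -expect1Z; [|auto..]; congr expect1; apply/funext => a; rewrite IH.
Qed.

Lemma expectB l f g s : bounded_real f -> bounded_real g ->
  expect l (fun t => f t - g t) s = expect l f s - expect l g s.
Proof.
move=> bf bg; rewrite -mulN1r -expectZ // -expectD //; last exact: bounded_realZ.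
by congr expect; apply/funext => t; rewrite mulN1r.
Qed.

Lemma expect_cst l c s : expect l (fun=> c) s = c.
Proof.
elim: l s => [//|m l IH] s /=.
by under eq_fun do rewrite IH; exact: expect1_cst.
Qed.

Lemma le_expect l f g s : bounded_real f -> bounded_real g ->
  (forall t, f t <= g t) -> expect l f s <= expect l g s.
Proof.
move=> bf bg fg; elim: l s => [//|m l IH] s /=.
by apply: le_expect1; auto.
Qed.

Lemma expect_sum l I (r : seq I) (F : I -> (nat -> nat) -> R) s :
  (forall i, bounded_real (F i)) ->
  expect l (fun t => \sum_(i <- r) F i t) s = \sum_(i <- r) expect l (F i) s.
Proof.
move=> bF; elim: r => [|i r IH].
  by rewrite big_nil; under eq_fun do rewrite big_nil; exact: expect_cst.
rewrite big_cons -IH -expectD //; last exact: bounded_sum.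
by congr expect; apply/funext => t; rewrite big_cons.
Qed.

Lemma expect_upd l m a f s : m \notin l ->
  expect l f (upd s m a) = expect l (fun t => f (upd t m a)) s.
Proof.
elim: l s => [//|k l IH] s; rewrite inE negb_or => /andP[mk ml] /=.
congr expect1; apply/funext => b.
by rewrite upd_comm // IH.
Qed.

Lemma sqr_expect_le l f s : bounded_real f ->
  expect l f s ^+ 2 <= expect l (fun t => f t ^+ 2) s.
Proof.
move=> bf; set m := expect l f s.
have b2 : bounded_real (fun t => f t ^+ 2) by exact: bounded_realM.
have : 0 <= expect l (fun t => (f t - m) ^+ 2) s.
  rewrite -(expect_cst l 0 s); apply: le_expect.
  - exact: bounded_cst.
  - by apply: bounded_realM; apply: bounded_realB => //; exact: bounded_cst.
  - by move=> t; exact: sqr_ge0.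
rewrite (_ : (fun t => _) = (fun t => (f t ^+ 2 + (- (2 * m)) * f t) + m ^+ 2)).
  rewrite expectD; [|apply: bounded_realD => //; exact: bounded_realZ|exact: bounded_cst].
  rewrite expectD //; last exact: bounded_realZ.
  rewrite expectZ // expect_cst -/m; lra.
by apply/funext => t; ring.
Qed.

(** With blanking in place of resampling, every increment is a function of a single path, so that
    the sum over [i] can be bounded path by path. *)
Lemma efron_stein l f s : uniq l -> bounded_real f ->
  expect l (fun t => f t ^+ 2) s - expect l f s ^+ 2 <=
  \sum_(i <- l) expect l (fun t => (f t - f (upd t i 0)) ^+ 2) s.
Proof.
move=> + bf; elim: l s => [|m l IH] s; first by rewrite /= big_nil subrr.
move=> /andP[ml ul].
have bsq h : bounded_real h -> bounded_real (fun t : nat -> nat => h t ^+ 2 : R).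
  by move=> bh; exact: bounded_realM.
have bu i : bounded_real (fun t => f (upd t i 0)).
  exact: (bounded_comp (fun t => upd t i 0)).
have bd i : bounded_real (fun t => (f t - f (upd t i 0)) ^+ 2).
  by apply: bsq; exact: bounded_realB.
pose D t := expect l f t - expect l f (upd t m 0).
have be0 : bounded_real (fun t => expect l f (upd t m 0)).
  by apply: (bounded_comp (fun t => upd t m 0)); exact: bounded_expect.
have bD : bounded_real D by exact: bounded_realB (bounded_expect _ bf) be0.
(* Splitting off the outermost coordinate: conditional variances are handled by
   induction, and the variance of the conditional mean is at most its mean
   squared deviation from the value with that coordinate blanked. *)
have H1 : expect1 (fun a => expect l (fun t => f t ^+ 2) (upd s m a)
     - expect l f (upd s m a) ^+ 2) <=
   \sum_(i <- l) expect (m :: l) (fun t => (f t - f (upd t i 0)) ^+ 2) s.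
  have -> : \sum_(i <- l) expect (m :: l) (fun t => (f t - f (upd t i 0)) ^+ 2) s =
    expect [:: m] (fun t => \sum_(i <- l) expect l (fun t => (f t - f (upd t i 0)) ^+ 2) t) s.
    by rewrite expect_sum // => i; exact: bounded_expect.
  apply: le_expect1.
  - apply: bounded_realB; first exact/bounded_expect_upd/bsq.
    by apply: bounded_realM; exact: bounded_expect_upd.
  - apply: (@bounded_sum _ _ l (fun i a =>
      expect l (fun t => (f t - f (upd t i 0)) ^+ 2) (upd s m a))) => i.
    exact: bounded_expect_upd.
  - by move=> a; exact: IH.
have H2 : expect1 (fun a => expect l f (upd s m a) ^+ 2) - expect (m :: l) f s ^+ 2
   <= expect (m :: l) (fun t => (f t - f (upd t m 0)) ^+ 2) s.
  set c := expect l f (upd s m 0).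
  have : expect1 (fun a => D (upd s m a) ^+ 2) <=
         expect (m :: l) (fun t => (f t - f (upd t m 0)) ^+ 2) s.
    apply: le_expect1 => //.
    - by apply: (@bounded_comp _ _ (fun a => upd s m a) (fun t => D t ^+ 2)); exact: bsq.
    - exact: bounded_expect_upd.
    - move=> a; apply: le_trans (sqr_expect_le _ _ _); last exact: bounded_realB.
      by rewrite expectB // -(expect_upd 0 f _ ml) /D.
  apply: le_trans.
  set g := (fun a => expect l f (upd s m a)).
  have bg : bounded_real g by exact: bounded_expect_upd.
  have -> : (fun a => D (upd s m a) ^+ 2) =
            (fun a => (g a ^+ 2 + (- (2 * c)) * g a) + c ^+ 2).
    by apply/funext => a; rewrite /D upd_upd -/c /g; ring.
  have bg2 : bounded_real (fun a => g a ^+ 2) by exact: bounded_realM.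
  rewrite expect1D; [|apply: bounded_realD => //; exact: bounded_realZ|exact: bounded_cst].
  rewrite expect1D //; last exact: bounded_realZ.
  rewrite expect1Z // expect1_cst /= -/g.
  rewrite -subr_ge0 (_ : _ - _ = (expect1 g - c) ^+ 2) ?sqr_ge0 //; ring.
rewrite big_cons [X in _ <= X]addrC.
have E1 : expect1 (fun a => expect l (fun t => f t ^+ 2) (upd s m a)
     - expect l f (upd s m a) ^+ 2) = expect (m :: l) (fun t => f t ^+ 2) s -
     expect1 (fun a => expect l f (upd s m a) ^+ 2).
  rewrite -mulN1r -expect1Z -?expect1D /=; first by congr expect1; apply/funext => a; rewrite mulN1r.
  - exact/bounded_expect_upd/bsq.
  - by apply: bounded_realZ; apply: bounded_realM; exact: bounded_expect_upd.
  - by apply: bounded_realM; exact: bounded_expect_upd.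
rewrite E1 in H1; have := lerD H1 H2.
by rewrite addrA subrK.
Qed.

Lemma expect_ext l f g s : (forall t, f t = g t) -> expect l f s = expect l g s.
Proof. by move=> fg; congr expect; apply/funext. Qed.

(* [G] may depend on the coordinates outside [K] only. *)
Lemma expect_prod l (K : pred nat) (h : nat -> nat -> R) (G : (nat -> nat) -> R) s :
  uniq l -> (forall i, bounded_real (h i)) -> bounded_real G ->
  (forall t i a, K i -> G (upd t i a) = G t) ->
  expect l (fun t => (\prod_(i <- l | K i) h i (t i)) * G t) s =
  (\prod_(i <- l | K i) expect1 (h i)) * expect l G s.
Proof.
move=> ul bh bG GK.
have bP r : bounded_real (fun t : nat -> nat => (\prod_(i <- r | K i) h i (t i)) * G t).
  apply: bounded_realM => //; elim: r => [|i r IH].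
    by exists 1 => x; rewrite big_nil normr1.
  have [M HM] : bounded_real (fun t : nat -> nat => h i (t i)) := bounded_comp (fun t => t i) (bh i).
  have [N HN] := IH; exists (Num.max (M * N) N) => t; rewrite big_cons.
  case: ifP => Ki; last by apply: le_trans (HN t) _; rewrite le_max lexx orbT.
  by rewrite normrM le_max ler_pM.
elim: l s ul => [|m l IH] s; first by rewrite /= !big_nil.
move=> /andP[ml ul] /=.
have EG a : K m -> expect l G (upd s m a) = expect l G s.
  by move=> Km; rewrite expect_upd //; apply: expect_ext => t; exact: GK.
case: (boolP (K m)) => Km; last first.
  rewrite big_cons (negbTE Km).
  under eq_fun do under expect_ext do rewrite big_cons (negbTE Km).
  under eq_fun do rewrite IH //.
  by rewrite expect1Z //; exact: bounded_expect_upd.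
rewrite big_cons Km.
have -> : (fun a => expect l (fun t => \prod_(i <- m :: l | K i) h i (t i) * G t) (upd s m a))
    = (fun a => (\prod_(i <- l | K i) expect1 (h i) * expect l G s) * h m a).
  apply/funext => a; rewrite expect_upd //.
  transitivity (expect l (fun t => h m a * ((\prod_(i <- l | K i) h i (t i)) * G t)) s).
    apply: expect_ext => t; rewrite big_cons Km GK // {1}/upd eqxx mulrA.
    congr (_ * _ * _); rewrite [LHS]big_seq_cond [RHS]big_seq_cond.
    apply: eq_bigr => i /andP[il _]; rewrite /upd; case: eqP => // im.
    by rewrite -im il in ml.
  by rewrite expectZ // IH // mulrC.
rewrite expect1Z //.
rewrite /= (_ : (fun a => _) = fun=> expect l G s); last first.
  by apply/funext => a; exact: EG.
by rewrite expect1_cst mulrC mulrA.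
Qed.

(** The mean over a word of [k] independent letters, freed from positions: the neighbours of every
    admissible set of occurrences then give the same number. *)
Fixpoint expect_list (k : nat) (Q : seq nat -> R) : R :=
  if k is k'.+1 then expect1 (fun a => expect_list k' (fun v => Q (a :: v)))
  else Q [::].

(** Coordinates outside [js] integrate to 1, and a subsequence meets the remaining ones in the order
    of [l], so the iterated sums match without being exchanged. *)
Lemma expect_map js l Q s : uniq l -> uniq js -> subseq js l -> bounded_real Q ->
  expect l (fun t => Q (map t js)) s = expect_list (size js) Q.
Proof.
elim: l js Q s => [|m l IH] js Q s; first by move=> _ _ /eqP ->.
case: js => [|j js] /andP[ml ul].
  by move=> _ _ _; exact: (expect_cst (m :: l) (Q [::]) s).
rewrite [subseq _ _]/=; case: (eqVneq j m) => [-> ujs sub bQ|jm ujs sub bQ].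
  move: ujs => /= /andP[mjs ujs]; congr expect1; apply/funext => a.
  rewrite expect_upd // -(IH js (fun v => Q (a :: v)) s) //; last exact: (bounded_comp (cons a)).
  apply: expect_ext => t; rewrite /upd eqxx; congr (Q (_ :: _)).
  apply/eq_in_map => i ijs; case: eqP => // im.
  by rewrite -im ijs in mjs.
change (expect1 (fun a => expect l (fun t => Q (map t (j :: js))) (upd s m a)) =
  expect_list (size (j :: js)) Q).
rewrite -[RHS]expect1_cst; congr expect1; apply/funext => a.
rewrite (expect_upd a _ s ml) -(IH (j :: js) Q s) //.
apply: expect_ext => t; congr Q; apply/eq_in_map => i /(mem_subseq sub) il.
by rewrite /upd; case: eqP => // im; rewrite -im il in ml.
Qed.

Lemma le_expect_list k Q Q' : bounded_real Q -> bounded_real Q' ->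
  (forall v, size v = k -> Q v <= Q' v) -> expect_list k Q <= expect_list k Q'.
Proof.
elim: k Q Q' => [|k IH] Q Q' bQ bQ' QQ' /=; first exact: QQ'.
have be q : bounded_real q -> bounded_real (fun a => expect_list k (fun v => q (a :: v))).
  move=> [M HM]; exists M => a.
  elim: k q HM {IH QQ'} a => [|k IH] q HM a //=.
  by apply: norm_expect1_le => b; apply: (IH (fun v => q (a :: v))).
apply: le_expect1 => [||a]; [exact: be..|].
by apply: IH => [||v vk]; [exact: (bounded_comp (cons a))..|apply: QQ'; rewrite /= vk].
Qed.

(** A union bound over the letters. It serves to keep [x] away from the neighbours of its prescribed
    occurrences at a cost of first order in [p x]. *)
Lemma expect_list_notin k q x : bounded_real q -> (forall v, 0 <= q v <= 1) ->
  expect_list k q - k%:R * p x <=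
  expect_list k (fun v => q v * (x \notin v)%:R).
Proof.
move=> bq q01; pose l := iota 0 k; pose s0 : nat -> nat := id.
have ul : uniq l by exact: iota_uniq.
have bn : bounded_real (fun v : seq nat => (x \notin v)%:R : R).
  exact: bounded_bool.
have sl : k = size l by rewrite size_iota.
have bm q' : bounded_real q' -> bounded_real (fun t : nat -> nat => q' (map t l) : R).
  exact: (bounded_comp (fun t : nat -> nat => map t l)).
have bx i : bounded_real (fun t : nat -> nat => (t i == x)%:R : R).
  exact: bounded_bool.
rewrite {1 3}sl -!(@expect_map l l _ s0) //; last exact: bounded_realM.
have -> : k%:R * p x = expect l (fun t => \sum_(i <- l) (t i == x)%:R) s0.
  rewrite expect_sum //.
  rewrite (eq_big_seq (fun=> p x)); last first.
    move=> i il; rewrite -expect1_eq1.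
    have := @expect_map [:: i] l (fun v => (head 0%N v == x)%:R) s0 ul isT.
    rewrite sub1seq => /(_ il)/= <- //; exact: bounded_bool.
  by rewrite big_const_seq count_predT -sl iter_addr_0 mulr_natl.
rewrite -expectB; [|exact: bm|exact: bounded_sum].
apply: le_expect => [||t].
- by apply: bounded_realB; [exact: bm|exact: bounded_sum].
- by apply: (bm (fun v => q v * (x \notin v)%:R)); exact: bounded_realM.
case: (boolP (x \in map t l)) => /= [xt|_]; last first.
  by rewrite mulr1 lerBlDr lerDl; apply: sumr_ge0 => i _.
rewrite mulr0 subr_le0; have /andP[_ q1] := q01 (map t l); apply: le_trans q1 _.
move/mapP: xt => [i il ->]; rewrite (bigD1_seq i) //= eqxx lerDl.
by apply: sumr_ge0.
Qed.
End DiscreteExpectation.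

(** * Occurrences of a symbol and their neighbours *)

Section Combinatorics.
Local Open Scope nat_scope.

Definition visited (s : nat -> nat) (n : nat) : seq nat := map s (iota 1 n).

Definition positions (s : nat -> nat) (n x : nat) : seq nat :=
  [seq i <- iota 1 n | s i == x].

(* Increasing lists of [l] positions in [m, m + w) with gaps at least 3, so that
   the neighbours of distinct positions are distinct and not themselves listed. *)
Fixpoint spaced (l m w : nat) : seq (seq nat) :=
  if l is l'.+1
  then [seq i :: J | i <- iota m w, J <- spaced l' i.+3 (m + w - i.+3)]
  else [:: [::]].

Definition nbhd (b : bool) (i : nat) : seq nat :=
  if b then [:: i.-1; i.+1] else [:: i.+1].

Definition neighbours (b : bool) (I : seq nat) : seq nat :=
  flatten [seq nbhd b i | i <- I].

Lemma size_neighbours b I : size (neighbours b I) = (b.+1 * size I).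
Proof.
elim: I => [|i I IH]; first by rewrite muln0.
by rewrite /neighbours /= size_cat -/(neighbours b I) IH mulnS; case: b {IH}.
Qed.

(** Induction on [l]: the tail starts at [i.+3] or later, so its neighbours are at least [i.+2],
    strictly beyond [i] and its own neighbours. *)
Lemma spacedP b l m w I : 0 < m -> I \in spaced l m w ->
  [/\ size I = l, all (fun i => m <= i < m + w) I,
      pairwise ltn I, pairwise ltn (neighbours b I) &
      all (fun j => (m.-1 <= j <= m + w) && (j \notin I)) (neighbours b I)].
Proof.
elim: l m w I => [|l IH] m w I m0; first by rewrite inE => /eqP ->.
move=> /allpairsPdep[i [J [iw JI ->]]].
move: iw; rewrite mem_iota => /andP[mi iw].
have [<- Jw pJ pnJ nJ] := IH i.+3 _ J (ltn0Sn _) JI.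
have Jw' j : j \in J -> i.+3 <= j < m + w.
  by move=> /(allP Jw); lia.
have nJ' j : j \in neighbours b J -> (i.+2 <= j <= m + w) && (j \notin J).
  by move=> jJ; have /andP[] := allP nJ j jJ; have := allP nJ j jJ; case: (j \notin J) => /=; 
    case: J JI {nJ pnJ pJ IH} Jw Jw' jJ => // k J _ Jw /(_ k); rewrite inE eqxx => /(_ isT); lia.
split=> //=.
- apply/andP; split; first by rewrite mi iw.
  by apply/allP => j /Jw'; lia.
- by rewrite pJ andbT; apply/allP => j /Jw'; rewrite /=; lia.
- rewrite /neighbours /= pairwise_cat pnJ !andbT; apply/andP; split.
    apply/allrelP => j k ji /nJ' /andP[+ _].
    by move: ji; case: b {IH pnJ nJ nJ'}; rewrite !inE; lia.
  by case: b {IH pnJ nJ nJ'} => //=; rewrite !andbT; lia.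
- apply/allP => j; rewrite mem_cat => /orP[|].
    move=> jb; apply/andP; split.
      by move: jb; case: b {IH pnJ nJ nJ'} => /=; rewrite !inE; lia.
    rewrite inE negb_or; apply/andP; split.
      by move: jb; case: b {IH pnJ nJ nJ'} => /=; rewrite !inE; lia.
    apply/negP => /Jw'; move: jb.
    by case: b {IH pnJ nJ nJ'} => /=; rewrite !inE; lia.
  move=> /nJ'/andP[jw jJ]; apply/andP; split; first lia.
  by rewrite inE negb_or jJ andbT; lia.
Qed.

Lemma spaced_uniq l m w : uniq (spaced l m w).
Proof.
elim: l m w => [//|l IH] m w /=; apply: allpairs_uniq_dep.
- exact: iota_uniq.
- by move=> i _; exact: IH.
- by move=> [i I] [j J] /= _ _ [-> ->].
Qed.

Lemma expSn_sub v l : v.+1 ^ l.+1 <= v ^ l.+1 + l.+1 * v.+1 ^ l.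
Proof.
elim: l => [|l IH]; first by rewrite !expn1 !expn0; lia.
rewrite [in leqLHS]expnS; apply: leq_trans (leq_mul (leqnn _) IH) _.
have : v ^ l.+1 <= v.+1 ^ l.+1 by rewrite leq_exp2r.
rewrite (expnS v l.+1) (expnS v.+1 l); nia.
Qed.

(** The discrete form of comparing the sum with the integral of x^l over [0, v]; [expSn_sub] is the
    mean value bound that telescopes. *)
Lemma sum_expn_ge v l : v ^ l.+1 <= l.+1 * \sum_(j < v) j.+1 ^ l.
Proof.
elim: v => [|v IH]; first by rewrite exp0n.
rewrite big_ord_recr /= mulnDr; apply: leq_trans (expSn_sub v l) _.
by rewrite leq_add2r.
Qed.

(** To leading order this is the binomial count w^l / l!, the origin of the factorial in the Sibuya
    weights. Fixing the first position leaves a shorter window, and summing the induction bound over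
    window lengths is [sum_expn_ge]. *)
Lemma size_spaced l m w : (w - 3 * l) ^ l <= size (spaced l m w) * l`!.
Proof.
elim: l m w => [//|l IH] m w; rewrite [spaced _ _ _]/= size_allpairs_dep.
set v := w - 3 * l.+1.
rewrite factS mulnCA; apply: leq_trans (sum_expn_ge v l) _.
rewrite leq_mul2l /= sumnE big_map big_distrl /= -[m in iota m w]addn0 iotaDl big_map.
rewrite -[w in iota 0 w]subn0 -/(index_iota 0 w) big_mkord.
have vw : v <= w by exact: leq_subr.
rewrite -(subnKC vw) big_split_ord /=; apply: leq_trans (leq_addr _ _).
(* The later the first position, the shorter the window left over, hence the reversal. *)
rewrite [leqLHS](reindex_inj rev_ord_inj) /=; apply: leq_sum => i _.
apply: leq_trans (IH _ _); apply: eq_leq; congr (_ ^ _).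
have := ltn_ord i; rewrite /v; lia.
Qed.

Lemma subseq_of_pairwise (J : seq nat) n : pairwise ltn J ->
  all (fun j => 1 <= j <= n) J -> subseq J (iota 1 n).
Proof.
move=> pJ bJ; suff -> : J = [seq i <- iota 1 n | i \in J] by exact: filter_subseq.
apply: (irr_sorted_eq ltn_trans ltnn).
- by rewrite sorted_pairwise //; exact: ltn_trans.
- by apply: sorted_filter; [exact: ltn_trans|exact: iota_ltn_sorted].
- move=> i; rewrite mem_filter mem_iota; case: (boolP (i \in J)) => //= iJ.
  by have /= := allP bJ i iJ; lia.
Qed.

(** Splits the event that [x] occurs exactly at [J] into conditions on single coordinates, which
    independence can factor. *)
Lemma positions_eq s n x J : pairwise ltn J -> all (fun j => 1 <= j <= n) J ->
  (positions s n x == J) = all (fun i => (s i == x) == (i \in J)) (iota 1 n).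
Proof.
move=> pJ bJ; apply/eqP/allP => [<- i il|H].
  by rewrite mem_filter il andbT.
apply: (irr_sorted_eq ltn_trans ltnn).
- by apply: sorted_filter; [exact: ltn_trans|exact: iota_ltn_sorted].
- by rewrite sorted_pairwise //; exact: ltn_trans.
- move=> i; rewrite mem_filter; case: (boolP (i \in iota 1 n)) => il.
    by rewrite andbT; exact: (eqP (H i il)).
  rewrite andbF; apply/esym/negbTE; apply: contra il => /(allP bJ).
  by rewrite mem_iota; lia.
Qed.

Lemma size_positions s n x : size (positions s n x) = count_mem x (visited s n).
Proof. by rewrite /positions size_filter /visited count_map. Qed.

Definition near_rare (s : nat -> nat) (n c j : nat) : bool :=
  (1 <= j <= n) && (size (positions s n (s j)) <= c).

Definition count_visited (s : nat -> nat) (n : nat) (Q : pred nat) : nat :=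
  count Q (undup (visited s n)).

(** Each symbol with at most [c] occurrences is counted at most [c] times for each of the three
    shifts. Positions 0 and [n.+1] are out of range, so the shifted sums do not exceed the centred
    one. *)
Lemma sum_near_rare s n c :
  \sum_(i <- iota 1 n) count (near_rare s n c) [:: i.-1; i; i.+1]
  <= 3 * c * count_visited s n xpredT.
Proof.
pose B j := nat_of_bool (near_rare s n c j).
have H0 : B 0 = 0 by [].
have Hn : B n.+1 = 0 by rewrite /B /near_rare ltnn andbF.
have ei f : \sum_(i <- iota 1 n) f i = \sum_(i < n) f i.+1.
  by rewrite -[1]addn0 iotaDl big_map -[n in iota 0 n]subn0 -/(index_iota 0 n) big_mkord.
have S1 : \sum_(i <- iota 1 n) B i.-1 <= \sum_(i <- iota 1 n) B i.
  rewrite !ei /=; have : \sum_(i < n) B i + B n = B 0 + \sum_(i < n) B i.+1.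
    by transitivity (\sum_(i < n.+1) B i); [rewrite big_ord_recr|rewrite big_ord_recl].
  by rewrite H0 add0n => <-; exact: leq_addr.
have S3 : \sum_(i <- iota 1 n) B i.+1 <= \sum_(i <- iota 1 n) B i.
  rewrite !ei /=.
  have : \sum_(i < n) B i.+1 + B n.+1 = B 1 + \sum_(i < n) B i.+2.
    by transitivity (\sum_(i < n.+1) B i.+1); [rewrite big_ord_recr|rewrite big_ord_recl].
  by rewrite Hn addn0 => ->; exact: leq_addl.
have S2 : \sum_(i <- iota 1 n) B i <= c * count_visited s n xpredT.
  rewrite /count_visited count_predT.
  have -> : \sum_(i <- iota 1 n) B i =
      \sum_(x <- visited s n) (size (positions s n x) <= c).
    rewrite big_map; apply: eq_big_seq => i; rewrite mem_iota /B /near_rare => il.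
    by have -> : 1 <= i <= n by lia.
  rewrite -(big_undup_iterop_count _ (visited s n) xpredT) /=.
  rewrite mulnC -sum1_size big_distrl /=; apply: leq_sum => x _.
  rewrite Monoid.iteropE iter_addn_0 -size_positions mul1n.
  by case: (leqP (size (positions s n x)) c) => h; rewrite ?mul1n ?mul0n.
have -> : \sum_(i <- iota 1 n) count (near_rare s n c) [:: i.-1; i; i.+1] =
   \sum_(i <- iota 1 n) (B i.-1 + (B i + B i.+1)).
  by apply: eq_bigr => i _ /=; rewrite addn0.
rewrite !big_split /= -mulnA !mulSn mul0n addn0.
by rewrite !leq_add // (leq_trans _ S2).
Qed.

(* [upd s i 0] erases the [i]-th sample, since 0 is not a symbol. *)
Section Stability.
Variables (n c : nat) (Q : (nat -> nat) -> pred nat).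
Hypothesis Q_visited : forall s x, Q s x -> x \in visited s n.
Hypothesis Q_local : forall s i x, 1 <= i <= n -> Q s x != Q (upd s i 0) x ->
  exists j, [/\ j \in [:: i.-1; i; i.+1], near_rare s n c j & s j = x].

(** Both directions charge the change to rare positions of the original path [s], so that the
    charges for all [i] can be added on one path. *)
Lemma count_visited_upd s i : 1 <= i <= n ->
  count_visited s n (Q s) <=
    count_visited (upd s i 0) n (Q (upd s i 0)) + count (near_rare s n c) [:: i.-1; i; i.+1]
  /\ count_visited (upd s i 0) n (Q (upd s i 0)) <=
    count_visited s n (Q s) + count (near_rare s n c) [:: i.-1; i; i.+1].
Proof.
move=> il; set C := [:: i.-1; i; i.+1].
pose D := [seq s j | j <- [seq j <- C | near_rare s n c j]].
have sD : size D = count (near_rare s n c) C by rewrite size_map size_filter.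
have QD x : Q s x != Q (upd s i 0) x -> x \in D.
  move=> /(Q_local il)[j [jC jr <-]]; apply: map_f; by rewrite mem_filter jr.
rewrite /count_visited -sD -!size_filter -!size_cat; split; apply: uniq_leq_size.
- by apply: filter_uniq; exact: undup_uniq.
- move=> x; rewrite mem_filter => /andP[Qx _].
  rewrite mem_cat mem_filter; case: (boolP (Q (upd s i 0) x)) => Qx'.
    by rewrite mem_undup Q_visited.
  by rewrite /= QD // Qx (negbTE Qx').
- by apply: filter_uniq; exact: undup_uniq.
- move=> x; rewrite mem_filter => /andP[Qx _].
  rewrite mem_cat mem_filter; case: (boolP (Q s x)) => Qx'.
    by rewrite mem_undup Q_visited.
  by rewrite /= QD // Qx (negbTE Qx').
Qed.

End Stability.

Lemma positions_upd s n i x : x != 0 -> s i != x ->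
  positions (upd s i 0) n x = positions s n x.
Proof.
move=> x0 ix; apply: eq_in_filter => j _; rewrite /upd; case: (eqVneq j i) => [->|//].
by rewrite (negbTE ix) eq_sym (negbTE x0).
Qed.

Lemma size_positions_upd s n i a x :
  size (positions s n x) <= (size (positions (upd s i a) n x)).+1.
Proof.
rewrite -[X in _ <= X]/(size (i :: positions (upd s i a) n x)).
apply: uniq_leq_size; first by apply: filter_uniq; exact: iota_uniq.
move=> j; rewrite inE !mem_filter /upd; by case: (eqVneq j i).
Qed.

(* The degree of such an [x] is the number of distinct symbols at the neighbours
   of its [l] occurrences, and these symbols are almost independent of the event
   that [x] occurs there. *)
Definition good_at (b : bool) (l n : nat) (q : pred (seq nat)) (s : nat -> nat) : pred nat :=
  fun x => [&& x != 0, positions s n x \in spaced l 2 (n - 2) &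
     q (map s (neighbours b (positions s n x)))].

Lemma mem_visited s n x : (x \in visited s n) = (0 < size (positions s n x)).
Proof. by rewrite size_positions -has_count has_pred1. Qed.

Lemma good_at_visited b l n q s x : 0 < l -> good_at b l n q s x -> x \in visited s n.
Proof.
by move=> l0 /and3P[_ /(spacedP b (ltn0Sn 1))[sl _ _ _ _] _]; rewrite mem_visited sl.
Qed.

Lemma mem_nbhd b i j : (j \in nbhd b i) -> (i == j.+1) || (i.+1 == j) || (i == 0).
Proof. by case: b; rewrite !inE; lia. Qed.

(** If the erased sample is [x] itself, [x] has exactly [l] occurrences before or after the erasure,
    hence at most [l.+1] before it. Otherwise its positions are unchanged, and only the word read at
    their neighbours can change, so [i] is adjacent to an occurrence. *)
Lemma good_at_local b l n q s i x : 0 < l -> 1 <= i <= n ->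
  good_at b l n q s x != good_at b l n q (upd s i 0) x ->
  exists j, [/\ j \in [:: i.-1; i; i.+1], near_rare s n l.+1 j & s j = x].
Proof.
move=> l0 il; case: (eqVneq x 0) => [->|x0]; first by rewrite /good_at eqxx.
case: (eqVneq (s i) x) => [six|six].
  move=> H; exists i; split; rewrite ?inE ?eqxx ?orbT // /near_rare il six /=.
  case: (boolP (good_at b l n q s x)) H => [|_].
    by move=> /and3P[_ /(spacedP b (ltn0Sn 1))[-> _ _ _ _] _] _; lia.
  case: (boolP (good_at b l n q (upd s i 0) x)) => // /and3P[_ /(spacedP b (ltn0Sn 1))[sl _ _ _ _] _ _].
  by apply: leq_trans (size_positions_upd s n i 0 x) _; rewrite sl.
rewrite /good_at x0 positions_upd //=; set J := positions s n x.
case: (boolP (J \in _)) => //= Jsp.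
have [sJ /allP bJ _ _ /allP nJ] := spacedP b (ltn0Sn 1) Jsp.
have [iJ _|iJ] := boolP (i \in neighbours b J); last first.
  rewrite (_ : map (upd s i 0) _ = map s (neighbours b J)) ?eqxx //.
  apply/eq_in_map => j jJ; rewrite /upd; case: eqP => // ji.
  by rewrite -ji jJ in iJ.
move/flatten_mapP: iJ => [j jJ ij]; exists j.
have /= bj := bJ j jJ.
have /andP[sj jl] : (s j == x) && (j \in iota 1 n) by move: jJ; rewrite /J mem_filter.
split; last exact/eqP.
- by move: (mem_nbhd ij); rewrite !inE; lia.
- rewrite /near_rare (eqP sj) -/J sJ; move: jl; rewrite mem_iota; lia.
Qed.

Lemma visited_local n s i x : 1 <= i <= n ->
  ((x != 0) && (x \in visited s n)) != ((x != 0) && (x \in visited (upd s i 0) n)) ->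
  exists j, [/\ j \in [:: i.-1; i; i.+1], near_rare s n 1 j & s j = x].
Proof.
move=> il; case: (eqVneq x 0) => [->//|x0] /=.
rewrite !mem_visited; case: (eqVneq (s i) x) => [six H|six]; last by rewrite positions_upd // eqxx.
exists i; split; rewrite ?inE ?eqxx ?orbT // /near_rare il six /=.
have := size_positions_upd s n i 0 x; move: H.
have : 0 < size (positions s n x).
  by rewrite -mem_visited -six map_f // mem_iota; lia.
by move=> ->; case: posnP => // ->.
Qed.

End Combinatorics.

(** * Degrees *)

Section Degrees.
Local Open Scope nat_scope.
Variable s : nat -> nat.

(* [b] selects the undirected graph, [noloop] deletes the loops. *)
Definition adjacent (b noloop : bool) (n x y : nat) : bool :=
  (0 < W s n x y + b * W s n y x) && ~~ (noloop && (y == x)).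

Definition degree (b noloop : bool) (n x : nat) : nat :=
  size (undup [seq y <- visited s n | adjacent b noloop n x y]).

Lemma card_nat_seq (l : seq nat) (A : set nat) :
  (forall x, A x <-> x \in l) -> card_nat A = size (undup l).
Proof.
move=> Al; rewrite /card_nat -card_fseq.
have -> : A = [set` [fset x in l]%fset].
  by apply/seteqP; split => x /=; rewrite !inE => /Al.
by rewrite set_fsetK.
Qed.

Lemma W_gt0 n x y :
  reflect (exists i, [/\ 1 <= i < n, s i = x & s i.+1 = y]) (0 < W s n x y).
Proof.
rewrite /W lt0n sum_nat_seq_neq0; apply: (iffP hasP) => [[i]|[i [il <- <-]]].
  rewrite mem_index_iota => il /=; rewrite eqb0 negbK => /andP[/eqP sx /eqP sy].
  by exists i.
by exists i; rewrite ?mem_index_iota //= !eqxx.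
Qed.

Lemma visitedP n x : reflect (exists2 i, 1 <= i <= n & s i = x) (x \in visited s n).
Proof.
apply: (iffP mapP) => [[i]|[i il <-]].
  by rewrite mem_iota => il ->; exists i => //; lia.
by exists i => //; rewrite mem_iota; lia.
Qed.

Lemma V_visited n x : V s n x <-> x \in visited s n.
Proof.
split=> [[i il <-]|/visitedP[i il <-]]; first by apply/visitedP; exists i.
by exists i.
Qed.

Lemma nrangeE n : nrange s n = count_visited s n xpredT.
Proof.
by rewrite /nrange (card_nat_seq (@V_visited n)) /count_visited count_predT.
Qed.

Lemma adjacent_visited b nl n x y : adjacent b nl n x y ->
  (x \in visited s n) && (y \in visited s n).
Proof.
move=> /andP[+ _]; rewrite addn_gt0 => /orP[|].
  by move=> /W_gt0[i [il <- <-]]; apply/andP; split; apply/visitedP; [exists i|exists i.+1]; lia.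
case: b => //; rewrite mul1n.
by move=> /W_gt0[i [il <- <-]]; apply/andP; split; apply/visitedP; [exists i.+1|exists i]; lia.
Qed.

Lemma degreeP b nl n x (A : set nat) : (forall y, A y <-> adjacent b nl n x y) ->
  card_nat A = degree b nl n x.
Proof.
move=> HA; apply: card_nat_seq => y; rewrite HA mem_filter.
split=> [axy|/andP[]//]; by have /andP[_ ->] := adjacent_visited axy; rewrite axy.
Qed.

Lemma DoutE n x : Dout s n x = degree false false n x.
Proof. by apply: degreeP => y; rewrite /adjacent /= mul0n addn0 andbT. Qed.

Lemma DbarE n x : Dbar s n x = degree true false n x.
Proof. by apply: degreeP => y; rewrite /adjacent /= mul1n andbT. Qed.

Lemma Dout_noloopE n x : Dout_noloop s n x = degree false true n x.
Proof.
apply: degreeP => y; rewrite /adjacent /= mul0n addn0.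
by split=> [[H /eqP yx]|/andP[H /eqP yx]]; [apply/andP|].
Qed.

Lemma Dbar_noloopE n x : Dbar_noloop s n x = degree true true n x.
Proof.
apply: degreeP => y; rewrite /adjacent /= mul1n.
by split=> [[H /eqP yx]|/andP[H /eqP yx]]; [apply/andP|].
Qed.

Lemma W_homo n x y : W s n x y <= W s n.+1 x y.
Proof.
rewrite /W; case: n => [|n]; first by rewrite big_geq.
by rewrite [leqRHS]big_nat_recr //= leq_addr.
Qed.

Lemma visited_homo n x : x \in visited s n -> x \in visited s n.+1.
Proof. by move=> /visitedP[i il <-]; apply/visitedP; exists i => //; lia. Qed.

Lemma degree_homo b nl n x : degree b nl n x <= degree b nl n.+1 x.
Proof.
apply: uniq_leq_size; first exact: undup_uniq.
move=> y; rewrite !mem_undup !mem_filter => /andP[/andP[axy lxy] yv].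
rewrite visited_homo // /adjacent lxy !andbT; apply: leq_trans axy _.
by rewrite leq_add ?W_homo // leq_mul // W_homo.
Qed.

Lemma degree_le b nl n x : degree b nl n x <= n.
Proof.
rewrite /degree; apply: leq_trans (size_undup _) _.
by rewrite size_filter (leq_trans (count_size _ _)) // size_map size_iota.
Qed.

Definition tail_count (b nl : bool) (k n : nat) : nat :=
  count_visited s n (fun x => k <= degree b nl n x).

Lemma tail_count_homo b nl k n : tail_count b nl k n <= tail_count b nl k n.+1.
Proof.
rewrite /tail_count /count_visited -!size_filter; apply: uniq_leq_size.
  by apply: filter_uniq; exact: undup_uniq.
move=> x; rewrite !mem_filter !mem_undup => /andP[kd xv].
by rewrite visited_homo // andbT (leq_trans kd) // degree_homo.
Qed.

Lemma tail_count_eq0 b nl k n : n < k -> tail_count b nl k n = 0.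
Proof.
move=> nk; rewrite /tail_count /count_visited; apply/eqP; rewrite -leqn0 leqNgt -has_count.
by apply/hasPn => x _; rewrite -ltnNge (leq_ltn_trans (degree_le _ _ _ _)).
Qed.

Lemma tail_count0 b nl n : tail_count b nl 0 n = nrange s n.
Proof. by rewrite nrangeE. Qed.

Lemma card_degree_eq b nl k n (A : set nat) :
  (forall x, A x <-> (x \in visited s n) && (degree b nl n x == k)) ->
  card_nat A + tail_count b nl k.+1 n = tail_count b nl k n.
Proof.
move=> HA; rewrite (@card_nat_seq [seq x <- visited s n | degree b nl n x == k]); last first.
  by move=> x; rewrite HA mem_filter andbC.
rewrite -filter_undup size_filter /tail_count /count_visited -count_predUI.
rewrite [X in _ + X](_ : _ = 0) ?addn0; last first.
  by apply/eqP; rewrite -leqn0 leqNgt -has_count; apply/hasPn => x _ /=; lia.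
by apply: eq_count => x /=; rewrite [RHS]leq_eqVlt eq_sym.
Qed.

(** A symbol seen only at time [n] has no outgoing edge. Hence for k >= 1 it makes no difference
    whether symbols of out-degree k are sought in the first [n.-1] or the first [n] samples. *)
Lemma degree_gt0_visited nl n x : 0 < degree false nl n x -> x \in visited s n.-1.
Proof.
rewrite /degree; case E : [seq _ <- _ | _] => [//|y r] _.
have : y \in [seq y <- visited s n | adjacent false nl n x y] by rewrite E mem_head.
rewrite mem_filter => /andP[/andP[+ _] _]; rewrite mul0n addn0 => /W_gt0[i [il <- _]].
by apply/visitedP; exists i => //; lia.
Qed.

(** Every edge at [x] joins an occurrence to one of the listed neighbours, and no neighbour carries
    [x]. There is no loop to delete, so both values of [nl] give the same degree. *)
Lemma good_at_degree b nl l n q x : good_at b l n q s x ->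
  exists v, q v /\ degree b nl n x = size (undup v) /\ size v = b.+1 * l.
Proof.
move=> /and3P[x0 Jsp qv]; set J := positions s n x in Jsp qv.
have [sJ /allP bJ _ _ /allP nJ] := spacedP b (ltn0Sn 1) Jsp.
exists (map s (neighbours b J)); split => //; split; last by rewrite size_map size_neighbours sJ.
apply: perm_size; apply: uniq_perm; rewrite ?undup_uniq // => y.
have n3 j : j \in J -> 2 <= j <= n.-1 by move=> /bJ; lia.
have JE i : 1 <= i <= n -> (i \in J) = (s i == x).
  by move=> il; rewrite mem_filter mem_iota andb_idr // => _; lia.
have adj i j : i \in J -> j \in nbhd b i -> (s j == x) = false.
  move=> iJ ij; have jn : j \in neighbours b J by apply/flatten_mapP; exists i.
  have /andP[jl jJ] := nJ j jn; rewrite -JE; first exact: negbTE.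
  by have := n3 i iJ; lia.
rewrite !mem_undup mem_filter; apply/andP/mapP => [[/andP[axy _] yv]|[j jJ ->]].
  move: axy; rewrite addn_gt0 => /orP[/W_gt0[i [il sx <-]]|].
    exists i.+1 => //; apply/flatten_mapP; exists i; first by rewrite JE ?sx ?eqxx //; lia.
    by case: b {nJ qv Jsp adj}; rewrite !inE eqxx ?orbT.
  case: b Jsp qv nJ adj yv => // Jsp qv nJ adj yv; rewrite mul1n => /W_gt0[i [il <- sx]].
  exists i => //; apply/flatten_mapP; exists i.+1; first by rewrite JE ?sx ?eqxx //; lia.
  by rewrite !inE eqxx.
move/flatten_mapP: jJ => [i iJ ij].
have := n3 i iJ => ib.
have six : s i = x by apply/eqP; rewrite -JE //; lia.
have sjx := adj i j iJ ij.
suff axy : adjacent b nl n x (s j) by have /andP[_ ->] := adjacent_visited axy.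
rewrite /adjacent sjx andbF andbT addn_gt0.
case: b ij {qv Jsp nJ adj} => /=; rewrite !inE.
  move=> /orP[/eqP ->|/eqP ->]; apply/orP.
    by right; rewrite mul1n; apply/W_gt0; exists i.-1; split => //; [lia|rewrite prednK //; lia].
  by left; apply/W_gt0; exists i; split => //; lia.
by move=> /eqP ->; apply/orP; left; apply/W_gt0; exists i; split => //; lia.
Qed.

End Degrees.

(** * Moments of counts of symbols *)

Section CountMoments.
Variable R : realType.
Variable p : nat -> R.
Hypothesis p_ge0 : forall a, 0 <= p a.
Hypothesis p_summable : summable_seq p.
Hypothesis p_sum1 : ssum p = 1.
Hypothesis p0 : p 0 = 0.

Lemma p_le1 x : p x <= 1.
Proof.
rewrite -p_sum1; apply: le_trans (partial_le_ssum x.+1 p_ge0 p_summable).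
by rewrite big_ord_recr /= lerDr sumr_ge0.
Qed.

Lemma count_visited_le s n Q : (count_visited s n Q <= n)%N.
Proof.
rewrite (leq_trans (count_size _ _)) // (leq_trans (size_undup _)) //.
by rewrite size_map size_iota.
Qed.

Lemma bounded_count n (Q : (nat -> nat) -> pred nat) :
  bounded_real (fun s : nat -> nat => (count_visited s n (Q s))%:R : R).
Proof. by exists n%:R => s; rewrite ger0_norm // ler_nat count_visited_le. Qed.

(** The constant is 3 times 3c: an increment is at most the number d of rare positions among three,
    d^2 <= 3 d, and [sum_near_rare] bounds the total of the d by 3c times the range. *)
Lemma variance_count n c (Q : (nat -> nat) -> pred nat) s0 :
  (forall s x, Q s x -> x \in visited s n) ->
  (forall s i x, (1 <= i <= n)%N -> Q s x != Q (upd s i 0) x ->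
     exists j, [/\ j \in [:: i.-1; i; i.+1], near_rare s n c j & s j = x]) ->
  expect p (iota 1 n) (fun s => (count_visited s n (Q s))%:R ^+ 2) s0 -
  expect p (iota 1 n) (fun s => (count_visited s n (Q s))%:R) s0 ^+ 2 <=
  (9 * c)%:R * expect p (iota 1 n) (fun s => (count_visited s n xpredT)%:R) s0.
Proof.
move=> Qv Ql; pose f s : R := (count_visited s n (Q s))%:R.
have bf : bounded_real f by exact: bounded_count.
have bu i : bounded_real (fun s => f (upd s i 0)).
  exact: (@bounded_comp _ _ _ (fun s => upd s i 0) f).
have bd i : bounded_real (fun s => (f s - f (upd s i 0)) ^+ 2).
  by apply: bounded_realM; exact: bounded_realB.
have bc : bounded_real (fun s => (count_visited s n xpredT)%:R : R).
  exact: (bounded_count n (fun=> xpredT)).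
apply: le_trans (efron_stein p_ge0 p_summable p_sum1 s0 (iota_uniq 1 n) bf) _.
rewrite -(expect_sum p_ge0 p_summable p_sum1) // -(expectZ p_ge0 p_summable) //.
apply: le_expect => //; [exact: bounded_sum|exact: bounded_realZ|].
move=> s; apply: (@le_trans _ _
   (3 * (\sum_(i <- iota 1 n) count (near_rare s n c) [:: i.-1; i; i.+1])%:R)).
  rewrite natr_sum mulr_sumr !big_seq; apply: ler_sum => i; rewrite mem_iota => il.
  have {}il : (1 <= i <= n)%N by lia.
  have [H1 H2] := count_visited_upd Qv Ql s il.
  rewrite /f; set a := count_visited s n _ in H1 H2 *.
  set b := count_visited _ n _ in H1 H2 *; set d := count _ _ in H1 H2 *.
  have d3 : (d <= 3)%N by exact: count_size.
  have : (a%:R <= b%:R + d%:R :> R) by rewrite -natrD ler_nat.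
  have : (b%:R <= a%:R + d%:R :> R) by rewrite -natrD ler_nat.
  have : (d%:R <= 3 :> R) by rewrite (ler_nat R d 3).
  have : (0 <= d%:R :> R) by [].
  by nra.
rewrite (_ : (9 * c)%:R * _ = 3 * (3 * c * count_visited s n xpredT)%:R); last first.
  by rewrite !natrM; ring.
by rewrite ler_wpM2l // ler_nat sum_near_rare.
Qed.

Lemma expect_coord l i (h : nat -> R) s : uniq l -> i \in l -> bounded_real h ->
  expect p l (fun t => h (t i)) s = expect1 p h.
Proof.
move=> ul il bh.
have := @expect_map _ p p_summable p_sum1 [:: i] l (fun v => h (head 0%N v)) s ul isT.
by rewrite sub1seq => /(_ il)/= -> //; exact: (bounded_comp (head 0%N)).
Qed.

Lemma expect1_neq x : expect1 p (fun a => (a != x)%:R) = 1 - p x.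
Proof.
rewrite -(expect1_eq1 p x) -{2}(expect1_cst p_summable p_sum1 1).
have b1 : bounded_real (fun _ : nat => 1 : R) by exact: bounded_cst.
have bx : bounded_real (fun a : nat => (a == x)%:R : R) by exact: bounded_bool.
rewrite -mulN1r -(expect1Z p_ge0) // -(expect1D p_ge0) //; last exact: bounded_realZ.
congr expect1; apply/funext => a; by case: eqP => _ /=; rewrite ?mulr1 ?mulr0 ?subrr ?addr0.
Qed.

Lemma expect_visited n x s0 :
  expect p (iota 1 n) (fun s => (x \in visited s n)%:R) s0 = 1 - (1 - p x) ^+ n.
Proof.
have bh : bounded_real (fun a : nat => (a != x)%:R : R) by exact: bounded_bool.
have -> : (fun s => (x \in visited s n)%:R) =
    (fun s : nat -> nat => 1 - (\prod_(i <- iota 1 n | xpredT i) (s i != x)%:R) * 1 : R).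
  apply/funext => s; rewrite mulr1; case: (boolP (x \in visited s n)) => [|xn].
    move=> /mapP[i il ->]; rewrite (bigD1_seq i) ?iota_uniq //= eqxx mul0r.
    by rewrite subr0.
  rewrite big_seq big1 ?subrr // => i il.
  by case: eqP => // sx; move: xn; rewrite -sx map_f.
rewrite (expectB p_ge0) //; [|exact: bounded_cst|]; last first.
  exists 1 => s; rewrite mulr1 ger0_norm; last by apply: prodr_ge0.
  by elim: (iota 1 n) => [|i l IH]; rewrite ?big_nil // big_cons mulr_ile1 // ?prodr_ge0 // lern1 leq_b1.
rewrite (expect_cst p_summable p_sum1) (@expect_prod _ _ _ _ _ _ _ (fun _ a => (a != x)%:R)) ?iota_uniq //; last exact: bounded_cst.
rewrite (expect_cst p_summable p_sum1) mulr1 expect1_neq big_const_seq count_predT size_iota.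
elim: n => [|n IH]; first by rewrite expr0 subrr.
by rewrite iterS exprS; have /(congr1 (fun y => 1 - y)) := IH; rewrite !subKr => ->.
Qed.

Lemma summable_visited n : summable_seq (fun x => 1 - (1 - p x) ^+ n).
Proof.
apply: (@summable_le _ _ (fun x => n%:R * p x)); last exact: summableZ.
move=> x; have q0 : 0 <= 1 - p x by rewrite subr_ge0 p_le1.
have q1 : 1 - p x <= 1 by rewrite lerBlDr lerDl.
rewrite ger0_norm ?subr_ge0 ?exprn_ile1 //.
elim: n => [|n IH]; first by rewrite expr0 subrr mul0r.
rewrite exprS -natr1 mulrDl mul1r.
have : (1 - p x) ^+ n <= 1 by exact: exprn_ile1.
have := p_ge0 x; nra.
Qed.

(** [expect] commutes with finite sums, so the alphabet is cut at [K]. Distinct symbols beyond [K]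
    are at most the samples falling there, whose mean is [n] times a tail of [p] and vanishes as [K]
    grows. *)
Lemma expect_range_le n s0 :
  expect p (iota 1 n) (fun s => (count_visited s n xpredT)%:R) s0 <=
  ssum (fun x => 1 - (1 - p x) ^+ n).
Proof.
set u := ssum _.
have H K : expect p (iota 1 n) (fun s => (count_visited s n xpredT)%:R) s0 <=
    u + n%:R * (1 - \sum_(x < K) p x).
  have bv x : bounded_real (fun s : nat -> nat => (x \in visited s n)%:R : R).
    exact: bounded_bool.
  have bK i : bounded_real (fun s : nat -> nat => (K <= s i)%N%:R : R).
    exact: bounded_bool.
  apply: (@le_trans _ _ (expect p (iota 1 n) (fun s =>
     \sum_(x <- iota 0 K) (x \in visited s n)%:R +
     \sum_(i <- iota 1 n) (K <= s i)%N%:R) s0)).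
    apply: le_expect => //; first exact: (bounded_count n (fun=> xpredT)).
      by apply: bounded_realD; exact: bounded_sum.
    move=> s; rewrite -!natr_sum -natrD ler_nat /count_visited count_predT.
    rewrite -(count_predC (fun x => (x < K)%N)) leq_add //.
      rewrite (_ : (\sum_(_ <- _) _)%N = count (mem (visited s n)) (iota 0 K)); last first.
        by rewrite -sum1_count [RHS]big_mkcond; apply: eq_bigr => x _ /=; case: (x \in _).
      rewrite -!size_filter; apply: uniq_leq_size.
        by apply: filter_uniq; exact: undup_uniq.
      by move=> x; rewrite !mem_filter mem_undup mem_iota /= add0n => /andP[-> ->].
    rewrite (_ : (\sum_(_ <- _) _)%N = count (fun x => (K <= x)%N) (visited s n)); last first.
      by rewrite -sum1_count [RHS]big_mkcond big_map; apply: eq_bigr => x _ /=; case: (K <= _)%N.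
    rewrite -!size_filter; apply: uniq_leq_size.
      by apply: filter_uniq; exact: undup_uniq.
    by move=> x; rewrite !mem_filter mem_undup /= -leqNgt.
  rewrite (expectD p_ge0) //; [|exact: bounded_sum..].
  rewrite !(expect_sum p_ge0) // lerD //.
    under eq_bigr do rewrite expect_visited.
    rewrite -[K in iota 0 K]subn0 -/(index_iota 0 K) big_mkord.
    apply: partial_le_ssum; last exact: summable_visited.
    move=> x; rewrite subr_ge0 exprn_ile1 //; first by rewrite subr_ge0 p_le1.
    by rewrite lerBlDr lerDl.
  rewrite big_seq (eq_bigr (fun=> 1 - \sum_(x < K) p x)); last first.
    move=> i il.
    have bx x : bounded_real (fun s : nat -> nat => (s i == x)%:R : R) by exact: bounded_bool.
    transitivity (expect p (iota 1 n) (fun s => 1 - \sum_(x <- iota 0 K) (s i == x)%:R) s0).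
      apply: expect_ext => s; case: leqP => Ks.
        rewrite big_seq big1 ?subr0 // => x; rewrite mem_iota; case: eqP => // <-; lia.
      rewrite (bigD1_seq (s i)) ?iota_uniq ?mem_iota //= eqxx big1 ?addr0 ?subrr //.
      by move=> x; rewrite eq_sym => /negbTE ->.
    rewrite (expectB p_ge0) //; [|exact: bounded_cst|exact: bounded_sum].
    rewrite (expect_cst p_summable) // (expect_sum p_ge0) //; congr (1 - _).
    rewrite -[K in iota 0 K]subn0 -/(index_iota 0 K) big_mkord; apply: eq_bigr => x _.
    rewrite (expect_coord s0 (iota_uniq 1 n) il (h := fun a => (a == x)%:R)); last exact: bounded_bool.
    exact: expect1_eq1.
  by rewrite -big_seq big_const_seq count_predT size_iota iter_addr_0 mulr_natl.
have : (fun K => u + n%:R * (1 - \sum_(x < K) p x)) @ \oo --> u + n%:R * (1 - 1).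
  apply: cvgD; first exact: cvg_cst.
  apply: cvgMr; apply: cvgB; first exact: cvg_cst.
  by rewrite -p_sum1; exact: ssum_cvg.
rewrite subrr mulr0 addr0 => cvgu; rewrite -(cvg_lim _ cvgu) //.
by apply: limr_ge; [apply/cvg_ex; eexists; exact: cvgu|exact: nearW].
Qed.

(** Independence separates the neighbours of [J] from the other coordinates. The latter give [l]
    factors [p x] and fewer than [n] factors [1 - p x], so the exponent [n] only lowers the product;
    the former give a word that satisfies [q] and avoids [x]. *)
Lemma expect_good_at_pattern (b : bool) l n (q : pred (seq nat)) x J s0 :
  (0 < l)%N -> J \in spaced l 2 (n - 2) ->
  p x ^+ l * (1 - p x) ^+ n *
    (expect_list p (b.+1 * l) (fun v => (q v)%:R) - (b.+1 * l)%:R * p x) <=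
  expect p (iota 1 n)
    (fun s => ((positions s n x == J) && q (map s (neighbours b J)))%:R) s0.
Proof.
move=> l0 Jsp; have [sJ bJ pJ pnJ nJ] := spacedP b (ltn0Sn 1) Jsp.
have n3 j : j \in J -> (2 <= j <= n.-1)%N by move=> /(allP bJ) /=; lia.
have n2 : (2 <= n)%N.
  have [j jJ] : exists j, j \in J.
    by case: (J) sJ => [/= E|j r _]; [rewrite -E in l0|exists j; rewrite mem_head].
  by have := n3 j jJ; lia.
have bJ' : all (fun j => (1 <= j <= n)%N) J.
  by apply/allP => j /n3; lia.
have nJ' : subseq (neighbours b J) (iota 1 n).
  apply: subseq_of_pairwise => //; apply/allP => j /(allP nJ) /=; lia.
pose K i := i \notin neighbours b J.
pose h i a : R := if i \in J then (a == x)%:R else (a != x)%:R.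
(* At the neighbours the absence of [x] goes into the word functional, since [q] reads the same
   coordinates. *)
pose G' v : R := (q v)%:R * (x \notin v)%:R.
have bG' : bounded_real G' by apply: bounded_realM; exact: bounded_bool.
pose G (s : nat -> nat) := G' (map s (neighbours b J)).
have bG : bounded_real G by exact: (bounded_comp (fun s => map s (neighbours b J))).
have bh i : bounded_real (h i) by rewrite /h; case: (i \in J); exact: bounded_bool.
have -> : (fun s => ((positions s n x == J) && q (map s (neighbours b J)))%:R) =
    (fun s => (\prod_(i <- iota 1 n | K i) h i (s i)) * G s).
  apply/funext => s; rewrite positions_eq // /G /G'.
  have hE i : h i (s i) = ((s i == x) == (i \in J))%:R.
    by rewrite /h; case: (i \in J); case: (s i == x).
  case: (boolP (all _ _)) => [/allP H|/allPn[i il H]] /=.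
    rewrite big_seq_cond big1 ?mul1r; last first.
      by move=> i /andP[il _]; rewrite hE H.
    rewrite (_ : _ \notin _) ?mulr1 //; apply/mapP => -[j jn xj].
    have /= := allP nJ j jn => /andP[_ jJ].
    have := H j (mem_subseq nJ' jn); rewrite -xj eqxx (negbTE jJ); discriminate.
  case: (boolP (K i)) => Ki.
    by rewrite big_mkcond (bigD1_seq i) ?iota_uniq //= Ki hE (negbTE H) !mul0r.
  rewrite (_ : (x \notin _) = false) ?mulr0 //; apply/negbTE; rewrite negbK.
  have iJ : (i \in J) = false.
    by apply/negbTE; move: Ki; rewrite negbK => /(allP nJ)/= /andP[].
  move: H; rewrite iJ eqbF_neg negbK => /eqP <-.
  by apply: map_f; move: Ki; rewrite negbK.
rewrite (expect_prod p_ge0) ?iota_uniq //; last first.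
  move=> t i a Ki; rewrite /G; congr G'; apply/eq_in_map => j jJ.
  by rewrite /upd; case: eqP => // ji; move: Ki; rewrite /K -ji jJ.
have E0 : 0 <= expect p (iota 1 n) G s0.
  rewrite -(expect_cst p_summable p_sum1 (iota 1 n) 0 s0).
  apply: le_expect => //; first exact: bounded_cst.
  by move=> t; rewrite /G /G' mulr_ge0.
have EG : expect p (iota 1 n) G s0 = expect_list p (b.+1 * l) G'.
  rewrite (expect_map p_summable p_sum1) ?iota_uniq //; last first.
    exact: (subseq_uniq nJ' (iota_uniq 1 n)).
  by rewrite size_neighbours sJ.
have q0 : 0 <= 1 - p x by rewrite subr_ge0 p_le1.
have q1 : 1 - p x <= 1 by rewrite lerBlDr lerDl.
have Eh i : expect1 p (h i) = if i \in J then p x else 1 - p x.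
  by rewrite /h; case: (i \in J); [exact: expect1_eq1|exact: expect1_neq].
have P0 : 0 <= p x ^+ l * (1 - p x) ^+ n by rewrite mulr_ge0 // exprn_ge0.
have Pge : p x ^+ l * (1 - p x) ^+ n <= \prod_(i <- iota 1 n | K i) expect1 p (h i).
  rewrite (bigID (mem J)) /=; apply: ler_pM; rewrite ?exprn_ge0 //.
    rewrite (eq_bigr (fun=> p x)); last by move=> i /andP[_ iJ]; rewrite Eh iJ.
    rewrite big_const_seq.
    rewrite (_ : count _ _ = l); last first.
      rewrite -sJ -size_filter; apply: perm_size; apply: uniq_perm.
      - by apply: filter_uniq; exact: iota_uniq.
      - exact: (subseq_uniq (subseq_of_pairwise pJ bJ') (iota_uniq 1 n)).
      move=> i; rewrite mem_filter /K /=; case: (boolP (i \in J)) => iJ; last by rewrite andbF.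
      rewrite andbT (mem_subseq (subseq_of_pairwise pJ bJ') iJ) andbT.
      by apply/negP => /(allP nJ)/= /andP[_]; rewrite iJ.
    rewrite le_eqVlt; apply/orP; left; apply/eqP.
    by elim: (l) => [|k IH]; rewrite ?expr0 // iterS exprS IH.
  rewrite (eq_bigr (fun=> 1 - p x)); last by move=> i /andP[_ iJ]; rewrite Eh (negbTE iJ).
  rewrite big_const_seq; set m := count _ _.
  have mn : (m <= n)%N by rewrite /m (leq_trans (count_size _ _)) // size_iota.
  apply: (@le_trans _ _ ((1 - p x) ^+ m)); first exact: ler_wiXn2l.
  rewrite le_eqVlt; apply/orP; left; apply/eqP.
  by elim: (m) => [|k IH]; rewrite ?expr0 // iterS exprS IH.
have bq : bounded_real (fun v : seq nat => (q v)%:R : R) by exact: bounded_bool.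
have q01 v : 0 <= ((q v)%:R : R) <= 1 by rewrite ler0n lern1 leq_b1.
have H1 := expect_list_notin p_ge0 p_summable p_sum1 (b.+1 * l) x bq q01.
set v := _ - _ in H1 *; rewrite -EG in H1.
(* For frequent symbols the union bound can exceed the pattern mean; the claimed lower bound is then
   nonpositive. *)
case: (lerP v 0) => v0.
  by apply: (@le_trans _ _ 0); [exact: mulr_ge0_le0|apply: mulr_ge0 => //; exact: le_trans Pge].
by apply: ler_pM => //; exact: ltW.
Qed.

(** The pattern bound is the same for all [J], whence the number of lists as a factor. The terms can
    have either sign, so every partial sum over symbols is bounded before the limit is taken. *)
Lemma expect_good_at_ge (b : bool) l n (q : pred (seq nat)) s0 : (0 < l)%N ->
  (size (spaced l 2 (n - 2)))%:R *
    ssum (fun x => p x ^+ l * (1 - p x) ^+ n *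
      (expect_list p (b.+1 * l) (fun v => (q v)%:R) - (b.+1 * l)%:R * p x)) <=
  expect p (iota 1 n) (fun s => (count_visited s n (good_at b l n q s))%:R) s0.
Proof.
move=> l0; set v := expect_list _ _ _; set m := (b.+1 * l)%N.
pose a x := p x ^+ l * (1 - p x) ^+ n * (v - m%:R * p x).
have a0 : a 0 = 0 by rewrite /a p0 expr0n; case: l l0 @v @m @a => // *; rewrite !mul0r.
have as_ : summable_seq a.
  apply: (@summable_le _ _ (fun x => (`|v| + m%:R) * p x)); last exact: summableZ.
  move=> x; have q0 : 0 <= 1 - p x by rewrite subr_ge0 p_le1.
  have q1 : 1 - p x <= 1 by rewrite lerBlDr lerDl.
  rewrite /a !normrM !normrX (ger0_norm (p_ge0 x)) (ger0_norm q0) mulrC.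
  apply: ler_pM => //.
  - by apply: mulr_ge0; rewrite exprn_ge0.
  - apply: le_trans (ler_normB _ _) _; rewrite lerD // normrM ger0_norm //.
    by rewrite (ger0_norm (p_ge0 x)) ler_piMr // p_le1.
  - rewrite -[leRHS]mulr1; apply: ler_pM; rewrite ?exprn_ge0 ?exprn_ile1 //.
    case: l l0 {v m a a0} => // l _; rewrite exprS ler_piMr // exprn_ile1 //.
    exact: p_le1.
rewrite -ssumZ //; apply: ssum_le_bound; first exact: summableZ.
move=> K; rewrite -mulr_sumr -(big_mkord xpredT a) /index_iota subn0.
have bg (x : nat) : bounded_real (fun s : nat -> nat => (good_at b l n q s x)%:R : R).
  exact: bounded_bool.
apply: (@le_trans _ _ (expect p (iota 1 n) (fun s => \sum_(x <- iota 0 K) (good_at b l n q s x)%:R) s0)).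
  rewrite (expect_sum p_ge0) // mulr_sumr; apply: ler_sum => x _.
  have [->|x0] := eqVneq x 0.
    rewrite a0 mulr0 -(expect_cst p_summable p_sum1 (iota 1 n) 0 s0).
    by apply: le_expect => //; exact: bounded_cst.
  have -> : (fun s => (good_at b l n q s x)%:R : R) = (fun s => \sum_(J <- spaced l 2 (n - 2))
      ((positions s n x == J) && q (map s (neighbours b J)))%:R).
    apply/funext => s; rewrite /good_at x0 /=.
    case: (boolP (positions s n x \in _)) => [Js|Js] /=.
      rewrite (bigD1_seq _ Js) ?spaced_uniq //= eqxx big1 ?addr0 // => J.
      by rewrite eq_sym => /negbTE ->.
    rewrite big_seq big1 // => J JS; case: eqP => // E.
    by move: Js; rewrite E JS.
  rewrite (expect_sum p_ge0) //; last by move=> J; exact: bounded_bool.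
  rewrite mulr_natl -[_ *+ _](iter_addr_0) -count_predT -big_const_seq.
  rewrite !big_seq; apply: ler_sum => J JS; exact: expect_good_at_pattern.
apply: le_expect => //; [exact: bounded_sum|exact: bounded_count|].
move=> s; rewrite -natr_sum ler_nat.
rewrite (_ : (\sum_(_ <- _) _)%N = count (good_at b l n q s) (iota 0 K)); last first.
  by rewrite -sum1_count [RHS]big_mkcond; apply: eq_bigr => x _ /=; case: (good_at _ _ _ _ _ _).
rewrite /count_visited -!size_filter; apply: uniq_leq_size.
  by apply: filter_uniq; exact: iota_uniq.
move=> x; rewrite !mem_filter mem_undup => /andP[gx _]; rewrite gx /=.
exact: good_at_visited gx.
Qed.

End CountMoments.

(** * Regularly varying exponential sums *)

Section MonotoneDensity.
Variable R : realType.

Lemma powR_slope (rho : R) :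
  (t `^ rho - 1) / (t - 1) @[t --> (1 : R)^'] --> rho.
Proof.
have [dr vr] := is_derive1_powR rho (@ltr01 R).
have H : (fun h : R => h^-1 *: (((powR (R:=R))^~ rho \o shift 1) (h *: 1) -
    (powR (R:=R))^~ rho 1)) @ 0^' --> rho.
  rewrite powR1 mulr1 in vr; rewrite -[X in _ --> X]vr; exact: dr.
apply/cvgrPdist_lt => e e0; move/cvgrPdist_lt : H => /(_ e e0).
rewrite !near_withinE !nearE => /nbhs_ballP[d d0 Hd].
apply/nbhs_ballP; exists d => // t td t1.
have := Hd (t - 1); rewrite /ball /= sub0r normrN distrC.
rewrite /ball /= distrC in td; rewrite distrC => /(_ td).
rewrite subr_eq0 => /(_ t1).
by rewrite /GRing.scale /= mulr1 subrK powR1 mulrC distrC.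
Qed.

Lemma powR_invl (t rho : R) : 0 < t -> t^-1 `^ rho = t `^ (- rho).
Proof. by move=> t0; rewrite -powR_inv1 ?ltW // -powRrM mulN1r. Qed.

(** Regular variation at one ratio [t]. The ratios obtained for exponential sums are special but
    accumulate at 1, which is what [monotone_density] asks for. *)
Definition scales_at (A : R -> R) (rho t : R) : Prop :=
  A (t * x) / A x @[x --> +oo] --> t `^ rho.

Lemma pinfty_scale (c : R) (P : R -> Prop) : 0 < c ->
  (\forall x \near +oo, P x) -> \forall x \near +oo, P (c * x).
Proof.
move=> c0 [M [Mr HM]]; exists (c^-1 * M); split; first exact: num_real.
by move=> x xM; apply: HM; rewrite -ltr_pdivrMl.
Qed.

Lemma cvg_scale (c l : R) (f : R -> R) : 0 < c ->
  f x @[x --> +oo] --> l -> f (c * x) @[x --> +oo] --> l.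
Proof.
move=> c0 fl; apply/cvgrPdist_lt => e e0; move/cvgrPdist_lt : fl => /(_ e e0).
exact: pinfty_scale.
Qed.

Lemma scales_at_inv A rho t : 0 < t -> scales_at A rho t -> scales_at A rho t^-1.
Proof.
move=> t0 H; rewrite /scales_at.
have tV0 : 0 < t^-1 by rewrite invr_gt0.
have := cvgV (lt0r_neq0 (powR_gt0 rho t0)) (cvg_scale tV0 H).
rewrite -powRN -powR_invl // => /(_ _); apply: cvg_trans; apply: near_eq_cvg; near=> x.
rewrite /=.
by rewrite invf_div mulrA divff ?gt_eqF // mul1r.
Unshelve. all: by end_near. Qed.

Lemma scales_at_mul A rho t u : 0 < t -> 0 < u ->
  (forall x, 0 < x -> 0 < A x) ->
  scales_at A rho t -> scales_at A rho u -> scales_at A rho (t * u).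
Proof.
move=> t0 u0 A0 Ht Hu; rewrite /scales_at powRM ?ltW //.
apply: cvg_trans (cvgM (cvg_scale u0 Ht) Hu).
apply: near_eq_cvg; near=> x.
have x0 : 0 < x by near: x; exact: nbhs_pinfty_gt.
rewrite /= mulrA -(mulrA t); field.
by rewrite !gt_eqF // A0 // mulr_gt0.
Unshelve. all: by end_near. Qed.

(* Karamata's monotone density theorem; [s] is the sign of the derivative. *)
Lemma monotone_density (A B : R -> R) (s rho : R) :
  (forall x, 0 < x -> 0 < A x) ->
  (forall x t, 0 < x -> 1 < t ->
     (t - 1) * x * B (t * x) <= s * (A (t * x) - A x) <= (t - 1) * x * B x) ->
  (forall d : R, 0 < d -> exists t, [/\ 1 < t, t < 1 + d & scales_at A rho t]) ->
  x * B x / A x @[x --> +oo] --> s * rho.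
Proof.
move=> A0 AB HA; apply/cvgrPdist_le => e e0.
(* The increment of [A] over [x, t x] bounds x B(x) from below, and that over [x / t, x] bounds it
   from above. Both slopes tend to [s * rho] as t tends to 1; one [t] is fixed for the tolerance
   before x goes to infinity. *)
have S1 : s * ((t `^ rho - 1) / (t - 1)) @[t --> (1 : R)^'] --> s * rho.
  by apply: cvgMr; exact: powR_slope.
have S2 : s * (- (t * ((t `^ (- rho) - 1) / (t - 1)))) @[t --> (1 : R)^'] --> s * rho.
  have -> : s * rho = s * (- (1 * - rho)) by ring.
  apply: cvgMr; apply: cvgN.
  apply: cvgM; last exact: powR_slope.
  exact: cvg_within.
have e20 : 0 < e / 2 by rewrite divr_gt0.
move/cvgrPdist_lt : S1 => /(_ _ e20); rewrite near_withinE nearE => /nbhs_ballP[d1 d10 H1].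
move/cvgrPdist_lt : S2 => /(_ _ e20); rewrite near_withinE nearE => /nbhs_ballP[d2 d20 H2].
have d0 : 0 < Num.min d1 d2 by rewrite lt_min; apply/andP.
have [t [t1 td At]] := HA _ d0.
have t0 : 0 < t by exact: lt_trans t1.
have tB : t - 1 > 0 by rewrite subr_gt0.
have tN1 : t != 1 by rewrite gt_eqF.
have /ltW {}H1 : `|s * rho - s * ((t `^ rho - 1) / (t - 1))| < e / 2.
  apply: H1 => //; rewrite /ball /= distrC gtr0_norm // ltrBlDl.
  by apply: lt_le_trans td _; rewrite lerD2l ge_min lexx.
have /ltW {}H2 : `|s * rho - s * (- (t * ((t `^ (- rho) - 1) / (t - 1))))| < e / 2.
  apply: H2 => //; rewrite /ball /= distrC gtr0_norm // ltrBlDl.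
  by apply: lt_le_trans td _; rewrite lerD2l ge_min lexx orbT.
have C1 : s * ((A (t * x) / A x - 1) / (t - 1)) @[x --> +oo] -->
    s * ((t `^ rho - 1) / (t - 1)).
  by apply: cvgMr; apply: cvgMl; apply: cvgB => //; exact: cvg_cst.
have C2 : s * (- (t * ((A (t^-1 * x) / A x - 1) / (t - 1)))) @[x --> +oo] -->
    s * (- (t * ((t `^ (- rho) - 1) / (t - 1)))).
  apply: cvgMr; apply: cvgN; apply: cvgMr; apply: cvgMl; apply: cvgB; last exact: cvg_cst.
  have := scales_at_inv t0 At; rewrite /scales_at.
  by rewrite powR_invl.
move/cvgrPdist_lt : C1 => /(_ _ e20) C1; move/cvgrPdist_lt : C2 => /(_ _ e20) C2.
near=> x.
have x0 : 0 < x by near: x; exact: nbhs_pinfty_gt.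
have /ltW D1 : `|s * ((t `^ rho - 1) / (t - 1)) - s * ((A (t * x) / A x - 1) / (t - 1))| < e / 2.
  by near: x; exact: C1.
have /ltW D2 : `|s * (- (t * ((t `^ (- rho) - 1) / (t - 1)))) -
   s * (- (t * ((A (t^-1 * x) / A x - 1) / (t - 1))))| < e / 2.
  by near: x; exact: C2.
have Ax := A0 x x0.
have L1 : s * ((A (t * x) / A x - 1) / (t - 1)) <= x * B x / A x.
  have /andP[_ H] := AB x t x0 t1.
  rewrite (_ : _ * _ = s * (A (t * x) - A x) / ((t - 1) * A x)); last first.
    by field; rewrite !gt_eqF.
  rewrite ler_pdivrMr ?mulr_gt0 //; apply: le_trans H _.
  rewrite le_eqVlt; apply/orP; left; apply/eqP; field.
  by rewrite gt_eqF.
have L2 : x * B x / A x <= s * (- (t * ((A (t^-1 * x) / A x - 1) / (t - 1)))).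
  have xt0 : 0 < t^-1 * x by rewrite mulr_gt0 // invr_gt0.
  have /andP[+ _] := AB _ t xt0 t1.
  rewrite (mulrA t) divff ?gt_eqF // mul1r => H.
  rewrite (_ : s * _ = t * (s * (A x - A (t^-1 * x))) / ((t - 1) * A x)); last first.
    by field; rewrite !gt_eqF.
  rewrite ler_pdivlMr ?mulr_gt0 // -ler_pdivrMl //; apply: le_trans H.
  rewrite le_eqVlt; apply/orP; left; apply/eqP; field.
  by rewrite !gt_eqF.
move: H1 H2 D1 D2; rewrite !ler_norml => /andP[? ?] /andP[? ?] /andP[? ?] /andP[? ?].
by apply/andP; split; lra.
Unshelve. all: by end_near. Qed.

End MonotoneDensity.

Section ExponentialSums.
Variable R : realType.
Variable q : nat -> R.
Hypothesis q0 : q 0 = 0.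
Hypothesis q_gt0 : forall x, (0 < x)%N -> 0 < q x.
Hypothesis q_homo : forall x y, (0 < x)%N -> (x <= y)%N -> q y <= q x.
Hypothesis q_summable : summable_seq q.

Definition expsum (t : R) : R := ssum (fun x => 1 - expR (- (t * q x))).

(** For k >= 1 this is the k-th derivative of [expsum] up to the sign (-1)^(k-1). *)
Definition expsum_deriv (k : nat) (t : R) : R :=
  ssum (fun x => q x ^+ k * expR (- (t * q x))).

Lemma q_ge0 x : 0 <= q x.
Proof. by case: x => [|x]; [rewrite q0|exact/ltW/q_gt0]. Qed.

Lemma one_sub_exp_le (u : R) : 1 - expR (- u) <= u.
Proof. by have := expR_ge1Dx (- u); lra. Qed.

Lemma one_sub_exp_ge0 (u : R) : 0 <= u -> 0 <= 1 - expR (- u).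
Proof. by move=> u0; rewrite subr_ge0 -expR0 ler_expR oppr_le0. Qed.

Lemma one_sub_exp_le1 (u : R) : 1 - expR (- u) <= 1.
Proof. by have := expR_gt0 (- u); lra. Qed.

Lemma summable_expsum t : 0 <= t -> summable_seq (fun x => 1 - expR (- (t * q x))).
Proof.
move=> t0; apply: (@summable_le _ _ (fun x => t * q x)); last exact: summableZ.
move=> x; rewrite ger0_norm; first exact: one_sub_exp_le.
by apply: one_sub_exp_ge0; rewrite mulr_ge0 // q_ge0.
Qed.

Lemma q_le1 x : q x <= q 1.
Proof. by case: x => [|x]; [rewrite q0; exact: q_ge0|exact: q_homo]. Qed.

Lemma summable_expsum_deriv k t : (0 < k)%N -> 0 <= t ->
  summable_seq (fun x => q x ^+ k * expR (- (t * q x))).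
Proof.
move=> k0 t0; apply: (@summable_le _ _ (fun x => q 1 ^+ k.-1 * q x)); last exact: summableZ.
move=> x; have qx := q_ge0 x; rewrite ger0_norm; last by rewrite mulr_ge0 ?exprn_ge0 // expR_ge0.
case: k k0 => // k _; rewrite exprSr /= -mulrA; apply: ler_pM.
- by rewrite exprn_ge0.
- by rewrite mulr_ge0 // expR_ge0.
- by apply: lerXn2r; rewrite ?nnegrE ?q_ge0 // q_le1.
- by rewrite ler_piMr // -expR0 ler_expR oppr_le0 mulr_ge0.
Qed.

Lemma expsum_gt0 t : 0 < t -> 0 < expsum t.
Proof.
move=> t0; apply: lt_le_trans (partial_le_ssum 2 _ (summable_expsum (ltW t0))).
  rewrite !big_ord_recr big_ord0 /= q0 mulr0 oppr0 expR0 subrr !add0r.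
  by rewrite subr_gt0 -expR0 ltr_expR oppr_lt0 mulr_gt0 // q_gt0.
by move=> x; apply: one_sub_exp_ge0; rewrite mulr_ge0 ?q_ge0 // ltW.
Qed.

Lemma expsum_deriv_gt0 k t : (0 < k)%N -> 0 < t -> 0 < expsum_deriv k t.
Proof.
move=> k0 t0; apply: lt_le_trans (partial_le_ssum 2 _ (summable_expsum_deriv k0 (ltW t0))).
  rewrite !big_ord_recr big_ord0 /= q0 expr0n gtn_eqF // mul0r !add0r.
  by rewrite mulr_gt0 ?exprn_gt0 ?q_gt0 // expR_gt0.
by move=> x; rewrite mulr_ge0 ?exprn_ge0 ?q_ge0 // expR_ge0.
Qed.

(** Convexity of the exponential, for [a] and [b] in either order. Summed over the symbols it gives
    the increment bounds of [monotone_density] without differentiating a series. *)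
Lemma exp_diff_bounds (a b : R) :
  (b - a) * expR (- b) <= expR (- a) - expR (- b) <= (b - a) * expR (- a).
Proof.
have H (u v : R) : (u - v) * expR v <= expR u - expR v.
  have := expR_ge1Dx (u - v); rewrite -(ler_pM2r (expR_gt0 v)) -expRD subrK; lra.
have := H (- a) (- b); have := H (- b) (- a); lra.
Qed.

Lemma expsum_diff x t : 0 < x -> 1 < t ->
  (t - 1) * x * expsum_deriv 1 (t * x) <= 1 * (expsum (t * x) - expsum x)
  <= (t - 1) * x * expsum_deriv 1 x.
Proof.
move=> x0 t1; have t0 : 0 < t by exact: lt_trans t1.
have tx0 : 0 < t * x by rewrite mulr_gt0.
have s1 := summable_expsum (ltW x0); have s2 := summable_expsum (ltW tx0).
have d1 := summable_expsum_deriv (ltn0Sn 0) (ltW x0).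
have d2 := summable_expsum_deriv (ltn0Sn 0) (ltW tx0).
rewrite mul1r /expsum /expsum_deriv -ssumB // -!ssumZ //.
have sB : summable_seq (fun i => 1 - expR (- (t * x * q i)) - (1 - expR (- (x * q i)))).
  rewrite (_ : (fun _ => _) = (fun i => (1 - expR (- (t * x * q i))) +
     (-1) * (1 - expR (- (x * q i))))); last by apply/funext => i; rewrite mulN1r.
  by apply: summableD => //; exact: summableZ.
apply/andP; split; apply: ler_ssum => //; [exact: summableZ| |exact: summableZ|].
- move=> i; rewrite expr1; have /andP[H _] := exp_diff_bounds (x * q i) (t * x * q i).
  have -> : (t - 1) * x * (q i * expR (- (t * x * q i))) =
     (t * x * q i - x * q i) * expR (- (t * x * q i)) by ring.
  by lra.
- move=> i; rewrite expr1; have /andP[_ H] := exp_diff_bounds (x * q i) (t * x * q i).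
  have -> : (t - 1) * x * (q i * expR (- (x * q i))) =
     (t * x * q i - x * q i) * expR (- (x * q i)) by ring.
  by lra.
Qed.

Lemma expsum_deriv_diff k x t : (0 < k)%N -> 0 < x -> 1 < t ->
  (t - 1) * x * expsum_deriv k.+1 (t * x) <=
    (-1) * (expsum_deriv k (t * x) - expsum_deriv k x)
  <= (t - 1) * x * expsum_deriv k.+1 x.
Proof.
move=> k0 x0 t1; have t0 : 0 < t by exact: lt_trans t1.
have tx0 : 0 < t * x by rewrite mulr_gt0.
have s1 := summable_expsum_deriv k0 (ltW x0); have s2 := summable_expsum_deriv k0 (ltW tx0).
have d1 := summable_expsum_deriv (ltn0Sn k) (ltW x0).
have d2 := summable_expsum_deriv (ltn0Sn k) (ltW tx0).
rewrite mulN1r opprB /expsum_deriv -ssumB // -!ssumZ //.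
have sB : summable_seq (fun i => q i ^+ k * expR (- (x * q i)) - q i ^+ k * expR (- (t * x * q i))).
  rewrite (_ : (fun _ => _) = (fun i => q i ^+ k * expR (- (x * q i)) +
     (-1) * (q i ^+ k * expR (- (t * x * q i))))); last by apply/funext => i; rewrite mulN1r.
  by apply: summableD => //; exact: summableZ.
apply/andP; split; apply: ler_ssum => //; [exact: summableZ| |exact: summableZ|].
- move=> i; have /andP[H _] := exp_diff_bounds (x * q i) (t * x * q i).
  have -> : (t - 1) * x * (q i ^+ k.+1 * expR (- (t * x * q i))) =
     q i ^+ k * ((t * x * q i - x * q i) * expR (- (t * x * q i))) by rewrite exprS; ring.
  by rewrite -mulrBr ler_wpM2l // exprn_ge0 // q_ge0.
- move=> i; have /andP[_ H] := exp_diff_bounds (x * q i) (t * x * q i).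
  have -> : (t - 1) * x * (q i ^+ k.+1 * expR (- (x * q i))) =
     q i ^+ k * ((t * x * q i - x * q i) * expR (- (x * q i))) by rewrite exprS; ring.
  by rewrite -mulrBr ler_wpM2l // exprn_ge0 // q_ge0.
Qed.

(** Concavity of [expsum] together with its value 0 at 0, checked term by term. *)
Lemma expsum_scale c t : 1 <= c -> 0 <= t -> expsum (c * t) <= c * expsum t.
Proof.
move=> c1 t0; have c0 : 0 <= c by exact: le_trans c1.
rewrite /expsum -ssumZ; last exact: summable_expsum.
apply: ler_ssum; first by apply: summable_expsum; exact: mulr_ge0.
  by apply: summableZ; exact: summable_expsum.
move=> i; set u := t * q i; have u0 : 0 <= u by rewrite mulr_ge0 // q_ge0.
rewrite -mulrA -/u.
have /andP[_ H1] := exp_diff_bounds u (c * u).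
have /andP[H2 _] := exp_diff_bounds 0 u; rewrite oppr0 expR0 addr0 in H2.
have : (c - 1) * (u * expR (- u)) <= (c - 1) * (1 - expR (- u)).
  by rewrite ler_wpM2l // subr_ge0.
by nra.
Qed.

Lemma expsum_homo s t : 0 <= s -> s <= t -> expsum s <= expsum t.
Proof.
move=> s0 st; apply: ler_ssum; [exact: summable_expsum|apply: summable_expsum; exact: le_trans st|].
by move=> i; rewrite lerD2l lerN2 ler_expR lerN2 ler_wpM2r // q_ge0.
Qed.

Lemma expsum_pinfty : expsum t @[t --> +oo] --> +oo.
Proof.
apply/cvgryPge => M; have [K MK] : exists K : nat, M <= K%:R / 2.
  exists `|Num.ceil (2 * M)|%N; rewrite ler_pdivlMr // mulrC natr_absz.
  by apply: le_trans (ceil_ge _) _; rewrite ler_int ler_norm.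
near=> t; apply: le_trans MK _.
have t0 : 0 < t by near: t; exact: nbhs_pinfty_gt.
have tq : (q K.+1)^-1 <= t by near: t; apply: nbhs_pinfty_ge; exact: num_real.
apply: le_trans (partial_le_ssum K.+1 _ (summable_expsum (ltW t0))); last first.
  by move=> i; apply: one_sub_exp_ge0; rewrite mulr_ge0 ?q_ge0 // ltW.
rewrite big_ord_recl /= q0 mulr0 oppr0 expR0 subrr add0r.
have -> : K%:R / 2 = \sum_(i < K) (2^-1 : R) by rewrite sumr_const card_ord mulr_natl.
apply: ler_sum => i _; rewrite /bump /= add1n.
have H : 1 <= t * q i.+1.
  rewrite -ler_pdivrMr ?q_gt0 // div1r; apply: le_trans tq.
  by rewrite lef_pV2 ?posrE ?q_gt0 // q_homo // ltnW // ltnS ltn_ord.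
have : expR (- (t * q i.+1)) <= 2^-1.
  rewrite expRN lef_pV2 ?posrE ?expR_gt0 //.
  by apply: le_trans (expR_ge1Dx _); lra.
by lra.
Unshelve. all: by end_near. Qed.

Variable gamma : R.
Hypothesis gamma_gt0 : 0 < gamma.
Hypothesis q_rv : forall N, (0 < N)%N ->
  q (N * m)%N / q m @[m --> \oo] --> (N%:R : R) `^ (- gamma^-1).

Lemma ssum_skip (f g : nat -> R) m0 : summable_seq f -> summable_seq g ->
  (forall x, 0 <= f x <= 1) -> (forall x, 0 <= g x) ->
  (forall x, (m0 <= x)%N -> f x <= g x) -> ssum f <= m0%:R + ssum g.
Proof.
move=> sf sg f01 g0 fg; apply: ssum_le_bound => // n.
apply: (@le_trans _ _ (\sum_(i < n) ((i < m0)%N%:R + g i))).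
  apply: ler_sum => i _; case: ltnP => [_|mi]; last by rewrite add0r fg.
  by have /andP[_ f1] := f01 i; have := g0 i; rewrite /=; lra.
rewrite big_split /= lerD //; last exact: partial_le_ssum.
rewrite -natr_sum ler_nat -(big_mkord xpredT (fun i => nat_of_bool (i < m0)%N)).
rewrite /index_iota subn0; apply: (@leq_trans (count (fun i => (i < m0)%N) (iota 0 n))).
  by rewrite -sum1_count [leqRHS]big_mkcond; apply: leq_sum => i _; case: (i < m0)%N.
rewrite -size_filter -[leqRHS](size_iota 0); apply: uniq_leq_size.
  by apply: filter_uniq; exact: iota_uniq.
by move=> i; rewrite mem_filter !mem_iota /= add0n => /andP[].
Qed.

(** By monotonicity a block of [N] consecutive indices is at least [N] times its last term and at
    most [N] times its first. The block starting at index 0, where [h] vanishes, costs at most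
    [N]. *)
Lemma ssum_dilate (h : nat -> R) N : (0 < N)%N -> h 0 = 0 ->
  (forall x, 0 <= h x <= 1) ->
  (forall x y, (0 < x)%N -> (x <= y)%N -> h y <= h x) -> summable_seq h ->
  [/\ summable_seq (fun m => h (N * m)%N),
      N%:R * ssum (fun m => h (N * m)%N) <= ssum h &
      ssum h <= N%:R + N%:R * ssum (fun m => h (N * m)%N)].
Proof.
move=> N0 h0 h01 hh sh.
have hge x : 0 <= h x by have /andP[] := h01 x.
have P1 K : N%:R * \sum_(m < K.+1) h (N * m)%N <= \sum_(y < (N * K).+1) h y.
  elim: K => [|K IH]; first by rewrite big_ord1 muln0 big_ord1 h0 mulr0.
  rewrite big_ord_recr /= mulrDr; apply: le_trans (lerD IH (lexx _)) _.
  rewrite mulnS addnC -addSn big_split_ord /= lerD2l.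
  rewrite mulr_natl -[leLHS](iter_addr_0) -[N in iter N]card_ord -[leLHS]big_const.
  apply: ler_sum => i _; apply: hh; first by rewrite addSn.
  by rewrite addSn ltn_add2l.
have P2 K : \sum_(y < N * K.+1) h y <= N%:R + N%:R * \sum_(m < K.+1) h (N * m)%N.
  elim: K => [|K IH].
    rewrite muln1 big_ord1 muln0 h0 mulr0 addr0 -[N in leRHS]card_ord -sumr_const.
    by apply: ler_sum => i _; have /andP[] := h01 i.
  rewrite mulnS addnC big_split_ord /= [in leRHS]big_ord_recr /= mulrDr addrA lerD //.
  rewrite mulr_natl -[leRHS](iter_addr_0) -[N in iter N]card_ord -[leRHS]big_const.
  apply: ler_sum => i _; apply: hh; first by rewrite muln_gt0 N0.
  exact: leq_addr.
have sN : summable_seq (fun m => h (N * m)%N).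
  apply: (@summable_ge0 _ _ (ssum h)) => // K.
  apply: (@le_trans _ _ (\sum_(m < K.+1) h (N * m)%N)).
    by rewrite big_ord_recr /= lerDl.
  apply: (@le_trans _ _ (N%:R * \sum_(m < K.+1) h (N * m)%N)).
    by rewrite ler_peMl ?sumr_ge0 // ler1n.
  by apply: le_trans (P1 K) _; exact: partial_le_ssum.
split => //.
  rewrite -ssumZ //; apply: ssum_le_bound; first exact: summableZ.
  move=> K; rewrite -mulr_sumr; apply: (@le_trans _ _ (N%:R * \sum_(m < K.+1) h (N * m)%N)).
    by rewrite ler_wpM2l // big_ord_recr /= lerDl.
  by apply: le_trans (P1 K) _; exact: partial_le_ssum.
apply: ssum_le_bound => // K.
apply: (@le_trans _ _ (\sum_(y < N * K.+1) h y)).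
  have KN : (K <= N * K.+1)%N by nia.
  by rewrite -(subnKC KN) big_split_ord /= lerDl sumr_ge0.
apply: le_trans (P2 K) _; rewrite lerD2l ler_wpM2l //.
exact: (@partial_le_ssum _ (fun m => h (N * m)%N)).
Qed.

(** The arithmetic of [expsum_scales_root]: [n] is the dilation factor, [m] the number of
    exceptional indices, [S] the dilated sum, [F] and [X] the values of [expsum] at t and at tau
    t. *)
Lemma ratio_estimate (m n F S X eta e : R) : 1 <= n -> 0 < e ->
  0 < eta -> eta <= 1 / 2 -> eta <= e / 4 -> 0 <= X -> 0 < F ->
  (m + 1) * n <= F * eta -> n * S <= F -> F <= n + n * S ->
  (1 - eta) * X <= m + S -> S <= m + (1 + eta) * X ->
  `|n^-1 - X / F| <= e.
Proof.
move=> N1 e0 eta0 eta12 eta4 X0 Ft0 FtL D1 D2 V1 V2.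
have e4 : 4 * eta <= e by lra.
have N0R : 0 < n by lra.
have W1 : n * ((1 - eta) * X) <= n * m + F.
  apply: (@le_trans _ _ (n * (m + S))); last by rewrite mulrDr lerD2l.
  by rewrite ler_wpM2l // ltW.
have W2 : F <= n * (m + 1) + n * ((1 + eta) * X).
  apply: le_trans D2 _; apply: (@le_trans _ _ (n + n * (m + (1 + eta) * X))).
    by rewrite lerD2l ler_wpM2l // ltW.
  by rewrite le_eqVlt; apply/orP; left; apply/eqP; ring.
have NX : 0 <= n * X by rewrite mulr_ge0 // ltW.
have em0 : 0 < 1 - eta by lra.
have NF : 0 <= eta * F by rewrite mulr_ge0 // ltW.
have Y1 : n * X <= (1 + 4 * eta) * F.
  rewrite -(ler_pM2l em0).
  have A1 : (1 - eta) * (n * X) <= (1 + eta) * F by lra.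
  apply: le_trans A1 _.
  have : 0 <= eta * F * (1 / 2 - eta) by rewrite mulr_ge0 // subr_ge0.
  by lra.
have Y2 : (1 - 4 * eta) * F <= n * X.
  have ep0 : 0 < 1 + eta by lra.
  rewrite -(ler_pM2l ep0).
  have A1 : (1 - eta) * F <= (1 + eta) * (n * X) by lra.
  apply: le_trans A1.
  have : 0 <= eta * F * eta by rewrite mulr_ge0 // ltW.
  by lra.
have -> : n^-1 - X / F = (F - n * X) / (n * F) by field; rewrite !gt_eqF.
rewrite normrM normfV (ger0_norm (x := n * F)); last by rewrite mulr_ge0 // ltW.
rewrite ler_pdivrMr ?mulr_gt0 //; apply: (@le_trans _ _ (4 * eta * F)).
  by rewrite ler_norml; lra.
apply: (@le_trans _ _ (e * F)).
  by rewrite ler_wpM2r // ltW.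
by rewrite ler_wpM2l ?ler_peMl // ltW.
Qed.

(** The sum of 1 - exp(- t q(N m)) over m is evaluated twice. It is close to F(t) / N by monotone
    blocks, and close to F(tau t) because q(N m) is nearly tau q(m). Here tau^gamma = 1 / N. *)
Lemma expsum_scales_root N : (0 < N)%N ->
  scales_at expsum gamma ((N%:R : R) `^ (- gamma^-1)).
Proof.
move=> N0; set tau := _ `^ _; have N0R : 0 < N%:R :> R by rewrite ltr0n.
have tau0 : 0 < tau by exact: powR_gt0.
rewrite /scales_at; have -> : tau `^ gamma = N%:R^-1.
  by rewrite /tau -powRrM mulNr mulVf ?gt_eqF // powR_inv1 // ltW.
apply/cvgrPdist_le => e e0.
pose eta := Num.min (1 / 2) (e / 4).
have eta0 : 0 < eta by rewrite lt_min !divr_gt0.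
have eta12 : eta <= 1 / 2 by rewrite ge_min lexx.
have eta4 : eta <= e / 4 by rewrite ge_min lexx orbT.
have em0 : 0 < 1 - eta by lra.
have em : 0 <= 1 - eta by exact: ltW.
have em1 : 1 <= (1 - eta)^-1 by rewrite invf_ge1 //; lra.
have ep : 0 <= 1 + eta by lra.
have ep1 : 1 <= 1 + eta by lra.
have [m0 Hm0] : exists m0, forall m, (m0 <= m)%N ->
   (1 - eta) * tau * q m <= q (N * m)%N <= (1 + eta) * tau * q m.
  have /cvgrPdist_le/(_ (eta * tau)) := q_rv N0.
  rewrite mulr_gt0 // => /(_ isT) [m1 _ Hm1]; exists m1.+1 => m m1m.
  have /= := Hm1 m (ltnW m1m); have qm := q_gt0 (leq_ltn_trans (leq0n m1) m1m).
  rewrite -/tau ler_norml => /andP[A B].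
  have A' : q (N * m)%N / q m <= (1 + eta) * tau by lra.
  have B' : (1 - eta) * tau <= q (N * m)%N / q m by lra.
  by rewrite ler_pdivrMr // in A'; rewrite ler_pdivlMr // in B'; apply/andP.
(* For large t the [m0] exceptional terms and the first block together weigh at most [eta] times
   F(t). *)
have Fy := expsum_pinfty; have /cvgryPge/(_ ((m0.+1)%:R * N%:R / eta)) Fy' := Fy.
near=> t.
have t0 : 0 < t by near: t; exact: nbhs_pinfty_gt.
have Ft0 := expsum_gt0 t0; have FtL : (m0.+1)%:R * N%:R / eta <= expsum t by near: t.
rewrite ler_pdivrMr // in FtL.
have u01 c (x : nat) : 0 <= c -> 0 <= 1 - expR (- (c * q x)) <= 1.
  by move=> c0; rewrite one_sub_exp_le1 one_sub_exp_ge0 // mulr_ge0 // q_ge0.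
pose h x := 1 - expR (- (t * q x)).
have h0 : h 0 = 0 by rewrite /h q0 mulr0 oppr0 expR0 subrr.
have hh x y : (0 < x)%N -> (x <= y)%N -> h y <= h x.
  by move=> x0 xy; rewrite lerD2l lerN2 ler_expR lerN2 ler_wpM2l ?q_homo // ltW.
have [sN D1 D2] := ssum_dilate N0 h0 (fun x => u01 t x (ltW t0)) hh (summable_expsum (ltW t0)).
rewrite -/(expsum t) in D1 D2; set S := ssum _ in D1 D2.
have tt0 : 0 <= tau * t by rewrite mulr_ge0 ?ltW.
have U1 : expsum ((1 - eta) * (tau * t)) <= m0%:R + S.
  apply: ssum_skip => //.
  - by apply: summable_expsum; rewrite mulr_ge0.
  - by move=> x; apply: u01; rewrite mulr_ge0.
  - by move=> x; have /andP[] := u01 t (N * x)%N (ltW t0).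
  - move=> x mx; rewrite /h lerD2l lerN2 ler_expR lerN2.
    have /andP[H _] := Hm0 x mx.
    rewrite (_ : _ * _ * q x = t * ((1 - eta) * tau * q x)); last by ring.
    by rewrite ler_wpM2l // ltW.
have U2 : S <= m0%:R + expsum ((1 + eta) * (tau * t)).
  apply: ssum_skip => //.
  - by apply: summable_expsum; rewrite mulr_ge0.
  - by move=> x; exact: u01 (ltW t0).
  - by move=> x; have /andP[] := u01 ((1 + eta) * (tau * t)) x (mulr_ge0 ep tt0).
  - move=> x mx; rewrite /h lerD2l lerN2 ler_expR lerN2.
    have /andP[_ H] := Hm0 x mx.
    rewrite (_ : _ * _ * q x = t * ((1 + eta) * tau * q x)); last by ring.
    by rewrite ler_wpM2l // ltW.
have V1 : (1 - eta) * expsum (tau * t) <= expsum ((1 - eta) * (tau * t)).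
  rewrite -ler_pdivlMl //.
  have := expsum_scale em1 (mulr_ge0 em tt0).
  by rewrite mulrA mulVf ?mul1r // gt_eqF.
have V2 : expsum ((1 + eta) * (tau * t)) <= (1 + eta) * expsum (tau * t).
  exact: expsum_scale ep1 tt0.
have X0 : 0 <= expsum (tau * t) by apply/ltW/expsum_gt0; rewrite mulr_gt0.
set X := expsum (tau * t) in V1 V2 X0 *; set F := expsum t in Ft0 FtL D1 D2 *.
have {}V1 : (1 - eta) * X <= m0%:R + S := le_trans V1 U1.
have {}V2 : S <= m0%:R + (1 + eta) * X.
  by apply: le_trans U2 _; rewrite lerD2l.
clear U1 U2; move: X F S X0 Ft0 FtL D1 D2 V1 V2 => X F S X0 Ft0 FtL D1 D2 V1 V2.
by apply: (@ratio_estimate m0%:R N%:R F S X eta) => //; rewrite ?ler1n // natr1.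
Unshelve. all: by end_near. Qed.

(** Quotients of the scales N^(-1/gamma) for consecutive N exceed 1 and tend to 1. [M] is chosen so
    large that 1 / M < (1 + d)^gamma - 1. *)
Lemma expsum_scales_near1 (d : R) : 0 < d ->
  exists t, [/\ 1 < t, t < 1 + d & scales_at expsum gamma t].
Proof.
move=> d0; have gV : 0 < gamma^-1 by rewrite invr_gt0.
have b1 : 1 < (1 + d) `^ gamma.
  have := @gt0_ltr_powR _ _ gamma_gt0 1 (1 + d).
  by rewrite powR1; apply; rewrite ?nnegrE ?ltrDl ?addr_ge0 // ltW.
pose M := `|Num.ceil (((1 + d) `^ gamma - 1)^-1)|.+1%N.
have M0 : 0 < M%:R :> R by rewrite ltr0n.
have M1 : 0 < M.+1%:R :> R by rewrite ltr0n.
have HM : ((1 + d) `^ gamma - 1)^-1 < M%:R.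
  rewrite /M -natr1 natr_absz; apply: le_lt_trans (ceil_ge _) _.
  by rewrite ltr_pwDr // ler_int ler_norm.
have aE : M.+1%:R / M%:R = 1 + M%:R^-1 :> R.
  by rewrite -natr1 mulrDl divff ?gt_eqF // mul1r.
have a0 : 0 < M.+1%:R / M%:R :> R by rewrite divr_gt0.
exists ((M.+1%:R / M%:R) `^ gamma^-1); split.
- have := @gt0_ltr_powR _ _ gV 1 (M.+1%:R / M%:R).
  by rewrite powR1; apply; rewrite ?nnegrE ?ler01 ?(ltW a0) // aE ltrDl invr_gt0.
- have -> : 1 + d = ((1 + d) `^ gamma) `^ gamma^-1.
    by rewrite -powRrM mulfV ?gt_eqF // powRr1 //; lra.
  rewrite gt0_ltr_powR ?nnegrE ?powR_ge0 ?(ltW a0) // aE -ltrBrDl.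
  by rewrite -(invrK (_ - 1)) ltf_pV2 ?posrE ?invr_gt0 // subr_gt0.
- have -> : (M.+1%:R / M%:R) `^ gamma^-1 =
     ((M.+1%:R : R) `^ (- gamma^-1))^-1 * (M%:R `^ (- gamma^-1)).
    rewrite powRM ?invr_ge0 ?ltW // powR_invl // -powRN opprK.
    by [].
  apply: scales_at_mul.
  + by rewrite invr_gt0 powR_gt0.
  + by rewrite powR_gt0.
  + exact: expsum_gt0.
  + by apply: scales_at_inv; [exact: powR_gt0|exact: expsum_scales_root].
  + exact: expsum_scales_root.
Qed.

(** B(x) is asymptotic to c A(x) / x, so it scales like A with the exponent lowered by 1. *)
Lemma scales_at_deriv (A B : R -> R) (c rho t : R) : 0 < t -> c != 0 ->
  (forall x, 0 < x -> 0 < A x) -> (forall x, 0 < x -> 0 < B x) ->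
  scales_at A rho t -> x * B x / A x @[x --> +oo] --> c ->
  scales_at B (rho - 1) t.
Proof.
move=> t0 c0 A0 B0 HA HB; rewrite /scales_at.
have -> : t `^ (rho - 1) = c * c^-1 * t `^ rho * t^-1.
  by rewrite mulfV // mul1r powRD ?powR_inv1 ?(ltW t0) // (gt_eqF t0) implybT.
apply: cvg_trans (cvgM (cvgM (cvgM (cvg_scale t0 HB) (cvgV c0 HB)) HA) (cvg_cst t^-1)).
 apply: near_eq_cvg; near=> x.
have x0 : 0 < x by near: x; exact: nbhs_pinfty_gt.
have tx0 : 0 < t * x by exact: mulr_gt0.
have := A0 _ x0; have := A0 _ tx0; have := B0 _ x0 => *; rewrite /=; field.
by rewrite !gt_eqF.
Unshelve. all: by end_near. Qed.

Hypothesis gamma_lt1 : gamma < 1.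

(** The absolute value of gamma (gamma - 1) ... (gamma - k + 1), the coefficient in the k-th
    derivative of t^gamma, for k >= 1. *)
Definition density_coeff (k : nat) : R := gamma * \prod_(1 <= j < k) (j%:R - gamma).

Lemma expsum_deriv1_ratio : x * expsum_deriv 1 x / expsum x @[x --> +oo] --> gamma.
Proof.
rewrite -[gamma in X in _ --> X]mul1r; apply: (@monotone_density _ _ _ 1).
- exact: expsum_gt0.
- by move=> x t x0 t1; exact: expsum_diff.
- exact: expsum_scales_near1.
Qed.

(** The two parts feed each other: scaling of the k-th derivative gives the ratio by monotone
    density with sign -1, and the ratio, nonzero since gamma < 1 <= k, gives scaling of the next
    derivative. *)
Lemma expsum_deriv_ratio k : (0 < k)%N ->
  (x * expsum_deriv k.+1 x / expsum_deriv k x @[x --> +oo] --> k%:R - gamma) /\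
  (forall t, 1 < t -> scales_at expsum gamma t ->
     scales_at (expsum_deriv k) (gamma - k%:R) t).
Proof.
have gN0 : gamma != 0 by rewrite gt_eqF.
have E0 := expsum_gt0; have D0 := expsum_deriv_gt0.
have step j : (0 < j)%N -> (forall t, 1 < t -> scales_at expsum gamma t ->
     scales_at (expsum_deriv j) (gamma - j%:R) t) ->
     x * expsum_deriv j.+1 x / expsum_deriv j x @[x --> +oo] --> j%:R - gamma.
  move=> k0 Hs; rewrite -opprB -mulN1r; apply: (@monotone_density _ _ _ (-1)).
  - by move=> x; exact: D0.
  - by move=> x t x0 t1; exact: expsum_deriv_diff.
  - move=> d /expsum_scales_near1[t [t1 td Ht]]; exists t; split => //.
    exact: Hs.
have base := expsum_deriv1_ratio.
elim: k => // k IH _; case: k IH => [_|k IH].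
  have Hs t : 1 < t -> scales_at expsum gamma t -> scales_at (expsum_deriv 1) (gamma - 1%:R) t.
    move=> t1 Ht; apply: (scales_at_deriv _ gN0 E0 _ Ht base).
      by exact: lt_trans t1.
    by move=> x; exact: D0.
  by split => //; exact: step.
have {IH} [IH1 IH2] := IH isT.
have Hs t : 1 < t -> scales_at expsum gamma t ->
    scales_at (expsum_deriv k.+2) (gamma - k.+2%:R) t.
  move=> t1 Ht; rewrite -(natr1 k.+1) opprD addrA.
  apply: (scales_at_deriv _ _ _ _ (IH2 t t1 Ht) IH1).
  - by exact: lt_trans t1.
  - by rewrite gt_eqF // subr_gt0 (lt_le_trans gamma_lt1) // ler1n.
  - by move=> x; exact: D0.
  - by move=> x; exact: D0.
by split => //; exact: step.
Qed.

Lemma expsum_deriv_asymp k : (0 < k)%N ->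
  x ^+ k * expsum_deriv k x / expsum x @[x --> +oo] --> density_coeff k.
Proof.
elim: k => // k IH _; case: k IH => [_|k IH].
  by rewrite /density_coeff big_geq // mulr1; exact: expsum_deriv1_ratio.
have [H _] := expsum_deriv_ratio (ltn0Sn k).
rewrite /density_coeff big_nat_recr //= mulrA mulrC.
apply: cvg_trans (cvgM H (IH isT)); apply: near_eq_cvg; near=> x.
have x0 : 0 < x by near: x; exact: nbhs_pinfty_gt.
rewrite /= (exprS x k.+1); move: (x ^+ k.+1) => y; field.
by rewrite !gt_eqF ?expsum_gt0 ?expsum_deriv_gt0.
Unshelve. all: by end_near. Qed.

End ExponentialSums.

(** * The Gamma function and the Sibuya weights *)

Section GammaFunction.
Variable R : realType.
Notation mu := (@lebesgue_measure R).

Definition gamma_integrand (s t : R) : R := t `^ (s - 1) * expR (- t).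

Definition gamma_integral (s : R) : \bar R :=
  (\int[mu]_(t in `]0%R, +oo[) (gamma_integrand s t)%:E)%E.

Lemma GammaE s : Gamma s = fine (gamma_integral s).
Proof. by []. Qed.

Lemma gamma_integrand_ge0 s t : 0 <= gamma_integrand s t.
Proof. by rewrite mulr_ge0 ?powR_ge0 ?expR_ge0. Qed.

Lemma measurable_gamma_integrand s (D : set R) :
  measurable_fun D (EFin \o gamma_integrand s).
Proof.
apply/measurable_EFinP; apply: measurable_funTS; apply: measurable_funM.
  exact: measurable_powR.
by apply: measurableT_comp => //; exact: measurable_expR.
Qed.

Lemma gamma_integral_ge0 s : (0 <= gamma_integral s)%E.
Proof. by apply: integral_ge0 => t _; rewrite lee_fin gamma_integrand_ge0. Qed.

(** Compact intervals away from 0, where the integrand may be singular; integration by parts is done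
    there and passed to the limit. *)
Definition exhaust (n : nat) : set R := `[n.+1%:R^-1, n.+1%:R]%classic.

Lemma gamma_integral_cvg s :
  (\int[mu]_(t in exhaust n) (gamma_integrand s t)%:E)%E @[n --> \oo] -->
  gamma_integral s.
Proof.
rewrite /gamma_integral (_ : `]0%R, +oo[%classic = \bigcup_n exhaust n).
  apply: ge0_nondecreasing_set_cvg_integral.
  - apply/nondecreasing_seqP => n; apply/subsetPset => t.
    rewrite /exhaust /= !in_itv /= => /andP[a b]; apply/andP; split.
      by apply: le_trans a; rewrite lef_pV2 ?posrE ?ltr0n // ler_nat.
    by apply: le_trans b _; rewrite ler_nat.
  - by move=> i; exact: measurable_itv.
  - by move=> i; exact: measurable_gamma_integrand.
  - by move=> i x _; rewrite lee_fin gamma_integrand_ge0.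
apply/seteqP; split => t /=; rewrite in_itv /= ?andbT.
  move=> t0; pose n := maxn `|Num.ceil t|%N `|Num.ceil t^-1|%N.
  have nat_ge (u : R) : 0 <= u -> u <= `|Num.ceil u|%N%:R.
    by move=> u0; rewrite natr_absz; apply: le_trans (ceil_ge _) _; rewrite ler_int ler_norm.
  exists n => //; rewrite /exhaust /= in_itv /=; apply/andP; split.
    rewrite -(invrK t) lef_pV2 ?posrE ?invr_gt0 ?ltr0n //.
    apply: le_trans (nat_ge _ _) _; first by rewrite invr_ge0 ltW.
    by rewrite ler_nat leqW // leq_max leqnn orbT.
  apply: le_trans (nat_ge _ (ltW t0)) _.
  by rewrite ler_nat leqW // leq_max leqnn.
by move=> [n _]; rewrite /exhaust /= in_itv /= => /andP[+ _]; apply: lt_le_trans; rewrite invr_gt0 ltr0n.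
Qed.

Lemma derivable_powR (s t : R) : 0 < t -> derivable (fun u => u `^ s) t 1.
Proof. by move=> t0; have [] := is_derive1_powR s t0. Qed.

Lemma derivable_continuous (f : R -> R) t : derivable f t 1 -> f u @[u --> t] --> f t.
Proof. by move=> /derivable1_diffP/differentiable_continuous. Qed.

Lemma gamma_by_parts s a b : 0 < a -> a < b ->
  (\int[mu]_(t in `[a, b]) (gamma_integrand (s + 1) t)%:E =
   (a `^ s * expR (- a) - b `^ s * expR (- b))%:E +
   s%:E * \int[mu]_(t in `[a, b]) (gamma_integrand s t)%:E)%E.
Proof.
move=> a0 ab.
have pos t : a <= t -> 0 < t by exact: lt_le_trans.
have posin t : t \in `[a, b] -> 0 < t by rewrite in_itv /= => /andP[/pos].
have dexp (t : R) : is_derive t 1 (fun u => - expR (- u)) (expR (- t)).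
  by apply: is_derive_eq; rewrite !mulrN1 opprK.
have cexp : {within `[a, b], continuous (fun t : R => expR (- t))}.
  apply: continuous_subspaceT => t; apply: continuous_comp; first exact: opp_continuous.
  exact: continuous_expR.
have cint r : {within `[a, b], continuous (gamma_integrand r)}.
  apply: derivable_within_continuous => t /posin t0; apply: derivableM.
    exact: derivable_powR.
  have [dd _] := dexp t; rewrite (_ : (fun u => _) = (- (fun u : R => - expR (- u)))).
    exact: derivableN.
  by apply/funext => u; rewrite /= opprK.
have key := @integration_by_parts R (fun t => t `^ s) (fun t => - expR (- t))
   (fun t => s * t `^ (s - 1)) (fun t => expR (- t)) a b ab.
transitivity (\int[mu]_(x in `[a, b]) (x `^ s * expR (- x))%:E)%E.
  by apply: eq_integral => t _; rewrite /gamma_integrand addrK.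
rewrite key //.
- rewrite (_ : (\int[mu]_(x in `[a, b]) (s * x `^ (s - 1) * - expR (- x))%:E)%E =
     ((- s)%:E * \int[mu]_(t in `[a, b]) (gamma_integrand s t)%:E)%E).
    rewrite EFinN mulNe oppeK; congr (_%:E + _)%E; ring.
  rewrite -integralZl //.
    by apply: eq_integral => t _; rewrite -EFinM /gamma_integrand; congr (_%:E); ring.
  apply: continuous_compact_integrable; first exact: segment_compact.
  exact: cint.
- apply: derivable_within_continuous => t /posin t0.
  by apply: derivableM => //; exact: derivable_powR.
- split.
  + by move=> t; rewrite in_itv /= => /andP[/ltW/pos t0 _]; exact: derivable_powR.
  + by apply: cvg_at_right_filter; exact: (@derivable_continuous (fun u => u `^ s) a (@derivable_powR s a a0)).
  + apply: cvg_at_left_filter.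
    exact: (@derivable_continuous (fun u => u `^ s) b (@derivable_powR s b (lt_trans a0 ab))).
- move=> t; rewrite in_itv /= => /andP[/ltW/pos t0 _]; rewrite derive1E.
  by have [_ ->] := is_derive1_powR s t0.
- split.
  + by move=> t _; have [] := dexp t.
  + apply: cvg_at_right_filter; apply: (@derivable_continuous (fun u => - expR (- u))).
    by have [] := dexp a.
  + apply: cvg_at_left_filter; apply: (@derivable_continuous (fun u => - expR (- u))).
    by have [] := dexp b.
- by move=> t _; rewrite derive1E; have [_ ->] := dexp t.
Qed.

(** A single term of the exponential series, of order one above an integer bound for [s], already
    dominates the power. *)
Lemma powR_expRN_cvg0 (s : R) : 0 < s -> (n.+1%:R : R) `^ s * expR (- n.+1%:R) @[n --> \oo] --> (0 : R).
Proof.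
move=> s0; pose k := `|Num.ceil s|%N.
have sk : s <= k%:R.
  by rewrite natr_absz; apply: le_trans (ceil_ge _) _; rewrite ler_int ler_norm.
have H : (k.+1`!%:R : R) * n.+1%:R^-1 @[n --> \oo] --> (0 : R).
  rewrite -[X in _ --> X](mulr0 (k.+1`!%:R)); apply: cvgM; first exact: cvg_cst.
  exact: cvg_harmonic.
apply: (squeeze_cvgr _ _ H); last exact: cvg_cst.
near=> n; rewrite mulr_ge0 ?powR_ge0 ?expR_ge0 //=.
have n1 : 1 <= n.+1%:R :> R by rewrite ler1n.
have n0 : 0 < n.+1%:R :> R by rewrite ltr0n.
apply: (@le_trans _ _ (n.+1%:R ^+ k * expR (- n.+1%:R))).
  rewrite ler_wpM2r ?expR_ge0 // -[leRHS](powR_mulrn k (ltW n0)).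
  exact: ler_powR.
have f0 : 0 < k.+1`!%:R :> R by rewrite ltr0n fact_gt0.
have E : n.+1%:R ^+ k.+1 / k.+1`!%:R <= expR n.+1%:R :> R.
  by have := @expR_ge1Dxn R n.+1%:R k (ltW n0); lra.
rewrite expRN ler_pdivrMr ?expR_gt0 // mulrAC ler_pdivlMr // mulrC -exprS.
by rewrite ler_pdivrMr // in E; rewrite mulrC.
Unshelve. all: by end_near. Qed.

Lemma gamma_integralS (s : R) : 0 < s ->
  gamma_integral (s + 1) = (s%:E * gamma_integral s)%E.
Proof.
move=> s0; have H1 := @gamma_integral_cvg (s + 1).
have H2 : (((n.+1%:R^-1 : R) `^ s * expR (- n.+1%:R^-1) - n.+1%:R `^ s * expR (- n.+1%:R))%:E +
    s%:E * (\int[mu]_(t in exhaust n) (gamma_integrand s t)%:E))%E @[n --> \oo] -->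
    (0%:E + s%:E * gamma_integral s)%E.
  apply: cvgeD; first by rewrite fin_num_adde_defr.
    apply: cvg_EFin; first exact: nearW.
    rewrite -[X in _ --> X]subr0; apply: cvgB; last exact: powR_expRN_cvg0.
    have H : (n.+1%:R^-1 : R) `^ s @[n --> \oo] --> (0 : R).
      have /cvg_at_rightP H := @powR_cvg0 R s s0.
      apply: (H (fun n => n.+1%:R^-1)); split; last exact: cvg_harmonic.
      by move=> n; rewrite invr_gt0 ltr0n.
    apply: (squeeze_cvgr _ _ H); last exact: cvg_cst.
    apply: nearW => n; rewrite mulr_ge0 ?powR_ge0 ?expR_ge0 //=.
    have e1 : expR (- n.+1%:R^-1) <= 1 :> R by rewrite -[leRHS]expR0 ler_expR oppr_le0 invr_ge0.
    by rewrite ler_piMr ?powR_ge0.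
  by apply: cvgeZl => //; exact: gamma_integral_cvg.
rewrite add0e in H2; apply: (cvg_unique _ H1) => //.
apply: cvg_trans H2; apply: near_eq_cvg; near=> n.
(* For n = 0 the interval is the single point 1, to which integration by parts does not apply. *)
have n2 : (1 <= n)%N by near: n; exact: nbhs_infty_ge.
have n0 : 0 < n.+1%:R^-1 :> R by rewrite invr_gt0 ltr0n.
have ab : n.+1%:R^-1 < n.+1%:R :> R.
  by apply: (@lt_trans _ _ 1); [rewrite invf_lt1 ?ltr0n // ltr1n|rewrite ltr1n].
exact/esym/gamma_by_parts.
Unshelve. all: by end_near. Qed.

Lemma gamma_integral1 : gamma_integral 1 = 1%E.
Proof.
rewrite /gamma_integral.
have E t : gamma_integrand 1 t = expR (- t) by rewrite /gamma_integrand subrr powRr0 mul1r.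
under eq_integral do rewrite E.
have dexp (t : R) : is_derive t 1 (fun u => - expR (- u)) (expR (- t)).
  by apply: is_derive_eq; rewrite !mulrN1 opprK.
have cexp (t : R) : - expR (- u) @[u --> t] --> - expR (- t).
  by apply: (@derivable_continuous (fun u => - expR (- u))); have [] := dexp t.
rewrite integral_itv_obnd_cbnd; last first.
  apply/measurable_EFinP; apply: measurable_funTS.
  by apply: measurableT_comp => //; exact: measurable_expR.
rewrite (@ge0_continuous_FTC2y _ _ (fun x => - (expR (- x))) _ 0) //.
- by rewrite oppr0 expR0 EFinN oppeK add0e.
- apply: continuous_subspaceT => t; apply: continuous_comp; first exact: opp_continuous.
  exact: continuous_expR.
- by rewrite -oppr0; apply: cvgN; exact: cvgr_expR.
- by apply: cvg_at_right_filter; exact: cexp.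
- by move=> t _; rewrite derive1E; have [_ ->] := dexp t.
Qed.

Lemma GammaS (s : R) : 0 < s -> Gamma (s + 1) = s * Gamma s.
Proof.
move=> s0; rewrite !GammaE gamma_integralS //.
(* An infinite integral is sent to 0 by [fine] on both sides. *)
case: (gamma_integral s) (gamma_integral_ge0 s) => [r||] //= _.
by rewrite gt0_muley ?lte_fin //= mulr0.
Qed.

Lemma Gamma1 : Gamma (1 : R) = 1.
Proof. by rewrite GammaE gamma_integral1. Qed.

(** Finiteness has to be proved, since [fine] sends infinity to 0. From t^s <= 1 + t the integral at
    s + 1 is at most the sum of those at 1 and 2, and the functional equation brings this back to
    [s]. Positivity is visible on ]0, 1[. *)
Lemma Gamma_gt0 (s : R) : 0 < s -> s <= 1 -> 0 < Gamma s.
Proof.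
move=> s0 s1; rewrite GammaE.
have I2 : gamma_integral 2 = 1%E.
  rewrite (_ : 2 = 1 + 1 :> R); last by rewrite -natr1.
  by rewrite gamma_integralS // gamma_integral1 mule1.
have fin1 : (gamma_integral (s + 1) < +oo)%E.
  apply: (@le_lt_trans _ _ (gamma_integral 1 + gamma_integral 2)%E); last first.
    by rewrite gamma_integral1 I2 -EFinD ltry.
  rewrite /gamma_integral -ge0_integralD //; last 4 first.
  - by move=> t _; rewrite lee_fin gamma_integrand_ge0.
  - exact: measurable_gamma_integrand.
  - by move=> t _; rewrite lee_fin gamma_integrand_ge0.
  - exact: measurable_gamma_integrand.
  apply: ge0_le_integral => //.
  - by move=> t _; rewrite lee_fin gamma_integrand_ge0.
  - exact: measurable_gamma_integrand.
  - by apply: emeasurable_funD; exact: measurable_gamma_integrand.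
  move=> t; rewrite /= in_itv /= andbT => t0.
  rewrite -EFinD lee_fin -mulrDl ler_wpM2r ?expR_ge0 // addrK subrr powRr0.
  rewrite (_ : 2 - 1 = 1 :> R) ?(powRr1 (ltW t0)); last by lra.
  have [t1|t1] := leP t 1.
    apply: (@le_trans _ _ 1); last by rewrite lerDl ltW.
    by rewrite -(powRr0 t); apply: ger_powR; rewrite ?t0 // ltW.
  apply: (@le_trans _ _ t); last by rewrite lerDr.
  by rewrite -[leRHS](powRr1 (ltW t0)) ler_powR // ltW.
have finS : (gamma_integral s < +oo)%E.
  move: fin1; rewrite gamma_integralS //; case: (gamma_integral s) (gamma_integral_ge0 s) => //=.
    by move=> r _ _; exact: ltry.
  by rewrite gt0_muley ?lte_fin.
rewrite fine_gt0 // finS andbT.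
apply: (@lt_le_trans _ _ (\int[mu]_(t in `]0%R, 1%R[) (expR (-1))%:E)%E).
  rewrite integral_cst //= lebesgue_measure_itv /= lte_fin ltr01 oppr0 adde0 mule1.
  by rewrite lte_fin expR_gt0.
apply: (@le_trans _ _ (\int[mu]_(t in `]0%R, 1%R[) (gamma_integrand s t)%:E)%E).
  apply: ge0_le_integral => //.
  - exact: measurable_gamma_integrand.
  move=> t; rewrite /= in_itv /= => /andP[t0 t1]; rewrite lee_fin.
  rewrite -[leLHS]mul1r; apply: ler_pM => //.
    rewrite -[leLHS](powRr0 t); apply: ger_powR; first by rewrite t0 (ltW t1).
    by rewrite subr_le0.
  by rewrite ler_expR lerN2 ltW.
apply: ge0_subset_integral => //.
- exact: measurable_gamma_integrand.
- by move=> t _; rewrite lee_fin gamma_integrand_ge0.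
- by move=> t /=; rewrite !in_itv /= => /andP[->].
Qed.

Lemma Gamma_fact n : Gamma (n.+1%:R : R) = n`!%:R.
Proof.
elim: n => [|n IH]; first exact: Gamma1.
by rewrite -natr1 GammaS ?ltr0n // IH factS natrM.
Qed.

Lemma Gamma_shift (g : R) l : g < 1 -> (0 < l)%N ->
  Gamma (l%:R - g) = \prod_(1 <= j < l) (j%:R - g) * Gamma (1 - g).
Proof.
move=> g1; elim: l => // l IH _; case: l IH => [|l] IH.
  by rewrite big_geq // mul1r.
rewrite -(natr1 l.+1) addrAC GammaS; last first.
  by rewrite subr_gt0 (lt_le_trans g1) // ler1n.
by rewrite [in RHS]big_nat_recr //= IH // mulrCA mulrA.
Qed.

Lemma sibuyaE (g : R) l : 0 < g -> g < 1 -> (0 < l)%N ->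
  sibuya g l = density_coeff g l / l`!%:R.
Proof.
move=> g0 g1 l0; rewrite /sibuya Gamma_shift // Gamma_fact /density_coeff.
have G0 : 0 < Gamma (1 - g) by apply: Gamma_gt0; lra.
by field; rewrite !gt_eqF // ltr0n fact_gt0.
Qed.

End GammaFunction.

Section SibuyaMass.
Variable R : realType.
Variable gamma : R.
Hypothesis gamma_gt0 : 0 < gamma.
Hypothesis gamma_lt1 : gamma < 1.

(** Agrees with [sibuya] for l >= 1 by [sibuyaE]; the value 0 at index 0 lets sums start there. *)
Definition sibuya_mass (l : nat) : R :=
  if l is 0 then 0 else density_coeff gamma l / l`!%:R.

Lemma density_coeff_ge0 l : 0 <= density_coeff gamma l.
Proof.
apply: mulr_ge0; first exact: ltW.
rewrite big_nat; apply: prodr_ge0 => j /andP[j0 _].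
by rewrite subr_ge0 (le_trans (ltW gamma_lt1)) // ler1n.
Qed.

Lemma sibuya_mass_ge0 l : 0 <= sibuya_mass l.
Proof. by case: l => // l; rewrite divr_ge0 ?density_coeff_ge0. Qed.

(** The weight at l is gamma / l times the product of 1 - gamma / j over j < l: the law of a waiting
    time with hazard rate gamma / l, whose partial sums telescope. *)
Lemma sibuya_mass_partial L :
  \sum_(l < L.+1) sibuya_mass l = 1 - \prod_(1 <= j < L.+1) (1 - gamma / j%:R).
Proof.
elim: L => [|L IH]; first by rewrite big_ord1 big_geq // subrr.
rewrite big_ord_recr IH [X in _ = 1 - X]big_nat_recr //= /density_coeff.
have E : \prod_(1 <= j < L.+1) (j%:R - gamma) = L`!%:R * \prod_(1 <= j < L.+1) (1 - gamma / j%:R).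
  elim: L {IH} => [|L IH]; first by rewrite !big_geq // mulr1.
  rewrite big_nat_recr //= [X in _ = _ * X]big_nat_recr //= IH factS natrM.
  move: (\prod_(_ <= _ < _) _) => X; field.
  by rewrite nat1r pnatr_eq0.
have f0 : L`!%:R != 0 :> R by rewrite pnatr_eq0 -lt0n fact_gt0.
rewrite E factS natrM; move: (\prod_(_ <= _ < _) _) => X; field.
by rewrite f0 nat1r pnatr_eq0.
Qed.

Lemma sibuya_mass_partial_le1 L : \sum_(l < L) sibuya_mass l <= 1.
Proof.
apply: (@le_trans _ _ (\sum_(l < L.+1) sibuya_mass l)).
  by rewrite big_ord_recr lerDl sibuya_mass_ge0.
rewrite sibuya_mass_partial gerBl big_nat; apply: prodr_ge0 => j /andP[j0 _].
rewrite subr_ge0 ler_pdivrMr ?ltr0n // mul1r (le_trans (ltW gamma_lt1)) //.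
by rewrite ler1n.
Qed.

Lemma sibuya_mass_summable : summable_seq sibuya_mass.
Proof. exact: summable_ge0 sibuya_mass_ge0 sibuya_mass_partial_le1. Qed.

(* The defect after [L] terms is at most exp(- gamma * H_L), with H_L harmonic. *)
Lemma sibuya_mass_partial_ge (e : R) : 0 < e ->
  exists L, 1 - e <= \sum_(l < L) sibuya_mass l.
Proof.
move=> e0.
have [L HL] : exists L, - ln e / gamma <= series (@harmonic R) L.
  apply: contrapT => /forallNP H; apply: (@dvg_harmonic R).
  apply: nondecreasing_is_cvgn; first by apply: nondecreasing_series => k _ _; exact: harmonic_ge0.
  exists (- ln e / gamma) => _ [n _ <-]; rewrite leNgt; apply/negP => /ltW; exact: H.
exists L.+1; rewrite sibuya_mass_partial lerD2l lerN2.
have -> : e = expR (ln e) by rewrite lnK.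
apply: (@le_trans _ _ (expR (- (gamma * series (@harmonic R) L)))); last first.
  by rewrite ler_expR lerNl mulrC -ler_pdivrMr.
rewrite big_add1 /= /series /= !big_mkord mulr_sumr -sumrN expR_sum.
apply: ler_prod => j _; apply/andP; split; last exact: expR_ge1Dx.
rewrite subr_ge0 ler_pdivrMr ?ltr0n // mul1r (le_trans (ltW gamma_lt1)) //.
by rewrite ler1n.
Qed.

Lemma sibuya_mass_sum1 : ssum sibuya_mass = 1.
Proof.
apply/eqP; rewrite eq_le; apply/andP; split.
  exact: ssum_le_bound sibuya_mass_summable sibuya_mass_partial_le1.
apply/ler_addgt0Pr => e e0; rewrite -lerBlDr.
have [L HL] := sibuya_mass_partial_ge e0; apply: le_trans HL _.
exact: partial_le_ssum sibuya_mass_ge0 sibuya_mass_summable.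
Qed.

End SibuyaMass.

(** * Mean range and mean counts of good symbols *)

Section SamplingLaw.
Variable R : realType.
Variable p : nat -> R.
Hypothesis p0 : p 0 = 0.
Hypothesis p_gt0 : forall x, (0 < x)%N -> 0 < p x.
Hypothesis p_homo : forall x y, (0 < x)%N -> (x <= y)%N -> p y <= p x.
Hypothesis p_summable : summable_seq p.
Hypothesis p_sum1 : ssum p = 1.
Variable gamma : R.
Hypothesis gamma_gt0 : 0 < gamma.
Hypothesis gamma_lt1 : gamma < 1.
Hypothesis p_rv : forall N, (0 < N)%N ->
  p (N * m)%N / p m @[m --> \oo] --> (N%:R : R) `^ (- gamma^-1).

(* Chosen so that [expR (- (n%:R * rate x)) = (1 - p x) ^+ n]. *)
Definition rate (x : nat) : R := - ln (1 - p x).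

Lemma p_ge0' x : 0 <= p x.
Proof. by case: x => [|x]; [rewrite p0|exact/ltW/p_gt0]. Qed.

Lemma p_lt1 x : p x < 1.
Proof.
rewrite -p_sum1; case: x => [|x]; first by rewrite p0 p_sum1.
apply: lt_le_trans (partial_le_ssum x.+3 p_ge0' p_summable).
rewrite 2!big_ord_recr /= -addrA; apply: ltr_wpDl.
  by apply: sumr_ge0 => i _; exact: p_ge0'.
by rewrite ltrDl p_gt0.
Qed.

Lemma expR_rate x : expR (- rate x) = 1 - p x.
Proof. by rewrite opprK lnK // posrE subr_gt0 p_lt1. Qed.

Lemma expR_rateM n x : expR (- (n%:R * rate x)) = (1 - p x) ^+ n.
Proof. by rewrite -mulrN expRM_natl expR_rate. Qed.

Lemma rate0 : rate 0 = 0.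
Proof. by rewrite /rate p0 subr0 ln1 oppr0. Qed.

Lemma p_le_rate x : p x <= rate x.
Proof. by have := expR_ge1Dx (- rate x); rewrite expR_rate; lra. Qed.

Lemma rate_le x : rate x <= p x / (1 - p x).
Proof.
have h : 0 < 1 - p x by rewrite subr_gt0 p_lt1.
have E : expR (rate x) = (1 - p x)^-1 by rewrite -expR_rate expRN invrK.
have := expR_ge1Dx (rate x); rewrite E.
rewrite (_ : p x / (1 - p x) = (1 - p x)^-1 - 1); last by field; rewrite gt_eqF.
lra.
Qed.

Lemma rate_gt0 x : (0 < x)%N -> 0 < rate x.
Proof. by move=> x0; apply: lt_le_trans (p_gt0 x0) (p_le_rate x). Qed.

Lemma rate_homo x y : (0 < x)%N -> (x <= y)%N -> rate y <= rate x.
Proof.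
move=> x0 xy; rewrite lerN2 ler_ln ?posrE ?subr_gt0 ?p_lt1 //.
by rewrite lerD2l lerN2 p_homo.
Qed.

Lemma rate_summable : summable_seq rate.
Proof.
apply: (@summable_le _ _ (fun x => (1 - p 1)^-1 * p x)); last exact: summableZ.
move=> x; have r0 : 0 <= rate x := le_trans (p_ge0' x) (p_le_rate x).
have px1 : p x <= p 1 by case: x {r0} => [|x]; [rewrite p0; exact: p_ge0'|exact: p_homo].
rewrite ger0_norm //; apply: le_trans (rate_le x) _.
rewrite mulrC ler_wpM2r ?p_ge0' // lef_pV2 ?posrE ?subr_gt0 ?p_lt1 //.
by rewrite lerD2l lerN2.
Qed.

Lemma p_cvg0 : p m @[m --> \oo] --> (0 : R).
Proof. exact: cvg_series_cvg_0 (summable_cvg p_summable). Qed.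

(** Squeezed by p <= rate <= p / (1 - p), with p tending to 0. *)
Lemma rate_rv N : (0 < N)%N ->
  rate (N * m)%N / rate m @[m --> \oo] --> (N%:R : R) `^ (- gamma^-1).
Proof.
move=> N0; have H := p_rv N0.
have c1 : 1 - p m @[m --> \oo] --> (1 - 0 : R) by apply: cvgB; [exact: cvg_cst|exact: p_cvg0].
have cN : p (N * m)%N @[m --> \oo] --> (0 : R).
  apply/cvgrPdist_lt => e e0; have /cvgrPdist_lt/(_ e e0)[M _ HM] := p_cvg0.
  by exists M => // m Mm; apply: HM => /=; rewrite (leq_trans Mm) // leq_pmull.
have c2 : (1 - p (N * m)%N)^-1 @[m --> \oo] --> ((1 - 0)^-1 : R).
  by apply: cvgV; [rewrite subr0 oner_neq0|apply: cvgB => //; exact: cvg_cst].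
rewrite subr0 in c1; rewrite subr0 invr1 in c2.
have L : p (N * m)%N / p m * (1 - p m) @[m --> \oo] --> (N%:R : R) `^ (- gamma^-1).
  by rewrite -[X in _ --> X]mulr1; exact: cvgM.
have U : p (N * m)%N / p m * (1 - p (N * m)%N)^-1 @[m --> \oo] --> (N%:R : R) `^ (- gamma^-1).
  by rewrite -[X in _ --> X]mulr1; exact: cvgM.
apply: (squeeze_cvgr _ L U); near=> m.
have m0 : (0 < m)%N by near: m; exact: nbhs_infty_gt.
have Nm0 : (0 < N * m)%N by rewrite muln_gt0 N0.
have pm := p_gt0 m0; have pN := p_gt0 Nm0.
have rm := rate_gt0 m0.
have h : 0 < 1 - p m by rewrite subr_gt0 p_lt1.
rewrite /=; apply/andP; split.
  rewrite -mulrA; apply: ler_pM => //; [exact: ltW| |exact: p_le_rate|].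
    by rewrite mulr_ge0 // ltW // invr_gt0.
  rewrite -[_^-1 * _]invrK lef_pV2 ?posrE ?invr_gt0 ?mulr_gt0 ?invr_gt0 //.
  by rewrite invfM invrK; exact: rate_le.
rewrite mulrAC; apply: ler_pM; [exact/ltW/rate_gt0|by rewrite invr_ge0 ltW|exact: rate_le|].
by rewrite lef_pV2 ?posrE // p_le_rate.
Unshelve. all: by end_near. Qed.

Definition mean_range (n : nat) : R := expsum rate n%:R.

Lemma mean_rangeE n : mean_range n = ssum (fun x => 1 - (1 - p x) ^+ n).
Proof. by congr ssum; apply/funext => x; rewrite expR_rateM. Qed.

Lemma mean_range0 : mean_range 0 = 0.
Proof.
rewrite mean_rangeE; apply/cvg_lim => //.
rewrite (_ : series _ = fun=> 0); first exact: cvg_cst.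
by apply/funext => n; rewrite /series /= big1 // => i _; rewrite expr0 subrr.
Qed.

Lemma mean_range_homo m n : (m <= n)%N -> mean_range m <= mean_range n.
Proof.
move=> mn; apply: expsum_homo; rewrite ?ler_nat //.
- exact: rate0.
- exact: rate_gt0.
- exact: rate_summable.
Qed.

(** Keeps the overshoot of the mean range over a square at the first passage to at most 1. *)
Lemma mean_rangeS n : mean_range n.+1 <= mean_range n + 1.
Proof.
have q1 x : 0 <= 1 - p x by rewrite subr_ge0 ltW // p_lt1.
have q2 x : 1 - p x <= 1 by rewrite gerBl p_ge0'.
have sv m := summable_visited p_ge0' p_summable p_sum1 m.
rewrite !mean_rangeE -[X in _ + X]p_sum1 -ssumD //; apply: ler_ssum => //; first exact: summableD.
move=> x; rewrite exprS; have : (1 - p x) ^+ n <= 1 by exact: exprn_ile1.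
have := p_ge0' x; nra.
Qed.

Lemma mean_range_unbounded (M : R) : exists n, M <= mean_range n.
Proof.
have /cvgryPge/(_ M) := expsum_pinfty rate0 rate_gt0 rate_homo rate_summable.
move=> [B [_ HB]]; exists (Num.truncn B).+1; apply: HB; exact: truncnS_gt.
Qed.

Lemma sample_size_ex (j : nat) : exists n, (j.+1 ^ 2)%N%:R <= mean_range n.
Proof. exact: mean_range_unbounded. Qed.

(* Along these sample sizes the mean range grows like the squares, so that the
   Chebyshev bounds are summable while consecutive means are equivalent. *)
Definition sample_size (j : nat) : nat := ex_minn (sample_size_ex j).

Lemma sample_size_ge j : (j.+1 ^ 2)%N%:R <= mean_range (sample_size j).
Proof. by rewrite /sample_size; case: ex_minnP. Qed.

Lemma sample_size_min j n : (j.+1 ^ 2)%N%:R <= mean_range n -> (sample_size j <= n)%N.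
Proof. by rewrite /sample_size; case: ex_minnP => m _ H /H. Qed.

Lemma sample_size_le j : mean_range (sample_size j) <= (j.+1 ^ 2)%N%:R + 1.
Proof.
case E : (sample_size j) => [|n].
  by rewrite mean_range0 addr_ge0.
apply: le_trans (mean_rangeS n) _; rewrite lerD2r ltW // ltNge; apply/negP.
by move=> /sample_size_min; rewrite E ltnn.
Qed.

Lemma sample_size_large N : \forall j \near \oo, (N <= sample_size j)%N.
Proof.
have [M HM] : exists M : nat, mean_range N < M%:R.
  exists (Num.truncn (mean_range N)).+1; exact: truncnS_gt.
exists M => // j /= Mj; rewrite leqNgt; apply/negP => jN.
have := sample_size_ge j; apply/negP; rewrite -ltNge.
apply: le_lt_trans (mean_range_homo (ltnW jN)) _; apply: lt_le_trans HM _.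
by rewrite ler_nat (leq_trans (leqW Mj)) // expnS expn1 leq_pmulr.
Qed.

Lemma cvg_natr (f : R -> R) (l : R) : f x @[x --> +oo] --> l ->
  f n%:R @[n --> \oo] --> l.
Proof.
move=> fl; apply/cvgrPdist_lt => e e0; move/cvgrPdist_lt : fl => /(_ e e0)[B [_ HB]].
exists (Num.truncn B).+1 => // n /= Bn; apply: HB.
by apply: lt_le_trans (truncnS_gt _) _; rewrite ler_nat.
Qed.

Let asymp k (k0 : (0 < k)%N) := expsum_deriv_asymp rate0 rate_gt0 rate_homo
  rate_summable gamma_gt0 rate_rv gamma_lt1 k0.

Lemma mean_range_gt0 n : (0 < n)%N -> 0 < mean_range n.
Proof.
move=> n0; apply: (expsum_gt0 rate0 rate_gt0 rate_summable).
by rewrite ltr0n.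
Qed.

Lemma expect_list_bool_bounds k (q : pred (seq nat)) :
  0 <= expect_list p k (fun v => (q v)%:R) <= 1.
Proof.
have cst c j : expect_list p j (fun=> c) = c.
  by elim: j => //= j ->; exact: expect1_cst.
apply/andP; split.
  rewrite -[leLHS](cst 0 k); apply: le_expect_list => //; [exact: p_ge0'|exact: bounded_cst|exact: bounded_bool].
rewrite -[leRHS](cst 1 k); apply: le_expect_list => //; [exact: p_ge0'|exact: bounded_bool|exact: bounded_cst|].
by move=> v _; rewrite lern1 leq_b1.
Qed.

(** Passes from [p] to [rate]. In the main term rate (1 - p) <= p turns p^l (1 - p)^n into at least
    rate^l (1 - p)^(n + l), whence the argument n + l; in the subtracted term p <= rate suffices. *)
Lemma expect_good_at_lower (b : bool) l (q : pred (seq nat)) s0 n : (0 < l)%N ->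
  (n - (2 + 3 * l))%N%:R ^+ l / l`!%:R *
    (expect_list p (b.+1 * l) (fun v => (q v)%:R) * expsum_deriv rate l (n + l)%N%:R -
     (b.+1 * l)%N%:R * expsum_deriv rate l.+1 n%:R) <=
  expect p (iota 1 n) (fun s => (count_visited s n (good_at b l n q s))%:R) s0.
Proof.
move=> l0; set m := expect_list _ _ _; set M := (b.+1 * l)%N.
pose B n : R := (n - (2 + 3 * l))%N%:R ^+ l / l`!%:R; rewrite -/(B n).
pose F k t : R := expsum_deriv rate k t; rewrite -!/(F _ _).
have /andP[m0 m1] := expect_list_bool_bounds M q; rewrite -/m in m0 m1.
have E0 : 0 <= expect p (iota 1 n) (fun s => (count_visited s n (good_at b l n q s))%:R) s0.
  rewrite -(expect_cst p_summable p_sum1 (iota 1 n) 0 s0).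
  apply: le_expect => //; [exact: p_ge0'|exact: bounded_cst|exact: bounded_count].
have B0 : 0 <= B n by rewrite divr_ge0 // exprn_ge0.
have [neg|pos] := lerP (m * F l (n + l)%N%:R - M%:R * F l.+1 n%:R) 0.
  by apply: le_trans E0; exact: mulr_ge0_le0.
apply: le_trans (expect_good_at_ge p_ge0' p_summable p_sum1 p0 b n q s0 l0).
apply: ler_pM => //; first exact: ltW.
  rewrite ler_pdivrMr ?ltr0n ?fact_gt0 // -natrX -natrM ler_nat.
  apply: leq_trans (size_spaced l 2 (n - 2)); rewrite leq_exp2r //; lia.
have s1 := summable_expsum_deriv rate0 rate_gt0 rate_homo rate_summable l0 (ler0n R (n + l)).
have s2 := summable_expsum_deriv rate0 rate_gt0 rate_homo rate_summable (ltn0Sn l) (ler0n R n).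
have rp x : 0 <= rate x by exact: le_trans (p_ge0' x) (p_le_rate x).
have q1 x : 0 <= 1 - p x by rewrite subr_ge0 ltW // p_lt1.
have q2 x : 1 - p x <= 1 by rewrite gerBl p_ge0'.
rewrite /F /expsum_deriv -!ssumZ // -ssumB; [|exact: summableZ..].
have sB : summable_seq (fun x => m * (rate x ^+ l * expR (- ((n + l)%N%:R * rate x))) -
    M%:R * (rate x ^+ l.+1 * expR (- (n%:R * rate x)))).
  have s3 := summableZ (- M%:R) s2; have s4 := summableZ m s1.
  rewrite (_ : (fun _ => _) = (fun x => m * (rate x ^+ l * expR (- ((n + l)%N%:R * rate x))) +
    (- M%:R) * (rate x ^+ l.+1 * expR (- (n%:R * rate x))))); first exact: summableD.
  by apply/funext => x; rewrite mulNr.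
apply: ler_ssum => //.
  apply: (@summable_le _ _ (fun x => (1 + M%:R) * p x)); last exact: summableZ.
  move=> x; have p1 : p x <= 1 by rewrite ltW // p_lt1.
  rewrite !normrM !normrX (ger0_norm (p_ge0' x)) (ger0_norm (q1 x)) mulrC.
  apply: ler_pM => //.
  - by apply: mulr_ge0; rewrite exprn_ge0 // p_ge0'.
  - apply: le_trans (ler_normB _ _) _; rewrite lerD // ?ger0_norm //.
      by rewrite ler_piMr.
    by rewrite mulr_ge0 // p_ge0'.
  - rewrite -[leRHS]mulr1; apply: ler_pM; rewrite ?exprn_ge0 ?exprn_ile1 ?p_ge0' //.
    case: (l) l0 => // k _; rewrite exprS ler_piMr ?p_ge0' // exprn_ile1 ?p_ge0' //.
move=> x; rewrite expR_rateM exprD expR_rateM mulrBr.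
apply: lerB.
  rewrite [leRHS]mulrC ler_wpM2l // [(1 - p x) ^+ n * _]mulrC mulrA.
  rewrite ler_wpM2r ?exprn_ge0 // -exprMn; apply: lerXn2r; rewrite ?nnegrE ?mulr_ge0 ?p_ge0' //.
  have h : 0 < 1 - p x by rewrite subr_gt0 p_lt1.
  by rewrite -ler_pdivlMr //; exact: rate_le.
rewrite (_ : p x ^+ l * (1 - p x) ^+ n * (M%:R * p x) = M%:R * (p x ^+ l.+1 * (1 - p x) ^+ n)).
  rewrite ler_wpM2l // ler_wpM2r ?exprn_ge0 //; apply: lerXn2r; rewrite ?nnegrE ?p_ge0' //.
  exact: p_le_rate.
by rewrite exprS; ring.
Qed.

(** The main term is about n^l / l! times the l-th derivative, hence the Sibuya weight times F(n).
    The union bound correction pairs n^l with the derivative of order l + 1, so it is O(F(n) /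
    n). *)
Lemma expect_good_at_asymp (b : bool) l (q : pred (seq nat)) s0 (e : R) :
  (0 < l)%N -> 0 < e -> \forall n \near \oo,
  (sibuya_mass gamma l * expect_list p (b.+1 * l) (fun v => (q v)%:R) - e) * mean_range n <=
  expect p (iota 1 n) (fun s => (count_visited s n (good_at b l n q s))%:R) s0.
Proof.
move=> l0 e0; set m := expect_list _ _ _; set M := (b.+1 * l)%N.
pose B n : R := (n - (2 + 3 * l))%N%:R ^+ l / l`!%:R.
pose F k t : R := expsum_deriv rate k t.
have /andP[m0 m1] := expect_list_bool_bounds M q; rewrite -/m in m0 m1.
have lower n : B n * (m * F l (n + l)%N%:R - M%:R * F l.+1 n%:R) <=
    expect p (iota 1 n) (fun s => (count_visited s n (good_at b l n q s))%:R) s0.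
  exact: expect_good_at_lower.
pose c := (2 + 3 * l)%N.
have inv0 : (n + l)%N%:R^-1 @[n --> \oo] --> (0 : R).
  apply: (squeeze_cvgr _ _ (@cvg_harmonic R)); last exact: cvg_cst.
  apply: nearW => n; rewrite invr_ge0 ler0n /= lef_pV2 ?posrE ?ltr0n ?addn_gt0 ?l0 ?orbT //.
  by rewrite ler_nat; lia.
have a1 : ((n - c)%N%:R / (n + l)%N%:R) ^+ l @[n --> \oo] --> (1 : R).
  have H : 1 - (c + l)%N%:R * (n + l)%N%:R^-1 @[n --> \oo] --> (1 : R).
    rewrite -[X in _ --> X]subr0 -[X in _ - X](mulr0 ((c + l)%N%:R)).
    by apply: cvgB; [exact: cvg_cst|apply: cvgM; [exact: cvg_cst|]].
  have H' : (n - c)%N%:R / (n + l)%N%:R @[n --> \oo] --> (1 : R).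
    apply: cvg_trans H; apply: near_eq_cvg; near=> n.
    have cn : (c <= n)%N by near: n; exact: nbhs_infty_ge.
    have d0 : (n + l)%N%:R != 0 :> R by rewrite pnatr_eq0; lia.
    rewrite natrB // !natrD in d0 *; field; exact: d0.
  have pw k : ((n - c)%N%:R / (n + l)%N%:R) ^+ k @[n --> \oo] --> (1 : R).
    elim: k => [|k IH].
      by rewrite (_ : (fun _ => _) = fun=> 1); [exact: cvg_cst|apply/funext => n; rewrite expr0].
    rewrite (_ : (fun _ => _) = (fun n : nat => (n - c)%N%:R / (n + l)%N%:R *
      ((n - c)%N%:R / (n + l)%N%:R) ^+ k)); last by apply/funext => n; rewrite exprS.
    by rewrite -[X in _ --> X]mulr1; exact: cvgM.
  exact: pw.
have a2 : (n + l)%N%:R ^+ l * F l (n + l)%N%:R / mean_range (n + l) @[n --> \oo] -->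
    density_coeff gamma l.
  by rewrite (cvg_shiftn l (fun n => n%:R ^+ l * F l n%:R / mean_range n)); exact: cvg_natr (asymp l0).
have a3 := cvg_natr (asymp (ltn0Sn l)).
(* The factor 2 / (n + 1) tends to 0 and dominates 1 / n for n >= 1. *)
have a4 : (M%:R / l`!%:R) * ((n%:R ^+ l.+1 * F l.+1 n%:R / mean_range n) * (2 * n.+1%:R^-1))
    @[n --> \oo] --> (0 : R).
  rewrite -[X in _ --> X](mulr0 (M%:R / l`!%:R)); apply: cvgM; first exact: cvg_cst.
  rewrite -[X in _ --> X](mulr0 (density_coeff gamma l.+1)); apply: cvgM => //.
  by rewrite -[X in _ --> X](mulr0 2); apply: cvgM; [exact: cvg_cst|exact: cvg_harmonic].
have a12 : (m / l`!%:R) * (((n - c)%N%:R / (n + l)%N%:R) ^+ l *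
    ((n + l)%N%:R ^+ l * F l (n + l)%N%:R / mean_range (n + l))) @[n --> \oo] -->
    (m / l`!%:R) * (1 * density_coeff gamma l).
  by apply: cvgM; [exact: cvg_cst|exact: cvgM].
have gen (A X Y : R) : A - X <= e / 2 -> Y <= e / 2 -> A - e <= X - Y by lra.
have e20 : 0 < e / 2 by rewrite divr_gt0.
have /cvgrPdist_lt/(_ _ e20) n12 := a12; have /cvgrPdist_lt/(_ _ e20) n4 := a4.
near=> n; apply: le_trans (lower n).
have n0 : (0 < n)%N by near: n; exact: nbhs_infty_gt.
have /ltW : `|(m / l`!%:R) * (1 * density_coeff gamma l) -
   (m / l`!%:R) * (((n - c)%N%:R / (n + l)%N%:R) ^+ l *
    ((n + l)%N%:R ^+ l * F l (n + l)%N%:R / mean_range (n + l)))| < e / 2.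
  by near: n; exact: n12.
have /ltW : `|0 - (M%:R / l`!%:R) * ((n%:R ^+ l.+1 * F l.+1 n%:R / mean_range n) * (2 * n.+1%:R^-1))| < e / 2.
  by near: n; exact: n4.
rewrite sub0r normrN ler_norml => /andP[_ h4]; rewrite ler_norml => /andP[_ h12].
have nl : (0 < n + l)%N by rewrite addn_gt0 n0.
have u0 := mean_range_gt0 n0; have ul0 := mean_range_gt0 nl.
have uu : mean_range n <= mean_range (n + l) := mean_range_homo (leq_addr l n).
have f0 : 0 < l`!%:R :> R by rewrite ltr0n fact_gt0.
have nn0 : 0 < n%:R :> R by rewrite ltr0n.
have nl0 : 0 < (n + l)%N%:R :> R by rewrite ltr0n.
have rmE : sibuya_mass gamma l * m = m / l`!%:R * (1 * density_coeff gamma l).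
  by rewrite /sibuya_mass; case: (l) l0 => // k _; ring.
have Fl0 : 0 <= F l (n + l)%N%:R by apply/ltW/(expsum_deriv_gt0 rate0 rate_gt0 rate_homo rate_summable l0 nl0).
have Fl1 : 0 <= F l.+1 n%:R by apply/ltW/(expsum_deriv_gt0 rate0 rate_gt0 rate_homo rate_summable (ltn0Sn l) nn0).
(* The limit [a2] is normalised by F(n + l); putting the smaller F(n) in its place only weakens a
   lower bound. *)
have T1 : (m / l`!%:R) * (((n - c)%N%:R / (n + l)%N%:R) ^+ l *
    ((n + l)%N%:R ^+ l * F l (n + l)%N%:R / mean_range (n + l))) * mean_range n <=
    B n * (m * F l (n + l)%N%:R).
  have -> : B n * (m * F l (n + l)%N%:R) = (m / l`!%:R) * (((n - c)%N%:R / (n + l)%N%:R) ^+ l *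
    ((n + l)%N%:R ^+ l * F l (n + l)%N%:R / mean_range (n + l))) * mean_range (n + l).
    rewrite /B -/c expr_div_n; move: (_ ^+ l) => X.
    have : (n + l)%N%:R ^+ l != 0 :> R by rewrite expf_neq0 // gt_eqF.
    move: ((n + l)%N%:R ^+ l) => Y Y0; field.
    by rewrite Y0 !gt_eqF.
  apply: ler_wpM2l => //; apply: mulr_ge0; first by rewrite divr_ge0 // ltW.
  apply: mulr_ge0; first by rewrite exprn_ge0 // divr_ge0.
  by rewrite divr_ge0 ?mulr_ge0 ?exprn_ge0 // ltW.
have T2 : B n * (M%:R * F l.+1 n%:R) <= (M%:R / l`!%:R) *
   ((n%:R ^+ l.+1 * F l.+1 n%:R / mean_range n) * (2 * n.+1%:R^-1)) * mean_range n.
  have -> : (M%:R / l`!%:R) * ((n%:R ^+ l.+1 * F l.+1 n%:R / mean_range n) * (2 * n.+1%:R^-1)) * mean_range n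
    = (n%:R ^+ l * (n%:R * (2 * n.+1%:R^-1))) / l`!%:R * (M%:R * F l.+1 n%:R).
    have : n.+1%:R != 0 :> R by rewrite pnatr_eq0.
    rewrite exprS; move: (n.+1%:R : R) => Y Y0; field.
    by rewrite Y0 !gt_eqF.
  apply: ler_wpM2r; first exact: mulr_ge0.
  rewrite ler_wpM2r ?invr_ge0 //; apply: (@le_trans _ _ (n%:R ^+ l)).
    by apply: lerXn2r; rewrite ?nnegrE ?ler0n // ler_nat leq_subr.
  rewrite ler_peMr ?exprn_ge0 // mulrA ler_pdivlMr ?ltr0n // mul1r -natrM ler_nat.
  by rewrite muln2 -addnn -addn1 leq_add2l.
rewrite mulrBr rmE; apply: le_trans (lerB T1 T2); rewrite -mulrBl ler_wpM2r ?(ltW u0) //.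
exact: gen h12 h4.
Unshelve. all: by end_near. Qed.

End SamplingLaw.

(** * Concentration along a sparse sequence of sample sizes *)

Section PathLaw.
Context (d : measure_display) (T : measurableType d) (R : realType).
Context (P : probability T R) (pi : nat -> R) (xi : nat -> {RV P >-> nat}).
Hypothesis pi_gt0 : forall i, (1 <= i)%N -> 0 < pi i.
Hypothesis pi_homo : forall i j, (1 <= i)%N -> (i <= j)%N -> pi j <= pi i.
Hypothesis pi_sum1 : (\sum_(1 <= i <oo) (pi i)%:E)%E = 1%E.
Hypothesis xi_iid : iid_samples pi xi.

(** Gives mass 0 to the index 0, where [pi] is unconstrained; this makes 0 a null symbol that can
    stand for an erased sample. *)
Definition law (a : nat) : R := if a is 0 then 0 else pi a.

Lemma law_ge0 a : 0 <= law a.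
Proof. by case: a => // a; exact/ltW/pi_gt0. Qed.

Lemma law_gt0 a : (0 < a)%N -> 0 < law a.
Proof. by case: a => // a _; exact: pi_gt0. Qed.

Lemma law_homo x y : (0 < x)%N -> (x <= y)%N -> law y <= law x.
Proof. by case: x y => // x [//|y] x0 xy; exact: pi_homo. Qed.

Lemma law_partial_le1 n : \sum_(i < n) law i <= 1.
Proof.
rewrite -lee_fin -pi_sum1 -(big_mkord xpredT law).
have -> : (\sum_(0 <= i < n) law i = \sum_(1 <= i < n) pi i)%R.
  case: n => [|n]; first by rewrite !big_geq.
  by rewrite big_ltn // add0r big_nat [RHS]big_nat; apply: eq_bigr => -[].
rewrite -sumEFin; apply: nneseries_lim_ge => i i1 _.
by rewrite lee_fin ltW // pi_gt0.
Qed.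

Lemma law_summable : summable_seq law.
Proof. exact: summable_ge0 law_ge0 law_partial_le1. Qed.

Lemma law_sum1 : ssum law = 1.
Proof.
apply: EFin_inj; rewrite -nneseries_ssum; [|exact: law_ge0|exact: law_summable].
rewrite -[RHS]pi_sum1; apply/cvg_lim => //.
have H : (\sum_(1 <= i < n) (pi i)%:E)%E @[n --> \oo] --> (\sum_(1 <= i <oo) (pi i)%:E)%E.
  by apply: is_cvg_ereal_nneg_natsum_cond => i i1 _; rewrite lee_fin ltW // pi_gt0.
apply: cvg_trans H; apply: near_eq_cvg; near=> n.
have n0 : (0 < n)%N by near: n; exact: nbhs_infty_gt.
rewrite [RHS]big_ltn // add0e; apply: eq_big_nat => -[//|i] _.
Unshelve. all: by end_near. Qed.

Lemma prob_xi i a : (1 <= i)%N -> P (xi i @^-1` [set a]) = (law a)%:E.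
Proof.
move=> i1; have [xi1 _ xid xipi] := xi_iid; rewrite xid //.
case: a => [|a]; last exact: xipi.
rewrite (_ : _ @^-1` _ = set0) ?measure0 //; apply/seteqP; split => // w /= E.
by have := xi1 1%N w isT; rewrite E.
Qed.

Lemma measurable_xi i a : measurable (xi i @^-1` [set a]).
Proof. exact: measurable_funPTI. Qed.

Lemma prefix_measurable n s :
  measurable [set w | forall i, (1 <= i <= n)%N -> xi i w = s i].
Proof.
rewrite (_ : mkset _ = \bigcap_(i in [set i | (1 <= i <= n)%N]) (xi i @^-1` [set s i])).
  apply: fin_bigcap_measurable => [|i _]; last exact: measurable_xi.
  by apply: (sub_finite_set _ (finite_II n.+1)) => i /= /andP[_]; rewrite ltnS.
by apply/seteqP; split => w /= H i; exact: H.
Qed.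

Lemma prefix_prob n s :
  P [set w | forall i, (1 <= i <= n)%N -> xi i w = s i] =
  (\prod_(i <- iota 1 n) law (s i))%:E.
Proof.
have [_ indep _ _] := xi_iid.
pose J := [fset i in iota 1 n]%fset.
have JE i : (i \in J) = (1 <= i <= n)%N by rewrite !inE mem_iota; lia.
rewrite (_ : mkset _ = \bigcap_(i in [set` J]) (xi i @^-1` [set s i])); last first.
  apply/seteqP; split => w /= H i; first by rewrite /= JE; exact: H.
  by move=> il; apply: H; rewrite /= JE.
rewrite (indep J (fun i => [set s i])); last by move=> i; rewrite JE => /andP[].
rewrite -prodEFin (perm_big (iota 1 n)) /=; last first.
  apply: uniq_perm; [exact: fset_uniq|exact: iota_uniq|].
  by move=> i; rewrite JE mem_iota; lia.
rewrite big_seq [RHS]big_seq; apply: eq_bigr => i; rewrite mem_iota => il.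
by rewrite prob_xi //; lia.
Qed.

Variables (n : nat) (A : (nat -> nat) -> bool).
Hypothesis A_local : forall s t, (forall i, (1 <= i <= n)%N -> s i = t i) -> A s = A t.

(** Induction on the number [k] of free coordinates: the cylinder is the disjoint union over the
    values of sample [j.+1], which matches one layer of [expect]. With no free coordinate, [A] is
    decided by the prefix. *)
Lemma cylinder_prob k j s : (j + k = n)%N ->
  let C := [set w | (forall i, (1 <= i <= j)%N -> xi i w = s i) /\ A (sample_path xi w)] in
  measurable C /\
  P C = (\prod_(i <- iota 1 j) law (s i) *
         expect law (iota j.+1 k) (fun t => (A t)%:R) s)%:E.
Proof.
have bA : bounded_real (fun t => (A t)%:R : R) by exact: bounded_bool.
elim: k j s => [|k IH] j s jk C.
  rewrite addn0 in jk; rewrite /= {}/C jk.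
  have -> : [set w | (forall i, (1 <= i <= n)%N -> xi i w = s i) /\ A (sample_path xi w)] =
    if A s then [set w | forall i, (1 <= i <= n)%N -> xi i w = s i] else set0.
    case: ifP => As; apply/seteqP; split => w //=.
    - by case.
    - by move=> H; split=> //; rewrite (A_local H).
    - by move=> [H]; rewrite (A_local H) As.
  case: (A s); last by rewrite mulr0 measure0.
  by rewrite mulr1 prefix_prob; split => //; exact: prefix_measurable.
pose D a := [set w | (forall i, (1 <= i <= j.+1)%N -> xi i w = upd s j.+1 a i) /\
  A (sample_path xi w)].
have jk' : (j.+1 + k = n)%N by rewrite addSnnS.
have HD a : measurable (D a) /\
    P (D a) = (\prod_(i <- iota 1 j.+1) law (upd s j.+1 a i) *
               expect law (iota j.+2 k) (fun t => (A t)%:R) (upd s j.+1 a))%:E.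
  exact: (IH j.+1 (upd s j.+1 a) jk').
have CD : C = \bigcup_a D a.
  apply/seteqP; split => w /=.
    move=> [H Aw]; exists (xi j.+1 w) => //; split => // i il; rewrite /upd.
    by case: eqP => [->//|/eqP ij]; apply: H; lia.
  move=> [a _ [H Aw]]; split => // i il; rewrite H; last by lia.
  by rewrite /upd; case: eqP => // ij; lia.
have tD : trivIset setT D.
  apply/trivIsetP => a b _ _ ab; apply/seteqP; split => // w [[Ha _] [Hb _]].
  have jj : (1 <= j.+1 <= j.+1)%N by rewrite leqnn.
  have := Ha _ jj; rewrite (Hb _ jj) /upd eqxx => ba.
  by rewrite ba eqxx in ab.
split; first by rewrite CD; apply: bigcup_measurable => a _; have [] := HD a.
rewrite CD measure_bigcup //; last by move=> a _; have [] := HD a.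
pose E a := expect law (iota j.+2 k) (fun t => (A t)%:R) (upd s j.+1 a).
have sE : summable_seq (fun a => law a * E a).
  apply: (expect1_summable law_ge0 law_summable).
  exact: (bounded_expect_upd law_ge0 law_summable law_sum1).
rewrite (eq_eseriesr (g := fun a => (\prod_(i <- iota 1 j) law (s i) * (law a * E a))%:E)); last first.
  move=> a _; apply: etrans (proj2 (HD a)) _; congr (_%:E).
  have u1 : upd s j.+1 a j.+1 = a by rewrite /upd eqxx.
  have -> : iota 1 j.+1 = iota 1 j ++ [:: j.+1] by have := iotaD 1 j 1; rewrite addn1 add1n.
  rewrite big_cat big_seq1 u1 /= -mulrA.
  congr (_ * _); rewrite big_seq [RHS]big_seq; apply: eq_bigr => i.
  by rewrite mem_iota /upd => il; case: eqP => // ij; lia.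
rewrite (eq_eseriesl (Q := xpredT)); last by move=> a; rewrite in_setT.
rewrite nneseries_ssum; last 2 first.
- move=> a; apply: mulr_ge0; first by apply: prodr_ge0 => i _; exact: law_ge0.
  rewrite mulr_ge0 ?law_ge0 // /E -(expect_cst law_summable law_sum1 (iota j.+2 k) 0 (upd s j.+1 a)).
  by apply: le_expect => //; [exact: law_ge0|exact: law_summable|exact: law_sum1|exact: bounded_cst].
- exact: summableZ.
by rewrite ssumZ.
Qed.

Lemma path_measurable : measurable [set w | A (sample_path xi w)].
Proof.
have [+ _] := @cylinder_prob n 0 (fun=> 0) (add0n n).
congr (measurable _); apply/seteqP; split => w /=; first by case.
by move=> Aw; split => // i; lia.
Qed.

Lemma path_prob : P [set w | A (sample_path xi w)] =
  (expect law (iota 1 n) (fun t => (A t)%:R) (fun=> 0))%:E.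
Proof.
have [_] := @cylinder_prob n 0 (fun=> 0) (add0n n).
rewrite big_nil mul1r => <-; congr (P _); apply/seteqP; split => w /=; last by case.
by move=> Aw; split => // i; lia.
Qed.

End PathLaw.

Section LocalDependence.
Variables (n : nat) (s t : nat -> nat).
Hypothesis st : forall i, (1 <= i <= n)%N -> s i = t i.

Lemma visited_ext : visited s n = visited t n.
Proof. by apply/eq_in_map => i; rewrite mem_iota => il; apply: st; lia. Qed.

Lemma positions_ext x : positions s n x = positions t n x.
Proof. by apply: eq_in_filter => i; rewrite mem_iota => il; rewrite st //; lia. Qed.

Lemma good_at_ext b l q x : (0 < l)%N -> good_at b l n q s x = good_at b l n q t x.
Proof.
move=> l0; rewrite /good_at positions_ext; case: (x != 0%N) => //=.
set J := positions t n x; case: (boolP (J \in _)) => //= Jsp.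
have [sJ /allP bJ _ _ /allP nJ] := spacedP b (ltn0Sn 1) Jsp.
have n2 : (2 <= n)%N.
  have : nth 0 J 0 \in J by rewrite mem_nth // sJ.
  by move=> /bJ /=; lia.
congr q; apply/eq_in_map => j /nJ/andP[jl _]; apply: st; lia.
Qed.

End LocalDependence.

Lemma sum_inv_sqr_le2 (R : realType) K : \sum_(j < K) ((j.+1 ^ 2)%N%:R : R)^-1 <= 2.
Proof.
case: K => [|K]; first by rewrite big_ord0.
apply: (@le_trans _ _ (2 - K.+1%:R^-1)); last by rewrite gerBl invr_ge0.
elim: K => [|K IH]; first by rewrite big_ord1 /= exp1n invr1; lra.
rewrite big_ord_recr /=; apply: le_trans (lerD IH (lexx _)) _.
rewrite -addrA lerD2l natrX -[K.+2]addn1 natrD.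
have : 0 < K.+1%:R :> R by [].
move: (K.+1%:R : R) => x x0.
have -> : - (x + 1)^-1 = - x^-1 + (x * (x + 1))^-1 by field; lra.
by rewrite lerD2l lef_pV2 ?posrE; nra.
Qed.

Section Concentration.
Context (d : measure_display) (T : measurableType d) (R : realType).
Context (P : probability T R) (pi : nat -> R) (xi : nat -> {RV P >-> nat}).
Context (gamma : R).
Hypothesis pi_gt0 : forall i, (1 <= i)%N -> 0 < pi i.
Hypothesis pi_homo : forall i j, (1 <= i)%N -> (i <= j)%N -> pi j <= pi i.
Hypothesis pi_sum1 : (\sum_(1 <= i <oo) (pi i)%:E)%E = 1%E.
Hypothesis gamma_gt0 : 0 < gamma.
Hypothesis gamma_lt1 : gamma < 1.
Hypothesis pi_rv : regularly_varying pi (- gamma^-1).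
Hypothesis xi_iid : iid_samples pi xi.

Notation p := (law pi).
Let p0 : p 0 = 0 := erefl.
Let p_gt0 : forall x, (0 < x)%N -> 0 < p x := law_gt0 pi_gt0.
Let p_ge0 : forall x, 0 <= p x := law_ge0 pi_gt0.
Let p_homo : forall x y, (0 < x)%N -> (x <= y)%N -> p y <= p x := law_homo pi_homo.
Let p_summable : summable_seq p := law_summable pi_gt0 pi_sum1.
Let p_sum1 : ssum p = 1 := law_sum1 pi_gt0 pi_sum1.

(** Regular variation read at integer ratios and integer arguments, where the ceilings disappear. *)
Lemma law_rv N : (0 < N)%N ->
  p (N * m)%N / p m @[m --> \oo] --> (N%:R : R) `^ (- gamma^-1).
Proof.
move=> N0; have N0' : 0 < N%:R :> R by rewrite ltr0n.
have := cvg_natr (pi_rv N0'); apply: cvg_trans; apply: near_eq_cvg; near=> m.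
have m0 : (0 < m)%N by near: m; exact: nbhs_infty_gt.
rewrite -natrM.
have E k : `|Num.ceil (k%:R : R)|%N = k.
  by rewrite (_ : k%:R = (Posz k)%:~R) // intrKceil absz_nat.
have pE k : (0 < k)%N -> pi k = p k by case: k.
by rewrite !E !pE // muln_gt0 N0.
Unshelve. all: by end_near. Qed.

Notation size_ := (sample_size p0 p_gt0 p_homo p_summable p_sum1).

Definition mean_count n (Q : (nat -> nat) -> pred nat) : R :=
  expect p (iota 1 n) (fun s => (count_visited s n (Q s))%:R) (fun=> 0).

Section Chebyshev.
Variables (n c : nat) (Q : (nat -> nat) -> pred nat).
Hypothesis Q_visited : forall s x, Q s x -> x \in visited s n.
Hypothesis Q_local : forall s i x, (1 <= i <= n)%N -> Q s x != Q (upd s i 0) x ->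
  exists j, [/\ j \in [:: i.-1; i; i.+1], near_rare s n c j & s j = x].
Hypothesis Q_ext : forall s t, (forall i, (1 <= i <= n)%N -> s i = t i) -> Q s =1 Q t.

Let deviates (e : R) s := e <= `|(count_visited s n (Q s))%:R - mean_count n Q|.

Let deviates_ext e s t : (forall i, (1 <= i <= n)%N -> s i = t i) ->
  deviates e s = deviates e t.
Proof.
move=> st; rewrite /deviates /count_visited (visited_ext st).
by rewrite (eq_count (Q_ext st)).
Qed.

Lemma deviation_measurable e : measurable [set w | deviates e (sample_path xi w)].
Proof. exact: (path_measurable pi_gt0 pi_sum1 xi_iid (@deviates_ext e)). Qed.

Lemma chebyshev_count (e : R) : 0 < e ->
  (P [set w | deviates e (sample_path xi w)] <=
   ((9 * c)%:R * mean_range p n / e ^+ 2)%:E)%E.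
Proof.
move=> e0; rewrite (path_prob pi_gt0 pi_sum1 xi_iid (@deviates_ext e)) lee_fin.
pose f s : R := (count_visited s n (Q s))%:R.
have bf : bounded_real f by exact: bounded_count.
have bf2 : bounded_real (fun s => f s ^+ 2) by exact: bounded_realM.
set m := mean_count n Q.
have bd : bounded_real (fun s => (f s ^+ 2 - 2 * m * f s) + m ^+ 2).
  apply: bounded_realD; last exact: bounded_cst.
  by apply: bounded_realB => //; exact: bounded_realZ.
have e2 : 0 < e ^+ 2 by rewrite exprn_gt0.
apply: (@le_trans _ _ (expect p (iota 1 n)
    (fun s => (e ^+ 2)^-1 * ((f s ^+ 2 - 2 * m * f s) + m ^+ 2)) (fun=> 0))).
  apply: le_expect => //; [exact: bounded_bool|exact: bounded_realZ|].
  move=> s; have -> : f s ^+ 2 - 2 * m * f s + m ^+ 2 = `|f s - m| ^+ 2.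
    by rewrite real_normK ?num_real //; ring.
  rewrite mulrC; case: (boolP (deviates e s)) => [es|_].
    by rewrite ler_pdivlMr // mul1r; apply: lerXn2r; rewrite ?nnegrE // ltW.
  by rewrite divr_ge0 // ?ltW // exprn_ge0.
rewrite expectZ // mulrC ler_wpM2r //; first by rewrite invr_ge0 ltW.
rewrite expectD //; [|by apply: bounded_realB => //; exact: bounded_realZ|exact: bounded_cst].
rewrite expectB //; last exact: bounded_realZ.
rewrite expectZ // expect_cst //.
have -> : expect p (iota 1 n) f (fun=> 0) = m by [].
have -> (X : R) : X - 2 * m * m + m ^+ 2 = X - m ^+ 2 by ring.
apply: le_trans (variance_count p_ge0 p_summable p_sum1 (fun=> 0) Q_visited Q_local) _.
rewrite ler_wpM2l // (mean_rangeE p0 p_gt0 p_summable p_sum1).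
exact: expect_range_le.
Qed.

End Chebyshev.

Lemma ae_concentration c (Q : nat -> (nat -> nat) -> pred nat) (e : R) :
  (forall n s x, Q n s x -> x \in visited s n) ->
  (forall n s i x, (1 <= i <= n)%N -> Q n s x != Q n (upd s i 0) x ->
    exists j, [/\ j \in [:: i.-1; i; i.+1], near_rare s n c j & s j = x]) ->
  (forall n s t, (forall i, (1 <= i <= n)%N -> s i = t i) -> Q n s =1 Q n t) ->
  0 < e ->
  {ae P, forall w, \forall j \near \oo,
    `|(count_visited (sample_path xi w) (size_ j) (Q (size_ j) (sample_path xi w)))%:R
      - mean_count (size_ j) (Q (size_ j))| < e * (j.+1 ^ 2)%N%:R}.
Proof.
move=> Qv Ql Qe e0.
pose F j := [set w | e * (j.+1 ^ 2)%N%:R <=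
  `|(count_visited (sample_path xi w) (size_ j) (Q (size_ j) (sample_path xi w)))%:R
      - mean_count (size_ j) (Q (size_ j))|].
have mF j : measurable (F j) by exact: (deviation_measurable (Qe (size_ j))).
have j0 j : 0 < (j.+1 ^ 2)%N%:R :> R by rewrite ltr0n expn_gt0.
(* The 2 comes from the mean range, at most (j + 1)^2 + 1 and hence at most twice the square. *)
pose M : R := (9 * c)%:R * 2 / e ^+ 2.
have M0 : 0 <= M by apply: divr_ge0; [exact: mulr_ge0|exact: sqr_ge0].
have PF j : (P (F j) <= (M * ((j.+1 ^ 2)%N%:R)^-1)%:E)%E.
  apply: le_trans (chebyshev_count (@Qv _) (@Ql _) (@Qe _) (mulr_gt0 e0 (j0 j))) _.
  have := sample_size_le p0 p_gt0 p_homo p_summable p_sum1 j.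
  have := j0 j; have : 1 <= (j.+1 ^ 2)%N%:R :> R by rewrite ler1n expn_gt0.
  move: ((j.+1 ^ 2)%N%:R : R) (mean_range _ _) => x u x1 x0 ux.
  rewrite lee_fin /M exprMn.
  rewrite (_ : _ * 2 / _ / _ = (9 * c)%:R * (2 * x) / (e ^+ 2 * x ^+ 2)); last first.
    by field; rewrite !gt_eqF.
  rewrite ler_wpM2r ?invr_ge0 ?mulr_ge0 ?exprn_ge0 // ?(ltW e0) ?(ltW x0) //.
  by rewrite ler_wpM2l //; lra.
have sM : summable_seq (fun j => M * ((j.+1 ^ 2)%N%:R)^-1).
  apply: summableZ; apply: (@summable_ge0 _ _ 2); last exact: sum_inv_sqr_le2.
  by move=> j; rewrite invr_ge0 ltW.
have P0 : P (lim_sup_set F) = 0%E.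
  apply: lim_sup_set_cvg0 => //.
  apply: (@le_lt_trans _ _ (\sum_(0 <= j <oo) (M * ((j.+1 ^ 2)%N%:R)^-1)%:E)%E).
    by apply: lee_nneseries => j *; [exact: measure_ge0|exact: PF].
  rewrite nneseries_ssum ?ltry // => j.
  by rewrite mulr_ge0 // invr_ge0 ltW.
exists (lim_sup_set F); split => //.
  by apply: bigcap_measurable => // k _; exact: bigcup_measurable.
move=> w /= H k _; apply: contrapT => Hk; apply: H.
exists k => // j /= kj; rewrite ltNge; apply/negP => jF; apply: Hk.
by exists j.
Qed.

End Concentration.

(** The function [f] labels the classes and so makes them disjoint; for good symbols the label is
    the number of occurrences. *)
Lemma sum_count_disjoint (X : Type) (f : X -> nat) (A : nat -> pred X) (B : pred X)
    (r : seq X) L :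
  (forall l x, A l x -> B x /\ f x = l) ->
  (\sum_(l < L) count (A l) r <= count B r)%N.
Proof.
move=> AB; elim: r => [|x r IH]; first by rewrite big1.
rewrite /= big_split leq_add //=.
have [fL|Lf] := ltnP (f x) L.
  rewrite (bigD1 (Ordinal fL)) //= big1 => [|l lf]; last first.
    case: (boolP (A l x)) => // /AB[_ fx]; move: lf.
    by rewrite -val_eqE /= fx eqxx.
  by rewrite addn0; case: (boolP (A _ x)) => // /AB[->].
rewrite big1 // => l _; case: (boolP (A l x)) => // /AB[_ fx].
by move: (ltn_ord l); rewrite -fx ltnNge Lf.
Qed.

(** * Limits of the degree proportions *)

Section ProportionLimit.
Variable R : realType.
Variable p : nat -> R.
Hypothesis p0 : p 0 = 0.
Hypothesis p_gt0 : forall x, (0 < x)%N -> 0 < p x.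
Hypothesis p_homo : forall x y, (0 < x)%N -> (x <= y)%N -> p y <= p x.
Hypothesis p_summable : summable_seq p.
Hypothesis p_sum1 : ssum p = 1.
Variable gamma : R.
Hypothesis gamma_gt0 : 0 < gamma.
Hypothesis gamma_lt1 : gamma < 1.
Hypothesis p_rv : forall N, (0 < N)%N ->
  p (N * m)%N / p m @[m --> \oo] --> (N%:R : R) `^ (- gamma^-1).

Let p_ge0 := p_ge0' p0 p_gt0.

Notation size_ := (sample_size p0 p_gt0 p_homo p_summable p_sum1).
Notation sqr j := ((j.+1 ^ 2)%N%:R : R).

Lemma sqr_ge1 j : 1 <= sqr j.
Proof. by rewrite ler1n expn_gt0. Qed.

Lemma between_squares (u : R) : 1 <= u -> exists j, sqr j <= u < sqr j.+1.
Proof.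
move=> u1; pose m := Num.truncn (Num.sqrt u).
have u0 : 0 <= u by lra.
have /andP[m1 m2] : m%:R <= Num.sqrt u < m.+1%:R.
  by apply: truncn_itv; exact: sqrtr_ge0.
have m0 : (0 < m)%N.
  rewrite lt0n; apply/eqP => m0; move: m2; rewrite m0 ltNge => /negP; apply.
  by rewrite -[leLHS]sqrtr1 ler_sqrt.
exists m.-1; rewrite prednK // -[u in _ <= u](sqr_sqrtr u0) -[u in u < _](sqr_sqrtr u0).
rewrite !natrX; apply/andP; split; first by apply: lerXn2r; rewrite ?nnegrE ?sqrtr_ge0.
by apply: ltrXn2r; rewrite ?nnegrE ?sqrtr_ge0.
Qed.

Lemma interpolate (f : nat -> R) (t : R) : 0 <= t <= 1 ->
  (forall n, f n <= f n.+1) ->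
  (forall e : R, 0 < e -> \forall j \near \oo,
     (t - e) * sqr j <= f (size_ j) <= (t + e) * sqr j) ->
  f n / mean_range p n @[n --> \oo] --> t.
Proof.
move=> /andP[t0 t1] f_homo H.
have fm m n : (m <= n)%N -> f m <= f n by move=> mn; exact: (homo_leq (@lexx _ R) le_trans).
apply/cvgrPdist_le => e e0.
pose d := Num.min (e / 4) 1.
have d0 : 0 < d by rewrite lt_min divr_gt0 // ltr01.
have [d1 d4] : d <= 1 /\ 4 * d <= e.
  by split; [rewrite ge_min lexx orbT|have : d <= e / 4 by [rewrite ge_min lexx]; lra].
have [J _ HJ] := H d d0.
(* With x = j + 1 and d x >= 3, (x + 1)^2 <= x^2 + 3 x <= (1 + d) x^2: consecutive squares are
   within a factor 1 + d. *)
have [K HK] : exists K : nat, 3 / d <= K%:R.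
  by exists (Num.truncn (3 / d)).+1; apply/ltW/truncnS_gt.
pose M := maxn J K.
exists (size_ M) => // n /= Mn.
have uM : sqr M <= mean_range p n.
  apply: le_trans (sample_size_ge p0 p_gt0 p_homo p_summable p_sum1 M) _.
  exact: mean_range_homo.
have [j /andP[j1 j2]] := between_squares (le_trans (sqr_ge1 M) uM).
have Mj : (M <= j)%N.
  by have := le_lt_trans uM j2; rewrite ltr_nat ltn_sqr.
have nj : (size_ j <= n)%N by exact: sample_size_min.
have nj' : (n <= size_ j.+1)%N.
  rewrite leqNgt; apply/negP => /ltnW jn; move: j2; rewrite ltNge => /negP; apply.
  apply: le_trans (sample_size_ge p0 p_gt0 p_homo p_summable p_sum1 j.+1) _.
  exact: mean_range_homo.
have /andP[H1 _] : (t - d) * sqr j <= f (size_ j) <= (t + d) * sqr j.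
  by apply: HJ => /=; rewrite (leq_trans _ Mj) // leq_maxl.
have /andP[_ H2] : (t - d) * sqr j.+1 <= f (size_ j.+1) <= (t + d) * sqr j.+1.
  by apply: HJ => /=; rewrite (leq_trans _ (leqW Mj)) // leq_maxl.
have {}H1 := le_trans H1 (fm _ _ nj); have {}H2 := le_trans (fm _ _ nj') H2.
have Kj : 3 <= d * j.+1%:R.
  rewrite mulrC -ler_pdivrMr //; apply: le_trans HK _; rewrite ler_nat.
  by rewrite (leq_trans (leq_maxr J K)) // leqW.
have sq : sqr j.+1 <= (1 + d) * sqr j.
  rewrite !natrX -[j.+2]addn1 natrD; move: Kj; have : 1 <= j.+1%:R :> R by rewrite ler1n.
  by move: (j.+1%:R : R) => x; nra.
have u0 : 0 < mean_range p n by rewrite (lt_le_trans _ j1) // (lt_le_trans _ (sqr_ge1 j)).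
have s1 := sqr_ge1 j.
move: (mean_range p n) (f n) (sqr j) (sqr j.+1) u0 j1 j2 H1 H2 sq s1 => u y a a' u0 j1 j2 H1 H2 sq s1.
rewrite -[t](mulfK (lt0r_neq0 u0)) -mulrBl normrM (@gtr0_norm _ u^-1) ?invr_gt0 //.
rewrite ler_pdivrMr //; have a0 : 0 <= a by lra.
have A1 : t * u <= t * ((1 + d) * a) by rewrite ler_wpM2l //; lra.
have A2 : (t + d) * a' <= (t + d) * ((1 + d) * a) by rewrite ler_wpM2l //; lra.
have A3 : t * a <= t * u by rewrite ler_wpM2l.
have A4 : 4 * d * a <= e * u by apply: ler_pM => //; lra.
have A5 : 0 <= d * a * (1 - t) by rewrite mulr_ge0 ?mulr_ge0 ?(ltW d0) //; lra.
have A6 : 0 <= d * a * (1 - d) by rewrite mulr_ge0 ?mulr_ge0 ?(ltW d0) //; lra.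
rewrite ler_norml; apply/andP; split; nra.
Qed.

Section Path.
Variables (b : bool) (s : nat -> nat).
Hypothesis s_gt0 : forall i, (1 <= i)%N -> (1 <= s i)%N.

Definition mean_pattern (q : pred (seq nat)) l : R :=
  expect_list p (b.+1 * l) (fun v => (q v)%:R).

(** The limiting proportion of symbols whose neighbour word satisfies [q]: the word length is
    governed by a Sibuya variable, and its letters are independent. *)
Definition pattern_mass (q : pred (seq nat)) : R :=
  ssum (fun l => sibuya_mass gamma l * mean_pattern q l).

Definition good_count l (q : pred (seq nat)) n : nat :=
  count_visited s n (good_at b l n q s).

Lemma mean_pattern_bounds q l : 0 <= mean_pattern q l <= 1.
Proof. exact: expect_list_bool_bounds. Qed.

Lemma pattern_mass_summable q :
  summable_seq (fun l => sibuya_mass gamma l * mean_pattern q l).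
Proof.
apply: (@summable_le _ _ (sibuya_mass gamma)); last exact: sibuya_mass_summable.
move=> l; have /andP[m0 m1] := mean_pattern_bounds q l.
have r0 := sibuya_mass_ge0 gamma_gt0 gamma_lt1 l.
by rewrite ger0_norm ?mulr_ge0 // ler_piMr.
Qed.

Lemma expect_listE m (Q : seq nat -> R) : bounded_real Q ->
  expect_list p m Q = expect p (iota 0 m) (fun t => Q (map t (iota 0 m))) (fun=> 0).
Proof.
by move=> bQ; rewrite (expect_map p_summable p_sum1) ?iota_uniq // size_iota.
Qed.

Lemma mean_patternC q l : mean_pattern (predC q) l = 1 - mean_pattern q l.
Proof.
have bq : bounded_real (fun v => (q v)%:R : R) by exact: bounded_bool.
have bC : bounded_real (fun v => (predC q v)%:R : R) by exact: bounded_bool.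
rewrite /mean_pattern !expect_listE //.
rewrite -[X in X - _](expect_cst p_summable p_sum1 (iota 0 (b.+1 * l)) 1 (fun=> 0)).
have bqm := bounded_comp (fun t : nat -> nat => map t (iota 0 (b.+1 * l))) bq.
rewrite -(expectB p_ge0 p_summable p_sum1 _ _ (bounded_cst _ 1) bqm).
by apply: expect_ext => t /=; case: (q _); rewrite ?subrr ?subr0.
Qed.

Lemma pattern_massC q : pattern_mass (predC q) = 1 - pattern_mass q.
Proof.
rewrite -[X in X - _](sibuya_mass_sum1 gamma_gt0 gamma_lt1) -ssumB; last first.
- exact: pattern_mass_summable.
- exact: sibuya_mass_summable.
by congr ssum; apply/funext => l; rewrite mean_patternC mulrBr mulr1.
Qed.

Hypothesis range_conc : forall e : R, 0 < e -> \forall j \near \oo,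
  `|(count_visited s (size_ j) (fun x => (x != 0%N) && (x \in visited s (size_ j))))%:R
    - expect p (iota 1 (size_ j)) (fun s => (count_visited s (size_ j)
        (fun x => (x != 0%N) && (x \in visited s (size_ j))))%:R) (fun=> 0)| < e * sqr j.

(** Half of [e] absorbs the deviation, the other half the overshoot 1 of the mean range. The
    matching lower bound comes out of the tail counts at k = 0. *)
Lemma range_le (e : R) : 0 < e -> \forall j \near \oo,
  (nrange s (size_ j))%:R <= (1 + e) * sqr j.
Proof.
move=> e0; have e2 : 0 < e / 2 by rewrite divr_gt0.
have [K HK] : exists K : nat, 2 / e <= K%:R.
  by exists (Num.truncn (2 / e)).+1; apply/ltW/truncnS_gt.
near=> j; have : (K <= j)%N by near: j; exact: nbhs_infty_ge.
have : `|(count_visited s (size_ j) (fun x => (x != 0%N) && (x \in visited s (size_ j))))%:R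
    - expect p (iota 1 (size_ j)) (fun s => (count_visited s (size_ j)
        (fun x => (x != 0%N) && (x \in visited s (size_ j))))%:R) (fun=> 0)| < (e / 2) * sqr j.
  by near: j; exact: range_conc.
(* The condition on 0 serves the erased paths, which do visit 0; on a true sample path it holds for
   all visited symbols. *)
have -> : count_visited s (size_ j) (fun x => (x != 0%N) && (x \in visited s (size_ j))) =
    nrange s (size_ j).
  rewrite nrangeE; apply: eq_in_count => x; rewrite mem_undup => xv; rewrite xv andbT.
  by have [i /andP[i1 _] <-] := visitedP _ _ _ xv; rewrite -lt0n s_gt0.
set E := expect _ _ _ _.
have EE : E <= sqr j + 1.
  apply: le_trans (sample_size_le p0 p_gt0 p_homo p_summable p_sum1 j).
  rewrite (mean_rangeE p0 p_gt0 p_summable p_sum1).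
  apply: le_trans (expect_range_le p_ge0 p_summable p_sum1 _ (fun=> 0)).
  have bc Q : bounded_real (fun s => (count_visited s (size_ j) (Q s))%:R : R).
    exact: bounded_count.
  apply: (le_expect p_ge0 p_summable p_sum1 _ _ (bc _) (bc _)) => t.
  by rewrite ler_nat /count_visited; apply: sub_count.
move=> /ltW; rewrite ler_norml => /andP[_ H] Kj.
have : 1 <= (e / 2) * sqr j.
  have : 2 / e <= sqr j by apply: le_trans HK _; rewrite ler_nat; nia.
  rewrite ler_pdivrMr // => h; rewrite mulrAC; lra.
move: EE H; move: (sqr j) => x; lra.
Unshelve. all: by end_near. Qed.

Variable q : pred (seq nat).

Lemma good_count_ge l (e : R) : (0 < l)%N -> 0 < e ->
  (forall e : R, 0 < e -> \forall j \near \oo,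
    `|(good_count l q (size_ j))%:R
    - expect p (iota 1 (size_ j)) (fun s => (count_visited s (size_ j)
        (good_at b l (size_ j) q s))%:R) (fun=> 0)| < e * sqr j) ->
  \forall j \near \oo,
    (sibuya_mass gamma l * mean_pattern q l - e) * sqr j <= (good_count l q (size_ j))%:R.
Proof.
(* One quarter pays for the deviation; the error in the mean is a quarter of the mean range, at most
   two quarters of the square. *)
move=> l0 e0 conc; have e2 : 0 < e / 4 by rewrite divr_gt0.
have [n0 _ Hn] := expect_good_at_asymp p0 p_gt0 p_homo p_summable p_sum1 gamma_gt0
  gamma_lt1 p_rv b q (fun=> 0) l0 e2.
near=> j; have jn : (n0 <= size_ j)%N by near: j; exact: (sample_size_large p0 p_gt0 p_homo p_summable p_sum1 n0).
have := Hn _ jn; rewrite /= -/(mean_pattern q l).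
have /ltW : `|(good_count l q (size_ j))%:R
    - expect p (iota 1 (size_ j)) (fun s => (count_visited s (size_ j)
        (good_at b l (size_ j) q s))%:R) (fun=> 0)| < (e / 4) * sqr j.
  by near: j; exact: conc.
rewrite ler_norml => /andP[+ _].
have := sample_size_ge p0 p_gt0 p_homo p_summable p_sum1 j.
have := sample_size_le p0 p_gt0 p_homo p_summable p_sum1 j.
have /andP[m0 m1] := mean_pattern_bounds q l.
have r0 := sibuya_mass_ge0 gamma_gt0 gamma_lt1 l.
have := sqr_ge1 j; have := mulr_ge0 r0 m0.
move: (sibuya_mass _ _ * _) (mean_range _ _) (sqr j) (expect _ _ _ _) ((good_count _ _ _)%:R : R).
move=> rm u x E g rm0 x1 u1 u2 gE Eu; nra.
Unshelve. all: by end_near. Qed.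

Hypothesis conc : forall l (e : R), (0 < l)%N -> 0 < e -> \forall j \near \oo,
    `|(good_count l q (size_ j))%:R
    - expect p (iota 1 (size_ j)) (fun s => (count_visited s (size_ j)
        (good_at b l (size_ j) q s))%:R) (fun=> 0)| < e * sqr j.

(** The factor [0 < l] removes the class of symbols without occurrences, whose Sibuya mass is 0. *)
Lemma sum_good_count_ge L (e : R) : 0 < e -> \forall j \near \oo,
  (\sum_(l < L) sibuya_mass gamma l * mean_pattern q l - e) * sqr j <=
  (\sum_(l < L) (0 < l) * good_count l q (size_ j))%N%:R.
Proof.
elim: L e => [|L IH] e e0.
  apply: nearW => j; rewrite !big_ord0 sub0r mulNr oppr_le0 mulr_ge0 //; exact: ltW.
have e2 : 0 < e / 2 by rewrite divr_gt0.
have HL : \forall j \near \oo, (sibuya_mass gamma L * mean_pattern q L - e / 2) * sqr j <=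
    ((0 < L) * good_count L q (size_ j))%N%:R.
  case: (posnP L) => [->|L0].
    apply: nearW => j; rewrite /= mul0r sub0r mulNr mul0n oppr_le0 mulr_ge0 //; exact: ltW.
  have := good_count_ge L0 e2 (fun e => conc L0); apply: filterS => j.
  by rewrite mul1n.
near=> j; rewrite !big_ord_recr /= natrD.
have h1 : (\sum_(l < L) sibuya_mass gamma l * mean_pattern q l - e / 2) * sqr j <=
  (\sum_(l < L) (0 < l) * good_count l q (size_ j))%N%:R by near: j; exact: IH.
have h2 : (sibuya_mass gamma L * mean_pattern q L - e / 2) * sqr j <=
    ((0 < L) * good_count L q (size_ j))%N%:R by near: j; exact: HL.
apply: le_trans (lerD h1 h2); rewrite -mulrDl ler_wpM2r //; lra.
Unshelve. all: by end_near. Qed.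

(** A Fatou argument: finitely many disjoint classes of good symbols already carry the pattern mass
    up to e / 2, and all of them lie in [B]. *)
Lemma count_ge (B : nat -> pred nat) (e : R) :
  (forall n l x, good_at b l n q s x -> B n x) -> 0 < e ->
  \forall j \near \oo, (pattern_mass q - e) * sqr j <=
    (count_visited s (size_ j) (B (size_ j)))%:R.
Proof.
move=> gB e0; have e2 : 0 < e / 2 by rewrite divr_gt0.
have /cvgrPdist_le/(_ _ e2)[L _ HL] := ssum_cvg (pattern_mass_summable q).
have := sum_good_count_ge L e2; apply: filterS => j hj.
apply: (@le_trans _ _ ((\sum_(l < L) (0 < l) * good_count l q (size_ j))%N%:R)).
  apply: le_trans hj; rewrite ler_wpM2r //.
  have := HL L (leqnn L); rewrite ler_norml => /andP[_]; rewrite /pattern_mass; lra.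
rewrite ler_nat; set n := size_ j.
apply: leq_trans (@sum_count_disjoint _ (fun x => size (positions s n x))
  (fun l x => good_at b l n q s x) (B n) _ L _).
  by apply: leq_sum => l _; case: (0 < l)%N; rewrite ?mul1n.
move=> l x gx; split; first exact: gB gx.
by have /and3P[_ /(spacedP b (ltn0Sn 1))[] ] := gx.
Qed.

End Path.

End ProportionLimit.

(** * Deterministic limits along a typical path *)

Section TypicalPath.
Variable R : realType.
Variable p : nat -> R.
Hypothesis p0 : p 0 = 0.
Hypothesis p_gt0 : forall x, (0 < x)%N -> 0 < p x.
Hypothesis p_homo : forall x y, (0 < x)%N -> (x <= y)%N -> p y <= p x.
Hypothesis p_summable : summable_seq p.
Hypothesis p_sum1 : ssum p = 1.
Variable gamma : R.
Hypothesis gamma_gt0 : 0 < gamma.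
Hypothesis gamma_lt1 : gamma < 1.
Hypothesis p_rv : forall N, (0 < N)%N ->
  p (N * m)%N / p m @[m --> \oo] --> (N%:R : R) `^ (- gamma^-1).

Notation size_ := (sample_size p0 p_gt0 p_homo p_summable p_sum1).

Definition concentrates (Q : nat -> (nat -> nat) -> pred nat) (s : nat -> nat) :=
  forall e : R, 0 < e -> \forall j \near \oo,
    `|(count_visited s (size_ j) (Q (size_ j) s))%:R -
      expect p (iota 1 (size_ j))
        (fun s => (count_visited s (size_ j) (Q (size_ j) s))%:R) (fun=> 0)|
    < e * (j.+1 ^ 2)%N%:R.

Definition distinct_ge k : pred (seq nat) := fun v => (k <= size (undup v))%N.

(** Collects the patterns and their complements in one countable family, so that a single null set
    serves all of them. *)
Definition signed_distinct_ge k (neg : bool) : pred (seq nat) :=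
  fun v => neg (+) distinct_ge k v.

(** All the randomness of the argument is contained in this property, which holds almost surely by
    [ae_typical]. *)
Definition typical (s : nat -> nat) :=
  [/\ forall i, (1 <= i)%N -> (1 <= s i)%N,
      concentrates (fun n s x => (x != 0%N) && (x \in visited s n)) s &
      forall b l k neg, (0 < l)%N ->
        concentrates (fun n => good_at b l n (signed_distinct_ge k neg)) s].

Definition tail_mass (b : bool) k : R := pattern_mass p gamma b (distinct_ge k).

Lemma pattern_mass_ge0 b q : 0 <= pattern_mass p gamma b q.
Proof.
apply: ssum_ge0; last exact: pattern_mass_summable.
move=> l; have /andP[m0 _] := mean_pattern_bounds p0 p_gt0 p_summable p_sum1 b q l.
by rewrite mulr_ge0 // sibuya_mass_ge0.
Qed.

Lemma tail_mass_bounds b k : 0 <= tail_mass b k <= 1.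
Proof.
rewrite pattern_mass_ge0 /= -subr_ge0 -pattern_massC //.
exact: pattern_mass_ge0.
Qed.

Lemma mean_pattern_true b (q : pred (seq nat)) l : (forall v, q v) ->
  mean_pattern p b q l = 1.
Proof.
move=> qT; rewrite /mean_pattern.
rewrite (_ : (fun v => (q v)%:R) = fun=> 1); last by apply/funext => v; rewrite qT.
by elim: (b.+1 * l)%N => //= m ->; exact: expect1_cst.
Qed.

Lemma tail_mass0 b : tail_mass b 0 = 1.
Proof.
rewrite -(sibuya_mass_sum1 gamma_gt0 gamma_lt1); congr ssum; apply/funext => l.
by rewrite mean_pattern_true ?mulr1.
Qed.

Variable s : nat -> nat.
Hypothesis s_typical : typical s.

Lemma tail_count_mean_range b nl k :
  (tail_count s b nl k n)%:R / mean_range p n @[n --> \oo] --> tail_mass b k.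
Proof.
have [s_gt0 s_range s_good] := s_typical.
apply: (@interpolate R p p0 p_gt0 p_homo p_summable p_sum1).
- exact: tail_mass_bounds.
- by move=> n; rewrite ler_nat tail_count_homo.
move=> e e0; have e2 : 0 < e / 2 by rewrite divr_gt0.
have lower : \forall j \near \oo, (tail_mass b k - e) * (j.+1 ^ 2)%N%:R <=
    (tail_count s b nl k (size_ j))%:R.
  apply: (count_ge gamma_gt0 gamma_lt1 p_rv
    (fun l e l0 => s_good b l k false l0 e) (B := fun n x => (k <= degree s b nl n x)%N)) e0.
  by move=> n l x /(good_at_degree nl)[v [qv [-> _]]].
(* The masses of a pattern and of its complement sum to 1, so the upper bound
   is the lower bound for the complementary pattern. *)
have upper : \forall j \near \oo, (pattern_mass p gamma b (predC (distinct_ge k)) - e / 2) *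
    (j.+1 ^ 2)%N%:R <=
    (count_visited s (size_ j) (predC (fun x => (k <= degree s b nl (size_ j) x)%N)))%:R.
  apply: (count_ge gamma_gt0 gamma_lt1 p_rv
    (fun l e l0 => s_good b l k true l0 e)
    (B := fun n => predC (fun x => (k <= degree s b nl n x)%N))) e2.
  by move=> n l x /(good_at_degree nl)[v [/= qv [-> _]]].
have range := range_le gamma_gt0 gamma_lt1 s_gt0 s_range e2.
near=> j; apply/andP; split; first by near: j; exact: lower.
have h1 : (pattern_mass p gamma b (predC (distinct_ge k)) - e / 2) * (j.+1 ^ 2)%N%:R <=
    (count_visited s (size_ j) (predC (fun x => (k <= degree s b nl (size_ j) x)%N)))%:R.
  by near: j; exact: upper.
have h2 : (nrange s (size_ j))%:R <= (1 + e / 2) * (j.+1 ^ 2)%N%:R :> R.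
  by near: j; exact: range.
have h3 : (tail_count s b nl k (size_ j))%:R +
   (count_visited s (size_ j) (predC (fun x => (k <= degree s b nl (size_ j) x)%N)))%:R =
   (nrange s (size_ j))%:R :> R.
  by rewrite -natrD nrangeE /tail_count /count_visited count_predC count_predT.
rewrite pattern_massC // -/(tail_mass b k) in h1; lra.
Unshelve. all: by end_near. Qed.

(** At k = 0 the tail count is the range and the mass is 1; dividing by this case replaces the mean
    range by the actual one. *)
Lemma tail_count_nrange b nl k :
  (tail_count s b nl k n)%:R / (nrange s n)%:R @[n --> \oo] --> tail_mass b k.
Proof.
have H1 := @tail_count_mean_range b nl k; have H0 := @tail_count_mean_range b nl 0.
rewrite tail_mass0 in H0.
have H : ((tail_count s b nl k n)%:R / mean_range p n) *
    ((tail_count s b nl 0 n)%:R / mean_range p n)^-1 @[n --> \oo] --> tail_mass b k * 1^-1.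
  by apply: cvgM => //; apply: cvgV => //; exact: oner_neq0.
rewrite invr1 mulr1 in H; apply: cvg_trans H; apply: near_eq_cvg; near=> n.
have n0 : (0 < n)%N by near: n; exact: nbhs_infty_gt.
have u0 := mean_range_gt0 p0 p_gt0 p_homo p_summable p_sum1 n0.
by rewrite tail_count0 invf_div mulrA divfK // gt_eqF.
Unshelve. all: by end_near. Qed.

End TypicalPath.

(** * Frequencies and limiting masses as differences of tails, and almost sure convergence *)

Lemma nneseries_telescope (R : realType) (a : nat -> R) k :
  a n @[n --> \oo] --> (0 : R) ->
  (\sum_(k <= l <oo) (a l - a l.+1)%:E)%E = (a k)%:E.
Proof.
move=> a0; apply/cvg_lim => //.
have H : (a k - a n)%:E @[n --> \oo] --> (a k)%:E.
  apply: cvg_EFin; first exact: nearW.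
  rewrite -[X in _ --> X]subr0; apply: cvgB => //; exact: cvg_cst.
apply: cvg_trans H; apply: near_eq_cvg; near=> n.
have kn : (k <= n)%N by near: n; exact: nbhs_infty_ge.
rewrite sumEFin; congr (_%:E).
rewrite -[LHS]opprB -telescope_sumr // -sumrN; apply: eq_bigr => l _.
by rewrite opprB.
Unshelve. all: by end_near. Qed.

Lemma nneseries1_ssum (R : realType) (f : nat -> R) :
  (forall l, 0 <= f l) -> f 0 = 0 -> summable_seq f ->
  (\sum_(1 <= l <oo) (f l)%:E)%E = (ssum f)%:E.
Proof.
move=> f0 f00 sf; rewrite -nneseries_ssum // nneseries_recl //.
  by rewrite f00 add0e.
by move=> l _; rewrite lee_fin.
Qed.

Section Frequencies.
Variables (R : realType) (s : nat -> nat).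

Definition degree_frequency b nl n k : R :=
  (tail_count s b nl k n)%:R / (nrange s n)%:R -
  (tail_count s b nl k.+1 n)%:R / (nrange s n)%:R.

Lemma degree_frequencyE b nl n k (A : set nat) :
  (forall x, A x <-> (x \in visited s n) && (degree s b nl n x == k)) ->
  (card_nat A)%:R / (nrange s n)%:R = degree_frequency b nl n k.
Proof.
move=> /card_degree_eq/(congr1 (fun m => m%:R : R)).
rewrite natrD => /(canRL (addrK _)) ->.
by rewrite mulrBl.
Qed.

Lemma rout_noloopE n k : rout_noloop s R n k = degree_frequency false true n k.
Proof.
apply: degree_frequencyE => x; rewrite /= Dout_noloopE V_visited.
by split=> [[-> ->]|/andP[-> /eqP ->]] //; rewrite eqxx.
Qed.

Lemma rbar_noloopE n k : rbar_noloop s R n k = degree_frequency true true n k.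
Proof.
apply: degree_frequencyE => x; rewrite /= Dbar_noloopE V_visited.
by split=> [[-> ->]|/andP[-> /eqP ->]] //; rewrite eqxx.
Qed.

Lemma rbarE n k : rbar s R n k = degree_frequency true false n k.
Proof.
apply: degree_frequencyE => x; rewrite /= DbarE V_visited.
by split=> [[-> ->]|/andP[-> /eqP ->]] //; rewrite eqxx.
Qed.

Lemma routE n k : (0 < k)%N -> rout s R n k = degree_frequency false false n k.
Proof.
move=> k0; apply: degree_frequencyE => x; rewrite /= DoutE V_visited.
split=> [[xv ->]|/andP[_ /eqP dk]]; last first.
  by split => //; apply: (@degree_gt0_visited _ false); rewrite dk.
rewrite eqxx andbT; case: n xv => // n; exact: visited_homo.
Qed.

Lemma sum_degree_frequency b nl n k :
  (\sum_(k <= l <oo) (degree_frequency b nl n l)%:E)%E =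
  ((tail_count s b nl k n)%:R / (nrange s n)%:R)%:E.
Proof.
apply: (@nneseries_telescope _
  (fun l => (tail_count s b nl l n)%:R / (nrange s n)%:R)).
apply: cvg_near_cst; near=> l.
rewrite tail_count_eq0 ?mul0r //; near: l; exact: nbhs_infty_gt.
Unshelve. all: by end_near. Qed.

End Frequencies.

Section LimitMasses.
Variable R : realType.
Variable p : nat -> R.
Hypothesis p0 : p 0 = 0.
Hypothesis p_gt0 : forall x, (0 < x)%N -> 0 < p x.
Hypothesis p_summable : summable_seq p.
Hypothesis p_sum1 : ssum p = 1.
Variable gamma : R.
Hypothesis gamma_gt0 : 0 < gamma.
Hypothesis gamma_lt1 : gamma < 1.

Let p_ge0 := p_ge0' p0 p_gt0.

Lemma mean_pattern_distinct (b : bool) k l : mean_pattern p b (distinct_ge k) l =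
  expect p (iota 1 (b.+1 * l)) (fun s => (k <= nrange s (b.+1 * l))%N%:R) (fun=> 0).
Proof.
rewrite /mean_pattern -[in LHS](size_iota 1 (b.+1 * l)).
rewrite -(expect_map p_summable p_sum1 (fun=> 0) (iota_uniq 1 (b.+1 * l))
  (iota_uniq 1 (b.+1 * l)) (subseq_refl _)); last exact: bounded_bool.
by apply: expect_ext => s; rewrite nrangeE /count_visited count_predT.
Qed.

Lemma mean_pattern_small (b : bool) k l : (b.+1 * l < k)%N ->
  mean_pattern p b (distinct_ge k) l = 0.
Proof.
move=> lk; rewrite mean_pattern_distinct -[RHS](expect_cst p_summable p_sum1 (iota 1 (b.+1 * l)) 0 (fun=> 0)).
apply: expect_ext => s; rewrite nrangeE leqNgt.
by rewrite (leq_ltn_trans (count_visited_le _ _ _) lk).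
Qed.

(** A word of length (b + 1) l has at most that many distinct letters. For k >= (b + 1) L the terms
    with l < L vanish, and the others have total Sibuya mass at most [e]. *)
Lemma tail_mass_cvg0 (b : bool) : tail_mass p gamma b k @[k --> \oo] --> (0 : R).
Proof.
apply/cvgrPdist_le => e e0.
have [L HL] := sibuya_mass_partial_ge gamma_gt0 gamma_lt1 e0.
exists (b.+1 * L)%N => // k /= Lk.
have /andP[t0 _] := tail_mass_bounds p0 p_gt0 p_summable p_sum1 gamma_gt0 gamma_lt1 b k.
rewrite sub0r normrN ger0_norm //.
pose f l := sibuya_mass gamma l * mean_pattern p b (distinct_ge k) l.
have f0 l : 0 <= f l.
  have /andP[m0 _] := mean_pattern_bounds p0 p_gt0 p_summable p_sum1 b (distinct_ge k) l.
  by rewrite mulr_ge0 // sibuya_mass_ge0.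
have fL l : (l < L)%N -> f l = 0.
  move=> lL; rewrite /f mean_pattern_small ?mulr0 //.
  by rewrite (leq_trans _ Lk) // ltn_pmul2l.
apply: ssum_le_bound; first exact: pattern_mass_summable.
move=> n; rewrite -/f.
apply: (@le_trans _ _ (\sum_(l < L + n) f l)).
  rewrite addnC big_split_ord /= lerDl; exact: sumr_ge0.
rewrite big_split_ord /= big1 ?add0r; last by move=> l _; rewrite fL //=.
have := sibuya_mass_partial_le1 gamma_gt0 gamma_lt1 (L + n).
rewrite big_split_ord /= => H.
suff : \sum_(i < n) f (L + i)%N <= \sum_(i < n) sibuya_mass gamma (L + i)%N by lra.
apply: ler_sum => i _.
have /andP[_ m1] := mean_pattern_bounds p0 p_gt0 p_summable p_sum1 b (distinct_ge k) (L + i).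
by rewrite /f ler_piMr // sibuya_mass_ge0.
Qed.

Lemma tail_massB (b : bool) k : tail_mass p gamma b k - tail_mass p gamma b k.+1 =
  ssum (fun l => sibuya_mass gamma l *
    expect p (iota 1 (b.+1 * l)) (fun s => (nrange s (b.+1 * l) == k)%:R) (fun=> 0)).
Proof.
rewrite -ssumB; [|exact: pattern_mass_summable..].
congr ssum; apply/funext => l; rewrite -mulrBr !mean_pattern_distinct.
rewrite -(expectB p_ge0) //; [|exact: bounded_bool..].
congr (_ * _); apply: expect_ext => s.
by rewrite [(k <= _)%N]leq_eqVlt eq_sym; case: eqP => [<-|_] /=; rewrite ?ltnn ?subr0 ?subrr.
Qed.

End LimitMasses.

Section AlmostSure.
Context (d : measure_display) (T : measurableType d) (R : realType).
Context (P : probability T R) (pi : nat -> R) (xi : nat -> {RV P >-> nat}).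
Context (gamma : R).
Hypothesis pi_gt0 : forall i, (1 <= i)%N -> 0 < pi i.
Hypothesis pi_homo : forall i j, (1 <= i)%N -> (i <= j)%N -> pi j <= pi i.
Hypothesis pi_sum1 : (\sum_(1 <= i <oo) (pi i)%:E)%E = 1%E.
Hypothesis gamma_gt0 : 0 < gamma.
Hypothesis gamma_lt1 : gamma < 1.
Hypothesis pi_rv : regularly_varying pi (- gamma^-1).
Hypothesis xi_iid : iid_samples pi xi.

Notation p := (law pi).
Let p0 : p 0 = 0 := erefl.
Let p_gt0 : forall x, (0 < x)%N -> 0 < p x := law_gt0 pi_gt0.
Let p_homo : forall x y, (0 < x)%N -> (x <= y)%N -> p y <= p x := law_homo pi_homo.
Let p_summable : summable_seq p := law_summable pi_gt0 pi_sum1.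
Let p_sum1 : ssum p = 1 := law_sum1 pi_gt0 pi_sum1.

Lemma ae_concentrates c (Q : nat -> (nat -> nat) -> pred nat) :
  (forall n s x, Q n s x -> x \in visited s n) ->
  (forall n s i x, (1 <= i <= n)%N -> Q n s x != Q n (upd s i 0) x ->
    exists j, [/\ j \in [:: i.-1; i; i.+1], near_rare s n c j & s j = x]) ->
  (forall n s t, (forall i, (1 <= i <= n)%N -> s i = t i) -> Q n s =1 Q n t) ->
  {ae P, forall w, concentrates p0 p_gt0 p_homo p_summable p_sum1 Q (sample_path xi w)}.
Proof.
move=> Qv Ql Qe.
have ei i : 0 < (i.+1%:R : R)^-1 by rewrite invr_gt0.
have := ae_foralln (fun i => ae_concentration pi_gt0 pi_homo pi_sum1 xi_iid Qv Ql Qe (ei i)).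
apply: filterS => w H e e0.
have := H (Num.truncn e^-1); apply: filterS => j /lt_le_trans; apply.
rewrite ler_wpM2r // -[leRHS]invrK lef_pV2 ?posrE ?invr_gt0 //.
exact/ltW/truncnS_gt.
Qed.

Lemma ae_typical : {ae P, forall w,
  typical p0 p_gt0 p_homo p_summable p_sum1 (sample_path xi w)}.
Proof.
have H1 : {ae P, forall w, concentrates p0 p_gt0 p_homo p_summable p_sum1
    (fun n s x => (x != 0%N) && (x \in visited s n)) (sample_path xi w)}.
  apply: (@ae_concentrates 1).
  - by move=> n s x /andP[].
  - by move=> n s i x; exact: visited_local.
  - by move=> n s t st x; rewrite (visited_ext st).
(* [ae_foralln] intersects over naturals, so the two booleans are coded by parities. *)
have H2 b l k neg : {ae P, forall w, (0 < l)%N ->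
    concentrates p0 p_gt0 p_homo p_summable p_sum1
      (fun n => good_at (odd b) l n (signed_distinct_ge k (odd neg))) (sample_path xi w)}.
  case: (posnP l) => [->|l0]; first exact: aeW.
  have := @ae_concentrates l.+1
    (fun n => good_at (odd b) l n (signed_distinct_ge k (odd neg))).
  move=> /(_ _ _ _)/filterS; apply => //.
  - by move=> n s x; exact: good_at_visited.
  - by move=> n s i x; exact: good_at_local.
  - by move=> n s t st x; exact: good_at_ext.
have H3 := ae_foralln (fun b => ae_foralln (fun l => ae_foralln (fun k =>
  ae_foralln (H2 b l k)))).
move: H1 H3; apply: filterS2 => w h1 h3; split=> //.
- by move=> i i1; have [xi1 _ _ _] := xi_iid; exact: xi1.
- by move=> b l k neg; have := h3 b l k neg; rewrite !oddb.
Qed.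

Lemma limit_massE (b : bool) k :
  (\sum_(1 <= l <oo) ((sibuya gamma l)%:E *
     P [set w | nrange (sample_path xi w) (b.+1 * l)%N = k]))%E =
  (tail_mass p gamma b k - tail_mass p gamma b k.+1)%:E.
Proof.
pose f l := sibuya_mass gamma l *
  expect p (iota 1 (b.+1 * l)) (fun s => (nrange s (b.+1 * l) == k)%:R) (fun=> 0).
have E01 l : 0 <= expect p (iota 1 (b.+1 * l)) (fun s => (nrange s (b.+1 * l) == k)%:R) (fun=> 0) <= 1.
  set g := (fun s => _).
  have bg : bounded_real g by exact: bounded_bool.
  have bc c : bounded_real (fun _ : nat -> nat => c : R) by exact: bounded_cst.
  have ge0 : forall x, 0 <= p x := law_ge0 pi_gt0.
  have le := le_expect ge0 p_summable p_sum1 (iota 1 (b.+1 * l)) (fun=> 0).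
  have cst c := expect_cst p_summable p_sum1 (iota 1 (b.+1 * l)) c (fun=> 0).
  apply/andP; split; [rewrite -[leLHS](cst 0)|rewrite -[leRHS](cst 1)]; apply: le => // s.
  by rewrite /g lern1 leq_b1.
have f0 l : 0 <= f l.
  by have /andP[E0 _] := E01 l; rewrite mulr_ge0 // sibuya_mass_ge0.
rewrite tail_massB // -/f -nneseries1_ssum //; last 2 first.
- by rewrite /f mul0r.
- apply: (@summable_le _ _ (sibuya_mass gamma)); last exact: sibuya_mass_summable.
  move=> l; rewrite ger0_norm //; have /andP[_ E1] := E01 l.
  by rewrite /f ler_piMr // sibuya_mass_ge0.
apply/congr_lim/funext => n; apply: eq_big_nat => l /andP[l0 _].
have A_local s t : (forall i, (1 <= i <= b.+1 * l)%N -> s i = t i) ->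
    (nrange s (b.+1 * l) == k) = (nrange t (b.+1 * l) == k).
  by move=> st; rewrite !nrangeE /count_visited (visited_ext st).
have := path_prob pi_gt0 pi_sum1 xi_iid A_local.
rewrite (_ : [set w | _] = [set w | nrange (sample_path xi w) (b.+1 * l)%N = k]); last first.
  by apply/seteqP; split => w /= /eqP.
move=> ->; rewrite -EFinM sibuyaE // /f; by case: (l) l0.
Qed.

Lemma rout_limE k : rout_lim gamma xi k =
  (tail_mass p gamma false k - tail_mass p gamma false k.+1)%:E.
Proof. by rewrite -limit_massE; apply: eq_eseriesr => l _; rewrite mul1n. Qed.

Lemma rbar_limE k : rbar_lim gamma xi k =
  (tail_mass p gamma true k - tail_mass p gamma true k.+1)%:E.
Proof. by rewrite -limit_massE. Qed.

Lemma ae_degree_frequency b nl k :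
  {ae P, forall w, (degree_frequency R (sample_path xi w) b nl n k)%:E @[n --> \oo] -->
    (tail_mass p gamma b k - tail_mass p gamma b k.+1)%:E}.
Proof.
move: ae_typical; apply: filterS => w tw.
have lim j := @tail_count_nrange _ _ p0 p_gt0 p_homo p_summable p_sum1 _ gamma_gt0 gamma_lt1
  (law_rv pi_rv) _ tw b nl j.
apply: cvg_EFin; first exact: nearW.
exact: cvgB (lim k) (lim k.+1).
Qed.

Lemma ae_degree_tail b nl k :
  {ae P, forall w,
    (\sum_(k <= l <oo) (degree_frequency R (sample_path xi w) b nl n l)%:E)%E
      @[n --> \oo] -->
    (\sum_(k <= l <oo) (tail_mass p gamma b l - tail_mass p gamma b l.+1)%:E)%E}.
Proof.
move: ae_typical; apply: filterS => w tw.
have lim j := @tail_count_nrange _ _ p0 p_gt0 p_homo p_summable p_sum1 _ gamma_gt0 gamma_lt1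
  (law_rv pi_rv) _ tw b nl j.
rewrite nneseries_telescope; last exact: tail_mass_cvg0.
under eq_fun do rewrite sum_degree_frequency.
by apply: cvg_EFin; [exact: nearW|exact: lim].
Qed.

End AlmostSure.

Theorem proposition2 (d : measure_display) (T : measurableType d)
    (R : realType) (P : probability T R) (pi : nat -> R) (gamma : R)
    (xi : nat -> {RV P >-> nat})
    (pi_gt0 : forall i, (1 <= i)%N -> 0 < pi i)
    (pi_nonincreasing : forall i j, (1 <= i)%N -> (i <= j)%N -> pi j <= pi i)
    (pi_sum1 : (\sum_(1 <= i <oo) (pi i)%:E)%E = 1%E)
    (gamma_gt0 : 0 < gamma) (gamma_lt1 : gamma < 1)
    (pi_rv : regularly_varying pi (- gamma^-1))
    (xi_iid : iid_samples pi xi) :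
  forall k : nat, (1 <= k)%N ->
  [/\ {ae P, forall w, (rout_noloop (sample_path xi w) R n k)%:E
                         @[n --> \oo] --> rout_lim gamma xi k} /\
      {ae P, forall w, (rbar_noloop (sample_path xi w) R n k)%:E
                         @[n --> \oo] --> rbar_lim gamma xi k},
      {ae P, forall w,
         (\sum_(k <= l <oo) (rout_noloop (sample_path xi w) R n l)%:E)%E
           @[n --> \oo] --> (\sum_(k <= l <oo) rout_lim gamma xi l)%E} /\
      {ae P, forall w,
         (\sum_(k <= l <oo) (rbar_noloop (sample_path xi w) R n l)%:E)%E
           @[n --> \oo] --> (\sum_(k <= l <oo) rbar_lim gamma xi l)%E} &
      {ae P, forall w, (rout (sample_path xi w) R n k)%:E
                         @[n --> \oo] --> rout_lim gamma xi k} /\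
      {ae P, forall w, (rbar (sample_path xi w) R n k)%:E
                         @[n --> \oo] --> rbar_lim gamma xi k}].
Proof.
move=> k k1.
have freq b nl := @ae_degree_frequency _ _ _ _ _ _ _ pi_gt0 pi_nonincreasing pi_sum1
  gamma_gt0 gamma_lt1 pi_rv xi_iid b nl k.
have tail b nl := @ae_degree_tail _ _ _ _ _ _ _ pi_gt0 pi_nonincreasing pi_sum1
  gamma_gt0 gamma_lt1 pi_rv xi_iid b nl k.
have outE := rout_limE pi_gt0 pi_sum1 gamma_gt0 gamma_lt1 xi_iid.
have barE := rbar_limE pi_gt0 pi_sum1 gamma_gt0 gamma_lt1 xi_iid.
split; split.
- move: (freq false true); apply: filterS => w; rewrite outE.
  by apply: cvg_trans; apply: near_eq_cvg; apply: nearW => n; rewrite rout_noloopE.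
- move: (freq true true); apply: filterS => w; rewrite barE.
  by apply: cvg_trans; apply: near_eq_cvg; apply: nearW => n; rewrite rbar_noloopE.
- move: (tail false true); apply: filterS => w; rewrite (eq_eseriesr (fun l _ => outE l)).
  apply: cvg_trans; apply: near_eq_cvg; apply: nearW => n.
  by apply: eq_eseriesr => l _; rewrite rout_noloopE.
- move: (tail true true); apply: filterS => w; rewrite (eq_eseriesr (fun l _ => barE l)).
  apply: cvg_trans; apply: near_eq_cvg; apply: nearW => n.
  by apply: eq_eseriesr => l _; rewrite rbar_noloopE.
(* The retained loops correspond to [nl = false]; the limit in [freq] is the same for both values of
   [nl]. *)
- move: (freq false false); apply: filterS => w; rewrite outE.
  by apply: cvg_trans; apply: near_eq_cvg; apply: nearW => n; rewrite routE.
- move: (freq true false); apply: filterS => w; rewrite barE.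
  by apply: cvg_trans; apply: near_eq_cvg; apply: nearW => n; rewrite rbarE.
Qed.
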